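(* If $0<\alpha\leq\frac{2}{3}$, then $$\|\mathcal{H}\|_{H_\alpha^\infty\rightarrow\mathcal{B}^{\alpha+1}}=\int_{0}^{1}\frac{1}{(1-t^2)^\alpha}\,dt+\frac{2\alpha\pi}{\sin\alpha\pi}.$$ If $\frac{2}{3}<\alpha<1$, then $$\int_{0}^{1}\frac{1}{(1-t^2)^\alpha}\,dt+\frac{2\alpha\pi}{\sin\alpha\pi}\leq\|\mathcal{H}\|_{H_\alpha^\infty\rightarrow\mathcal{B}^{\alpha+1}}\leq\int_{0}^{1}\frac{1}{(1-t^2)^\alpha}\,dt+2\int_{0}^{1}\frac{(1-t)^{1-\alpha}}{t^\alpha}\,dt.$$ If $\alpha\geq1$, then $\mathcal{H}:H^\infty_\alpha\rightarrow\mathcal{B}^{\alpha+1}$ is not a bounded operator.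
   Context: $\mathbb{D}$ is the open unit disk in $\mathbb{C}$ and $H(\mathbb{D})$ is the set of analytic functions on $\mathbb{D}$. For $\alpha>0$, the Korenblum space $H^\infty_\alpha$ is the space of all $f\in H(\mathbb{D})$ with $\|f\|_{H^\infty_\alpha}=\sup_{z\in\mathbb{D}}(1-|z|^2)^\alpha|f(z)|<\infty$. For $0<\beta<\infty$, the $\beta$-Bloch space $\mathcal{B}^\beta$ consists of those $f\in H(\mathbb{D})$ with $$\|f\|_{\mathcal{B}^\beta}=|f(0)|+\sup_{z\in\mathbb{D}}(1-|z|^2)^{\beta}|f'(z)|<\infty.$$ The Hilbert matrix operator $\mathcal{H}$ acts on $f(z)=\sum_{k\ge 0}a_kz^k\in H(\mathbb{D})$ by $$\mathcal{H}f(z)=\sum_{n=0}^\infty\left(\sum_{k=0}^\infty\frac{a_k}{n+k+1}\right)z^n,$$ whenever the right-hand side makes sense and defines an analytic function in $\mathbb{D}$. For normed spaces $X,Y$ of analytic functions, $\|\mathcal{H}\|_{X\to Y}=\sup\{\|\mathcal{H}f\|_Y:\ f\in X,\ \|f\|_X\le 1\}$. ''$\mathcal{H}:X\to Y$ is a bounded operator'' means that $\mathcal{H}f$ is defined and belongs to $Y$ for every $f\in X$, and $\|\mathcal{H}\|_{X\to Y}<\infty$; ''not a bounded operator'' is the negation of this. *)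

(* Defs.v *)
From Stdlib Require Import Reals.
From Coquelicot Require Import Coquelicot.
Open Scope R_scope.

Definition in_disk (z : C) : Prop := Cmod z < 1.

(* Functions on the disk are total functions [C -> C]; every notion below only
   depends on their values on the disk. *)
Definition analytic_on_disk (f : C -> C) : Prop :=
  forall z : C, in_disk z -> @ex_derive C_AbsRing C_NormedModule f z.

Definition sup_disk (h : C -> R) : Rbar :=
  Lub_Rbar (fun x => exists z : C, in_disk z /\ x = h z).

(* On the disk [1 - Cmod z ^ 2 > 0], so [Rpower] is the usual real power. *)
Definition korenblum_norm (alpha : R) (f : C -> C) : Rbar :=
  sup_disk (fun z => Rpower (1 - Cmod z ^ 2) alpha * Cmod (f z)).

Definition bloch_norm (beta : R) (f : C -> C) : Rbar :=
  Rbar_plus (Cmod (f (RtoC 0)))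
    (sup_disk (fun z => Rpower (1 - Cmod z ^ 2) beta * Cmod (C_derive f z))).

(* Members of the space of analytic functions on which the extended-valued
   norm [N] is finite. *)
Definition in_space (N : (C -> C) -> Rbar) (f : C -> C) : Prop :=
  analytic_on_disk f /\ Rbar_lt (N f) p_infty.

(* "[H f] is defined and equals [g] on the disk".  The inner series need not
   converge absolutely; [is_series] is the limit of the partial sums. *)
Definition is_hilbert (f g : C -> C) : Prop :=
  exists a b : nat -> C,
    (forall z : C, in_disk z -> @is_pseries C_AbsRing C_NormedModule a z (f z)) /\
    (forall n : nat,
       @is_series C_AbsRing C_NormedModule
         (fun k => Cdiv (a k) (RtoC (INR (n + k + 1)))) (b n)) /\
    (forall z : C, in_disk z -> @is_pseries C_AbsRing C_NormedModule b z (g z)) /\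
    analytic_on_disk g.

Definition hilbert_norm (NX NY : (C -> C) -> Rbar) : Rbar :=
  Rbar_lub (fun y => exists f g : C -> C,
    in_space NX f /\ Rbar_le (NX f) 1 /\ is_hilbert f g /\ y = NY g).

Definition hilbert_bounded (NX NY : (C -> C) -> Rbar) : Prop :=
  (forall f : C -> C, in_space NX f ->
     exists g : C -> C, is_hilbert f g /\ in_space NY g) /\
  Rbar_lt (hilbert_norm NX NY) p_infty.

(* Improper Riemann integral over the open interval (0,1). *)
Definition integral01 (h : R -> R) : R := RInt_gen h (at_right 0) (at_left 1).

(* Main.v *)
Require Import Defs.
From Stdlib Require Import Reals.
From Coquelicot Require Import Coquelicot.
From Stdlib Require Import Lra Lia IndefiniteDescription.
Open Scope R_scope.

(* Since f is only assumed complex differentiable, its Taylor expansion comes from Goursat's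
   bisection argument.  For alpha < 1 the partial sums of the Taylor coefficients a_k of f grow
   slower than k^s for some s < 1, so the series sum_k a_k / (n + k + 1) converge by Abel summation.

   Moving the path of integration in (H f)'(z) = int_0^1 t f(t) / (1 - t z)^2 dt from the segment to
   phi_z(s) = s / (1 - (1 - s) z) gives (H f)'(z) = 1 / (1 - z) int_0^1 phi_z(s) f(phi_z(s)) ds; both
   paths end at the boundary point 1, so this is done for the dilations f(rho z), and rho tends to 1.
   As |phi_z(s)| <= phi_|z|(s), the growth of f bounds the integrand, weighted by
   (1 - |z|^2)^(alpha+1), pointwise by 2 s^alpha (1 - s)^(-alpha) when alpha <= 2/3 and by
   2 s^(1-alpha) (1 - s)^(-alpha) when alpha >= 1/2.

   The function (1 - z^2)^(-alpha) has norm 1, attains the bound for |H f(0)|, and for z = r -> 1 its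
   weighted derivative tends to 2 int_0^1 s^alpha (1 - s)^(-alpha) ds = 2 alpha pi / sin (alpha pi),
   an instance of the reflection formula, which follows from the partial fractions of the cosecant.
   For alpha >= 1 the function 1 / (1 - z) has a_k = 1 and the harmonic series diverges. *)

(** The moments of f need not converge absolutely, so sums and integrals cannot be exchanged for f
    itself. For a dilation everything converges uniformly up to the boundary point 1 and the growth
    bound is inherited; Abel's theorem then recovers each moment in the limit, and the dilated
    moments are bounded uniformly in [rho] and [n], which carries the limit through the series of
    the derivative.

    Moving the path takes no deformation of contours: it is done on monomials, whose integrands have
    an explicit complex primitive.

    Improper integrals occur only for nonnegative integrands, as suprema over compact subintervals;
    this is why the estimates are stated for every [u, v] inside (0, 1).

    The value 2/3 is the point up to which the weighted kernel stays below its limit as z = r -> 1.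
    For alpha > 2/3 and small s it exceeds that limit for some r < 1; a cruder majorant replaces it
    and the two bounds no longer meet. *)

(** * Limits of complex-valued functions *)

(** Stated through [Cmod] because [C] carries two uniform structures, the product one and that of
    [C_AbsRing]. [Clim_filterlim] links it to the former, [Cnear] to the latter. *)
Definition Clim {T} (F : (T -> Prop) -> Prop) (f : T -> C) (l : C) : Prop :=
  forall eps : posreal, F (fun x => Cmod (f x - l) < eps).

Lemma ball_Rabs (x e y : R) : @ball R_UniformSpace x e y -> Rabs (y - x) < e.
Proof. auto. Qed.

Lemma Rabs_ball (x e y : R) : Rabs (y - x) < e -> @ball R_UniformSpace x e y.
Proof. auto. Qed.

Lemma Rlim0 {T} (F : (T -> Prop) -> Prop) {FF : Filter F} (h : T -> R) :
  filterlim h F (locally 0) <-> forall eps : posreal, F (fun x => Rabs (h x) < eps).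
Proof.
  split.
  - intros H eps. apply (H (fun y => Rabs y < eps)). exists eps. intros y Hy.
    apply ball_Rabs in Hy. now rewrite Rminus_0_r in Hy.
  - intros H P [eps HP]. unfold filtermap. apply (filter_imp (fun x => Rabs (h x) < eps));
      [|apply H].
    intros x Hx. apply HP, Rabs_ball. now rewrite Rminus_0_r.
Qed.

Lemma Clim_iff {T} (F : (T -> Prop) -> Prop) {FF : Filter F} f l :
  Clim F f l <-> filterlim (fun x => Cmod (f x - l)) F (locally 0).
Proof.
  rewrite (Rlim0 F). unfold Clim. split; intros H eps; generalize (H eps); apply filter_imp;
    intros x;
  rewrite Rabs_pos_eq; auto using Cmod_ge_0.
Qed.

Lemma Clim_filterlim {T} (F : (T -> Prop) -> Prop) {FF : Filter F} f l :
  Clim F f l <-> filterlim f F (@locally C_UniformSpace l).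
Proof.
  split.
  - intros H P HP. apply locally_C in HP. destruct HP as [eps HP].
    unfold filtermap. generalize (H eps). apply filter_imp. intros x Hx. apply HP. exact Hx.
  - intros H eps. apply (H (fun y => Cmod (y - l) < eps)). apply locally_C.
    exists eps. intros y Hy. exact Hy.
Qed.

Lemma Clim_imp {T} (F : (T -> Prop) -> Prop) {FF : Filter F} f g l :
  F (fun x => f x = g x) -> Clim F f l -> Clim F g l.
Proof.
  intros E H eps. generalize (filter_and _ _ E (H eps)). apply filter_imp.
  intros x [e h]. now rewrite <- e.
Qed.

Lemma Clim_ext {T} (F : (T -> Prop) -> Prop) {FF : Filter F} f g l :
  (forall x, f x = g x) -> Clim F f l -> Clim F g l.
Proof. intros E. apply (Clim_imp F). apply filter_forall, E. Qed.

Lemma Clim_squeeze {T} (F : (T -> Prop) -> Prop) {FF : Filter F} f l g :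
  F (fun x => Cmod (f x - l) <= g x) -> filterlim g F (locally 0) -> Clim F f l.
Proof.
  intros B H eps. generalize (filter_and _ _ B (proj1 (Rlim0 F g) H eps)).
  apply filter_imp. intros x [h1 h2]. apply Rle_lt_trans with (1 := h1).
  apply Rle_lt_trans with (2 := h2). apply Rle_abs.
Qed.

Lemma Clim_const {T} (F : (T -> Prop) -> Prop) {FF : Filter F} (c : C) :
  Clim F (fun _ => c) c.
Proof.
  intros eps. apply filter_forall. intros _.
  replace (c - c)%C with (RtoC 0) by ring. rewrite Cmod_0. apply cond_pos.
Qed.

Lemma Clim_plus {T} (F : (T -> Prop) -> Prop) {FF : Filter F} f g l m :
  Clim F f l -> Clim F g m -> Clim F (fun x => f x + g x)%C (l + m)%C.
Proof.
  intros Hf Hg eps.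
  generalize (filter_and _ _ (Hf (pos_div_2 eps)) (Hg (pos_div_2 eps))). apply filter_imp.
  intros x [h1 h2]. simpl in h1, h2.
  replace (f x + g x - (l + m))%C with ((f x - l) + (g x - m))%C by ring.
  apply Rle_lt_trans with (1 := Cmod_triangle _ _). lra.
Qed.

Lemma Clim_bounded {T} (F : (T -> Prop) -> Prop) {FF : Filter F} f l :
  Clim F f l -> F (fun x => Cmod (f x) <= Cmod l + 1).
Proof.
  intros Hf. generalize (Hf (mkposreal 1 Rlt_0_1)). apply filter_imp. intros x h. simpl in h.
  replace (f x) with ((f x - l) + l)%C by ring.
  apply Rle_trans with (1 := Cmod_triangle _ _). lra.
Qed.

Lemma Clim_mult {T} (F : (T -> Prop) -> Prop) {FF : Filter F} f g l m :
  Clim F f l -> Clim F g m -> Clim F (fun x => f x * g x)%C (l * m)%C.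
Proof.
  intros Hf Hg eps.
  assert (H0 : 0 < Cmod l + 1) by (generalize (Cmod_ge_0 l); lra).
  assert (H1 : 0 < Cmod m + 1) by (generalize (Cmod_ge_0 m); lra).
  assert (e1 : 0 < eps / 2 / (Cmod m + 1)).
  { apply Rdiv_lt_0_compat; [apply (cond_pos (pos_div_2 eps))|lra]. }
  assert (e2 : 0 < eps / 2 / (Cmod l + 1)).
  { apply Rdiv_lt_0_compat; [apply (cond_pos (pos_div_2 eps))|lra]. }
  generalize (filter_and _ _ (filter_and _ _ (Hf (mkposreal _ e1)) (Hg (mkposreal _ e2)))
     (Clim_bounded F f l Hf)). apply filter_imp.
  intros x [[h1 h2] h3]. simpl in h1, h2.
  replace (f x * g x - l * m)%C with ((f x - l) * m + f x * (g x - m))%C by ring.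
  apply Rle_lt_trans with (1 := Cmod_triangle _ _). rewrite !Cmod_mult.
  assert (A : Cmod (f x - l) * Cmod m <= eps / 2 / (Cmod m + 1) * (Cmod m + 1)).
  { apply Rmult_le_compat; auto using Cmod_ge_0; lra. }
  assert (B : Cmod (f x) * Cmod (g x - m) < (Cmod l + 1) * (eps / 2 / (Cmod l + 1))).
  { apply Rle_lt_trans with ((Cmod l + 1) * Cmod (g x - m)).
    - apply Rmult_le_compat_r; auto using Cmod_ge_0.
    - apply Rmult_lt_compat_l; auto. }
  replace (eps / 2 / (Cmod m + 1) * (Cmod m + 1)) with (eps / 2) in A by (field; lra).
  replace ((Cmod l + 1) * (eps / 2 / (Cmod l + 1))) with (eps / 2) in B by (field; lra).
  lra.
Qed.

Lemma Clim_opp {T} (F : (T -> Prop) -> Prop) {FF : Filter F} f l :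
  Clim F f l -> Clim F (fun x => - f x)%C (- l)%C.
Proof.
  intros Hf eps. generalize (Hf eps). apply filter_imp. intros x h.
  replace (- f x - - l)%C with (- (f x - l))%C by ring. now rewrite Cmod_opp.
Qed.

Lemma Clim_minus {T} (F : (T -> Prop) -> Prop) {FF : Filter F} f g l m :
  Clim F f l -> Clim F g m -> Clim F (fun x => f x - g x)%C (l - m)%C.
Proof. intros Hf Hg. apply Clim_plus; auto. now apply Clim_opp. Qed.

Lemma Clim_RtoC {T} (F : (T -> Prop) -> Prop) {FF : Filter F} (h : T -> R) l :
  filterlim h F (locally l) -> Clim F (fun x => RtoC (h x)) (RtoC l).
Proof.
  intros H eps. apply (H (fun y => Cmod (RtoC y - RtoC l) < eps)). exists eps. intros y Hy.
  rewrite <- RtoC_minus, Cmod_R. exact Hy.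
Qed.

Lemma im_le_Cmod (c : C) : Rabs (Im c) <= Cmod c.
Proof. apply Rle_trans with (2 := Rmax_Cmod c). apply Rmax_r. Qed.

Lemma re_minus a b : Re (a - b)%C = Re a - Re b.
Proof. unfold Cminus. rewrite re_plus, re_opp. ring. Qed.

Lemma im_minus a b : Im (a - b)%C = Im a - Im b.
Proof. unfold Cminus. rewrite im_plus, im_opp. ring. Qed.

Lemma Rlim_intro {T} (F : (T -> Prop) -> Prop) {FF : Filter F} (h : T -> R) (l : R) :
  (forall eps : posreal, F (fun x => Rabs (h x - l) < eps)) -> filterlim h F (locally l).
Proof.
  intros H P [eps HP]. unfold filtermap. generalize (H eps). apply filter_imp. intros x Hx.
  apply HP. exact Hx.
Qed.

Lemma Rlim_elim {T} (F : (T -> Prop) -> Prop) {FF : Filter F} (h : T -> R) (l : R) :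
  filterlim h F (locally l) -> forall eps : posreal, F (fun x => Rabs (h x - l) < eps).
Proof. intros H eps. apply (H (fun y => Rabs (y - l) < eps)). exists eps. intros y Hy. exact Hy.
Qed.

Lemma Clim_Re {T} (F : (T -> Prop) -> Prop) {FF : Filter F} f l :
  Clim F f l -> filterlim (fun x => Re (f x)) F (locally (Re l)).
Proof.
  intros H. apply Rlim_intro; auto. intros eps. generalize (H eps). apply filter_imp. intros x.
  rewrite <- re_minus. apply Rle_lt_trans, re_le_Cmod.
Qed.

Lemma Clim_Im {T} (F : (T -> Prop) -> Prop) {FF : Filter F} f l :
  Clim F f l -> filterlim (fun x => Im (f x)) F (locally (Im l)).
Proof.
  intros H. apply Rlim_intro; auto. intros eps. generalize (H eps). apply filter_imp. intros x.
  rewrite <- im_minus. apply Rle_lt_trans, im_le_Cmod.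
Qed.

Lemma Cmod_le_Re_Im (c : C) : Cmod c <= Rabs (Re c) + Rabs (Im c).
Proof.
  replace c with (RtoC (Re c) + Ci * RtoC (Im c))%C at 1.
  - apply Rle_trans with (1 := Cmod_triangle _ _). rewrite Cmod_mult, !Cmod_R, Cmod_Ci. lra.
  - destruct c as [x y]. unfold RtoC, Ci, Cplus, Cmult, Re, Im; simpl. f_equal; ring.
Qed.

Lemma Clim_Re_Im {T} (F : (T -> Prop) -> Prop) {FF : Filter F} f l :
  filterlim (fun x => Re (f x)) F (locally (Re l)) ->
  filterlim (fun x => Im (f x)) F (locally (Im l)) -> Clim F f l.
Proof.
  intros H1 H2 eps.
  generalize (filter_and _ _ (Rlim_elim F _ _ H1 (pos_div_2 eps))
    (Rlim_elim F _ _ H2 (pos_div_2 eps))).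
  apply filter_imp. intros x [h1 h2]. simpl in h1, h2.
  apply Rle_lt_trans with (1 := Cmod_le_Re_Im _). rewrite re_minus, im_minus. lra.
Qed.

Lemma Cmod_triangle_inv (a b : C) : Rabs (Cmod a - Cmod b) <= Cmod (a - b).
Proof.
  apply Rabs_le. split.
  - generalize (Cmod_triangle a (b - a)). replace (a + (b - a))%C with b by ring.
    replace (b - a)%C with (- (a - b))%C by ring. rewrite Cmod_opp. lra.
  - generalize (Cmod_triangle b (a - b)). replace (b + (a - b))%C with a by ring. lra.
Qed.

Lemma Clim_Cmod {T} (F : (T -> Prop) -> Prop) {FF : Filter F} f l :
  Clim F f l -> filterlim (fun x => Cmod (f x)) F (locally (Cmod l)).
Proof.
  intros H. apply Rlim_intro; auto. intros eps. generalize (H eps). apply filter_imp. intros x.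
  apply Rle_lt_trans, Cmod_triangle_inv.
Qed.

Lemma Rlim0_scal {T} (F : (T -> Prop) -> Prop) {FF : Filter F} (c : R) (h : T -> R) :
  filterlim h F (locally 0) -> filterlim (fun x => c * h x) F (locally 0).
Proof.
  intros H. rewrite <- (Rmult_0_r c). apply (filterlim_comp _ _ _ _ (fun y => c * y) _ _ _ H).
  apply (filterlim_scal_r (K := R_AbsRing) (V := R_NormedModule)).
Qed.

Lemma Clim_inv {T} (F : (T -> Prop) -> Prop) {FF : Filter F} f l :
  l <> RtoC 0 -> Clim F f l -> Clim F (fun x => / f x)%C (/ l)%C.
Proof.
  intros Hl H. assert (P : 0 < Cmod l) by now apply Cmod_gt_0.
  apply (Clim_squeeze F _ _ (fun x => (2 / (Cmod l * Cmod l)) * Cmod (f x - l))).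
  - generalize (H (pos_div_2 (mkposreal _ P))). apply filter_imp. intros x h. simpl in h.
    assert (Q : Cmod l / 2 < Cmod (f x)).
    { generalize (Cmod_triangle_inv (f x) l). intros q. apply Rabs_le_between in q. lra. }
    assert (N : f x <> RtoC 0) by (apply Cmod_gt_0; lra).
    replace (/ f x - / l)%C with (- (f x - l) * / (f x * l))%C by (field; auto).
    rewrite Cmod_mult, Cmod_opp, Cmod_inv, Cmod_mult by now apply Cmult_neq_0.
    rewrite Rmult_comm. apply Rmult_le_compat_r; auto using Cmod_ge_0.
    replace (2 / (Cmod l * Cmod l)) with (/ (Cmod l / 2 * Cmod l)) by (field; lra).
    apply Rinv_le_contravar; [apply Rmult_lt_0_compat; lra|]. apply Rmult_le_compat_r; lra.
  - apply Clim_iff in H; auto. now apply Rlim0_scal.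
Qed.

Lemma Clim_div {T} (F : (T -> Prop) -> Prop) {FF : Filter F} f g l m :
  m <> RtoC 0 -> Clim F f l -> Clim F g m -> Clim F (fun x => f x / g x)%C (l / m)%C.
Proof. intros Hm Hf Hg. apply Clim_mult; auto. now apply Clim_inv. Qed.

Lemma Clim_pow {T} (F : (T -> Prop) -> Prop) {FF : Filter F} f l n :
  Clim F f l -> Clim F (fun x => f x ^ n)%C (l ^ n)%C.
Proof.
  intros H. induction n; simpl. apply Clim_const; auto. now apply Clim_mult.
Qed.

Lemma Clim_unique {T} (F : (T -> Prop) -> Prop) {FF : ProperFilter F} f l m :
  Clim F f l -> Clim F f m -> l = m.
Proof.
  intros H1 H2. apply Ceq_minus, Cmod_eq_0. apply Rle_antisym; [|apply Cmod_ge_0].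
  apply le_epsilon. intros e He.
  destruct (filter_ex _ (filter_and _ _ (H1 (pos_div_2 (mkposreal e He)))
    (H2 (pos_div_2 (mkposreal e He)))))
    as [x [h1 h2]]. simpl in h1, h2.
  replace (l - m)%C with (- (f x - l) + (f x - m))%C by ring.
  apply Rle_trans with (1 := Cmod_triangle _ _). rewrite Cmod_opp. lra.
Qed.

Lemma Clim_comp {T U} (F : (T -> Prop) -> Prop) (G : (U -> Prop) -> Prop) (h : T -> U) f l :
  filterlim h F G -> Clim G f l -> Clim F (fun x => f (h x)) l.
Proof. intros H Hf eps. apply (H _ (Hf eps)). Qed.

Lemma Clim_Cmod_le {T} (F : (T -> Prop) -> Prop) {FF : ProperFilter F} f l M :
  Clim F f l -> F (fun x => Cmod (f x) <= M) -> Cmod l <= M.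
Proof.
  intros H B. apply le_epsilon. intros e He.
  destruct (filter_ex _ (filter_and _ _ (H (mkposreal e He)) B)) as [x [h1 h2]]. simpl in h1.
  generalize (Cmod_triangle_inv (f x) l). intros q. apply Rabs_le_between in q. lra.
Qed.

Lemma Rlim_le {T} (F : (T -> Prop) -> Prop) {FF : ProperFilter F} (f g : T -> R) (l m : R) :
  F (fun x => f x <= g x) -> filterlim f F (locally l) -> filterlim g F (locally m) -> l <= m.
Proof.
  intros H H1 H2. apply (filterlim_le (F := F) f g l m H); [exact H1|exact H2].
Qed.

(** * Continuity and complex differentiability *)

(** Neighbourhoods for the structure of [C_AbsRing], the one in which the complex [is_derive] is
    expressed. *)
Definition Cnear (z : C) : (C -> Prop) -> Prop := @locally (AbsRing_UniformSpace C_AbsRing) z.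

#[global] Instance Cnear_filter z : ProperFilter (Cnear z)
  := @locally_filter (AbsRing_UniformSpace C_AbsRing) z.

Lemma Cnear_intro z (P : C -> Prop) d :
  0 < d -> (forall w, Cmod (w - z) < d -> P w) -> Cnear z P.
Proof. intros Hd H. exists (mkposreal d Hd). intros w Hw. apply H, Hw. Qed.

Lemma Cnear_elim z (P : C -> Prop) :
  Cnear z P -> exists d, 0 < d /\ forall w, Cmod (w - z) < d -> P w.
Proof. intros [d H]. exists d. split; [apply cond_pos|]. intros w Hw. apply H, Hw. Qed.

Definition Cdiff (f : C -> C) (z l : C) : Prop :=
  forall eps, 0 < eps -> exists d, 0 < d /\
    forall w, Cmod (w - z) < d -> Cmod (f w - f z - l * (w - z)) <= eps * Cmod (w - z).

Lemma Cdiff_is_derive f z l :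
  Cdiff f z l <-> @is_derive C_AbsRing C_NormedModule f z l.
Proof.
  split.
  - intros H. split; [apply is_linear_scal_l|].
    intros x Hx eps. apply (@is_filter_lim_locally_unique C_AbsRing (AbsRing_NormedModule
      C_AbsRing)) in Hx. subst x.
    destruct (H eps (cond_pos eps)) as [d [Hd K]]. exists (mkposreal d Hd). intros w Hw.
    specialize (K w Hw). 
    change (Cmod (f w - f z - (w - z) * l) <= eps * Cmod (w - z)).
    now rewrite (Cmult_comm (w - z)).
  - intros [_ H] eps Heps. specialize (H z (fun P h => h) (mkposreal eps Heps)).
    destruct H as [d K]. exists d. split; [apply cond_pos|]. intros w Hw.
    specialize (K w Hw). change (Cmod (f w - f z - (w - z) * l) <= eps * Cmod (w - z)) in K.
    now rewrite (Cmult_comm l).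
Qed.

Lemma Cdiff_continuous f z l : Cdiff f z l -> Clim (Cnear z) f (f z).
Proof.
  intros H eps. destruct (H 1 Rlt_0_1) as [d [Hd K]].
  assert (P : 0 < Cmod l + 1) by (generalize (Cmod_ge_0 l); lra).
  apply (Cnear_intro z _ (Rmin d (eps / (Cmod l + 1)))).
  { apply Rmin_pos; auto. apply Rdiv_lt_0_compat; auto. apply cond_pos. }
  intros w Hw. specialize (K w (Rlt_le_trans _ _ _ Hw (Rmin_l _ _))).
  assert (Q : Cmod (w - z) * (Cmod l + 1) < eps).
  { apply Rmult_lt_reg_r with (/ (Cmod l + 1)); [now apply Rinv_0_lt_compat|].
    rewrite Rmult_assoc, Rinv_r, Rmult_1_r by lra.
    apply (Rlt_le_trans _ _ _ Hw (Rmin_r _ _)). }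
  replace (f w - f z)%C with ((f w - f z - l * (w - z)) + l * (w - z))%C by ring.
  apply Rle_lt_trans with (1 := Cmod_triangle _ _). rewrite Cmod_mult. lra.
Qed.

Lemma Cdiff_ext_loc f g z l :
  Cnear z (fun w => f w = g w) -> Cdiff f z l -> Cdiff g z l.
Proof.
  intros E H eps Heps. destruct (H eps Heps) as [d [Hd K]].
  apply Cnear_elim in E. destruct E as [d' [Hd' E]].
  exists (Rmin d d'). split; [now apply Rmin_pos|]. intros w Hw.
  rewrite <- (E w), <- (E z).
  - apply K, (Rlt_le_trans _ _ _ Hw (Rmin_l _ _)).
  - replace (z - z)%C with (RtoC 0) by ring. now rewrite Cmod_0.
  - apply (Rlt_le_trans _ _ _ Hw (Rmin_r _ _)).
Qed.

Lemma in_disk_near z : in_disk z -> Cnear z in_disk.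
Proof.
  unfold in_disk. intros H. apply (Cnear_intro z _ (1 - Cmod z)); [lra|]. intros w Hw.
  replace w with ((w - z) + z)%C by ring. apply Rle_lt_trans with (1 := Cmod_triangle _ _). lra.
Qed.

Ltac eqC := match goal with |- @eq _ ?a ?b => change (@eq C a b) end.
Ltac scalR := match goal with |- context [@scal ?k ?v ?a ?b] => change (@scal k v a b)
  with (Rmult a b) end.
Ltac eqR := match goal with |- @eq _ ?a ?b => change (@eq R a b) end.

(** * Complex series and power series *)

Definition Csum (a : nat -> C) (n : nat) : C := @sum_n C_AbelianMonoid a n.

Definition Cseries (a : nat -> C) (s : C) : Prop := Clim eventually (Csum a) s.

Lemma Csum_0 a : Csum a 0 = a 0%nat.
Proof. apply (@sum_O C_AbelianMonoid). Qed.

Lemma Csum_S a n : Csum a (S n) = (Csum a n + a (S n))%C.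
Proof. apply (@sum_Sn C_AbelianMonoid). Qed.

Lemma Csum_ext a b n : (forall k, a k = b k) -> Csum a n = Csum b n.
Proof. intros H. induction n; rewrite ?Csum_0, ?Csum_S, ?IHn, H; auto. Qed.

Lemma Csum_plus a b n : Csum (fun k => a k + b k)%C n = (Csum a n + Csum b n)%C.
Proof. induction n; rewrite ?Csum_0, ?Csum_S, ?IHn; [reflexivity|ring]. Qed.

Lemma Csum_scal c a n : Csum (fun k => c * a k)%C n = (c * Csum a n)%C.
Proof. induction n; rewrite ?Csum_0, ?Csum_S, ?IHn; [reflexivity|ring]. Qed.

Lemma Csum_Cmod a b n : (forall k, Cmod (a k) <= b k) ->
  Cmod (Csum a n) <= @sum_n R_AbelianMonoid b n.
Proof.
  intros H. induction n; rewrite ?Csum_0, ?Csum_S, ?sum_O, ?sum_Sn; [apply H|].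
  apply Rle_trans with (1 := Cmod_triangle _ _). apply Rplus_le_compat; auto.
Qed.

Lemma Csum_Re a n : Re (Csum a n) = @sum_n R_AbelianMonoid (fun k => Re (a k)) n.
Proof. induction n; rewrite ?Csum_0, ?Csum_S, ?sum_O, ?sum_Sn, ?re_plus, ?IHn; reflexivity. Qed.

Lemma Csum_Im a n : Im (Csum a n) = @sum_n R_AbelianMonoid (fun k => Im (a k)) n.
Proof. induction n; rewrite ?Csum_0, ?Csum_S, ?sum_O, ?sum_Sn, ?im_plus, ?IHn; reflexivity. Qed.

Lemma Csum_lim {T} (F : (T -> Prop) -> Prop) {FF : Filter F} (b : T -> nat -> C) c n :
  (forall k, Clim F (fun j => b j k) (c k)) -> Clim F (fun j => Csum (b j) n) (Csum c n).
Proof.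
  intros H. induction n.
  - rewrite Csum_0. apply (Clim_ext F (fun j => b j 0%nat)); auto. intros. now rewrite Csum_0.
  - rewrite Csum_S. apply (Clim_ext F (fun j => Csum (b j) n + b j (S n))%C).
    intros. now rewrite Csum_S. apply Clim_plus; auto.
Qed.

Lemma is_series_Cseries a s : @is_series C_AbsRing C_NormedModule a s <-> Cseries a s.
Proof. symmetry. apply (Clim_filterlim eventually (Csum a) s). Qed.

Lemma pow_n_Cpow z k : @pow_n C_Ring z k = (z ^ k)%C.
Proof. induction k; simpl; auto. Qed.

Lemma Cseries_ext a b s : (forall k, a k = b k) -> Cseries a s -> Cseries b s.
Proof. intros H. apply (Clim_ext eventually). intros n. now apply Csum_ext. Qed.

Lemma is_pseries_Cseries a z s :
  @is_pseries C_AbsRing C_NormedModule a z s <-> Cseries (fun k => a k * z ^ k)%C s.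
Proof.
  unfold is_pseries. rewrite is_series_Cseries. 
  split; apply Cseries_ext; intros k; rewrite <- pow_n_Cpow; apply Cmult_comm.
Qed.

Lemma Cseries_unique a s t : Cseries a s -> Cseries a t -> s = t.
Proof. apply (Clim_unique eventually). Qed.

Lemma Cseries_plus a b s t : Cseries a s -> Cseries b t -> Cseries (fun k => a k + b k)%C (s + t)%C.
Proof.
  intros H K. apply (Clim_ext eventually (fun n => Csum a n + Csum b n)%C).
  intros; now rewrite Csum_plus. apply (Clim_plus eventually); auto.
Qed.

Lemma Cseries_scal c a s : Cseries a s -> Cseries (fun k => c * a k)%C (c * s)%C.
Proof.
  intros H. apply (Clim_ext eventually (fun n => c * Csum a n)%C).
  intros; now rewrite Csum_scal. apply (Clim_mult eventually); auto. apply (Clim_const eventually).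
Qed.

Lemma Cseries_minus a b s t : Cseries a s -> Cseries b t ->
  Cseries (fun k => a k - b k)%C (s - t)%C.
Proof.
  intros H K. apply (Cseries_ext (fun k => a k + (- (1)) * b k)%C). intros; ring.
  replace (s - t)%C with (s + (- (1)) * t)%C by ring. apply Cseries_plus; auto.
  now apply Cseries_scal.
Qed.

Lemma Csum_shift a n : Csum a (S n) = (a 0%nat + Csum (fun k => a (S k)) n)%C.
Proof. induction n. rewrite Csum_S, !Csum_0. reflexivity. rewrite Csum_S, IHn, (Csum_S _ n). ring.
Qed.

Lemma Cseries_shift a s : Cseries a s -> Cseries (fun k => a (S k)) (s - a 0%nat)%C.
Proof.
  intros H. apply (Clim_ext eventually (fun n => Csum a (S n) - a 0%nat)%C).
  intros; rewrite Csum_shift; ring.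
  apply (Clim_minus eventually); [|apply (Clim_const eventually)].
  apply (Clim_comp eventually eventually S (Csum a)); auto.
  intros P [N HN]. exists N. intros n Hn. apply HN. lia.
Qed.

Lemma Cseries_unshift a s : Cseries (fun k => a (S k)) s -> Cseries a (a 0%nat + s)%C.
Proof.
  intros H eps. destruct (H eps) as [N HN]. exists (S N). intros n Hn.
  destruct n; [lia|]. rewrite Csum_shift. 
  replace (a 0%nat + Csum (fun k => a (S k)) n - (a 0%nat + s))%C with (Csum (fun k => a (S k))
    n - s)%C by ring.
  apply HN. lia.
Qed.

Lemma Cseries_term_bounded a s : Cseries a s -> exists B, forall n, Cmod (a n) <= B.
Proof.
  intros H. destruct (Clim_bounded eventually _ _ H) as [N HN].
  assert (K : exists B, forall n, (n <= S N)%nat -> Cmod (a n) <= B).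
  { generalize (S N). intros m. induction m.
    - exists (Cmod (a 0%nat)). intros n Hn. replace n with 0%nat by lia. lra.
    - destruct IHm as [B HB]. exists (Rmax B (Cmod (a (S m)))). intros n Hn.
      destruct (Nat.eq_dec n (S m)) as [->|]. apply Rmax_r.
      apply Rle_trans with (2 := Rmax_l _ _). apply HB. lia. }
  destruct K as [B HB]. exists (Rmax B (2 * (Cmod s + 1))). intros n.
  destruct (Nat.le_gt_cases n (S N)).
  - apply Rle_trans with (2 := Rmax_l _ _). auto.
  - apply Rle_trans with (2 := Rmax_r _ _). destruct n; [lia|].
    replace (a (S n)) with (Csum a (S n) - Csum a n)%C by (rewrite Csum_S; ring).
    apply Rle_trans with (1 := Cmod_triangle _ _). rewrite Cmod_opp.
    generalize (HN (S n) ltac:(lia)) (HN n ltac:(lia)). lra.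
Qed.

Lemma sum_n_le_Series b n : (forall k, 0 <= b k) -> ex_series b ->
  @sum_n R_AbelianMonoid b n <= Series b.
Proof.
  intros H E. apply Series_correct in E. 
  apply (is_lim_seq_incr_compare (@sum_n R_AbelianMonoid b) (Series b)). exact E.
  intros m. rewrite sum_Sn. unfold plus; simpl. generalize (H (S m)). lra.
Qed.

Lemma Cseries_le a s b : Cseries a s -> (forall n, Cmod (a n) <= b n) -> ex_series b ->
  Cmod s <= Series b.
Proof.
  intros H B E. apply (Clim_Cmod_le eventually (Csum a)); auto.
  apply filter_forall. intros n. apply Rle_trans with (@sum_n R_AbelianMonoid b n).
  now apply Csum_Cmod.
  apply sum_n_le_Series; auto. intros k. apply Rle_trans with (2 := B k). apply Cmod_ge_0.
Qed.

Lemma ex_Cseries a b : (forall n, Cmod (a n) <= b n) -> ex_series b -> exists s, Cseries a s.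
Proof.
  intros H E. destruct (@ex_series_le C_AbsRing C_CompleteNormedModule a b) as [s Hs]; auto.
  exists s. now apply is_series_Cseries.
Qed.

(** A total function: it is the sum when the series converges, and consists of default values of
    [Series] otherwise. *)
Definition CSer (a : nat -> C) : C := (Series (fun n => Re (a n)), Series (fun n => Im (a n))).

Lemma CSer_unique a s : Cseries a s -> CSer a = s.
Proof.
  intros H. destruct s as [x y]. unfold CSer. f_equal; apply is_series_unique.
  - apply (filterlim_ext (fun n => Re (Csum a n))). intros; apply Csum_Re.
    apply (Clim_Re eventually _ _ H).
  - apply (filterlim_ext (fun n => Im (Csum a n))). intros; apply Csum_Im.
    apply (Clim_Im eventually _ _ H).
Qed.

Lemma CSer_correct a : (exists s, Cseries a s) -> Cseries a (CSer a).
Proof. intros [s H]. now rewrite (CSer_unique a s). Qed.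

Lemma Cseries_tail a s b N : Cseries a s -> (forall n, Cmod (a n) <= b n) -> ex_series b ->
  Cmod (Csum a N - s) <= Series b - @sum_n R_AbelianMonoid b N.
Proof.
  intros H B E.
  assert (K : Clim eventually (fun n => Csum a N - Csum a n)%C (Csum a N - s)%C).
  { apply (Clim_minus eventually); auto. apply (Clim_const eventually). }
  apply (Clim_Cmod_le eventually _ _ _ K). exists N. intros n Hn.
  apply Rle_trans with (@sum_n R_AbelianMonoid b n - @sum_n R_AbelianMonoid b N).
  - replace n with (N + (n - N))%nat by lia. generalize (n - N)%nat. intros m. induction m.
    + rewrite Nat.add_0_r. replace (Csum a N - Csum a N)%C with (RtoC 0) by ring. rewrite Cmod_0.
      lra.
    + rewrite Nat.add_succ_r, Csum_S, sum_Sn. unfold plus; simpl.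
      replace (Csum a N - (Csum a (N + m) + a (S (N + m))))%C
        with ((Csum a N - Csum a (N + m)) - a (S (N + m)))%C by ring.
      apply Rle_trans with (1 := Cmod_triangle _ _). rewrite Cmod_opp.
      generalize (B (S (N + m))). lra.
  - assert (P : forall k, 0 <= b k) by (intros k; apply Rle_trans with (2 := B k); apply Cmod_ge_0).
    generalize (sum_n_le_Series b n P E). lra.
Qed.

Lemma ex_series_Rmult (c : R) (u : nat -> R) : ex_series u -> ex_series (fun n => c * u n).
Proof. intros [l H]. exists (c * l). apply (is_series_scal_l (K := R_AbsRing)
  (V := R_NormedModule) c u l H). Qed.

Lemma Series_tail_lim b : ex_series b -> is_lim_seq (fun n => Series b - @sum_n R_AbelianMonoid b
  n) 0.
Proof.
  intros E. apply Series_correct in E. replace (Finite 0) with (Finite (Series b - Series b))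
    by (f_equal; ring).
  apply is_lim_seq_minus'. apply is_lim_seq_const. exact E.
Qed.

(** Tannery's theorem. The domination passes to the limit terms [c], so cutting at an index where
    the tail of [B] is below eps/3 controls both remainders, and a finite sum of limits is left. *)
Lemma Cseries_dominated {T} (F : (T -> Prop) -> Prop) {FF : ProperFilter F}
  (b : T -> nat -> C) (s : T -> C) c sigma B :
  F (fun j => Cseries (b j) (s j) /\ forall n, Cmod (b j n) <= B n) ->
  ex_series B -> (forall n, Clim F (fun j => b j n) (c n)) -> Cseries c sigma ->
  Clim F s sigma.
Proof.
  intros H E L Hc eps.
  assert (Bc : forall n, Cmod (c n) <= B n).
  { intros n. apply (Clim_Cmod_le F _ _ _ (L n)). revert H. apply filter_imp. intros x [_ h].
    apply h. }
  assert (P : 0 < eps / 3) by (generalize (cond_pos eps); lra).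
  destruct (proj1 (Rlim0 eventually _) (Series_tail_lim B E) (mkposreal _ P)) as [N HN].
  specialize (HN N (Nat.le_refl _)). simpl in HN. apply Rabs_lt_between in HN.
  destruct HN as [_ HN]. assert (e3 : pos eps = 3 * (eps / 3)) by lra. set (t := eps / 3) in *.
  generalize (filter_and _ _ H (Csum_lim F b c N L (mkposreal _ P))). apply filter_imp.
  intros x [[h1 h2] h3]. simpl in h3.
  replace (s x - sigma)%C with (- (Csum (b x) N - s x) + (Csum (b x) N - Csum c N)
    + (Csum c N - sigma))%C by ring.
  apply Rle_lt_trans with (1 := Cmod_triangle _ _).
  apply Rle_lt_trans with (1 := Rplus_le_compat_r _ _ _ (Cmod_triangle _ _)). rewrite Cmod_opp.
  assert (T1 := Cseries_tail _ _ B N h1 h2 E). assert (T2 := Cseries_tail _ _ B N Hc Bc E).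
  fold t in h3. rewrite e3. lra.
Qed.

Definition conv_disk (a : nat -> C) : Prop :=
  forall r, 0 <= r < 1 -> ex_series (fun n => Cmod (a n) * r ^ n).

(** Convergence at the midpoint [r'] of r and 1 bounds the terms there, and this dominates the
    series at r by a geometric one of ratio r / r'. *)
Lemma conv_disk_pseries a :
  (forall z, in_disk z -> exists s, Cseries (fun k => a k * z ^ k)%C s) -> conv_disk a.
Proof.
  intros H r Hr. pose (r' := (r + 1) / 2). assert (Hr' : 0 < r' < 1) by (unfold r'; lra).
  destruct (H (RtoC r')) as [s Hs].
  { unfold in_disk. rewrite Cmod_R, Rabs_pos_eq; lra. }
  destruct (Cseries_term_bounded _ _ Hs) as [B HB].
  apply (ex_series_le (K := R_AbsRing) (V := R_CompleteNormedModule) _ (fun n => B * ((r / r')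
    ^ n))).
  - intros n. unfold norm; simpl. unfold abs; simpl. rewrite Rabs_pos_eq.
    2: { apply Rmult_le_pos. apply Cmod_ge_0. apply pow_le; lra. }
    specialize (HB n). rewrite Cmod_mult, Cmod_pow, Cmod_R, Rabs_pos_eq in HB by lra.
    unfold Rdiv. rewrite Rpow_mult_distr, pow_inv.
    replace (Cmod (a n) * r ^ n) with ((Cmod (a n) * r' ^ n) * (r ^ n * / r' ^ n)).
    + apply Rmult_le_compat_r; auto. apply Rmult_le_pos. apply pow_le; lra.
      apply Rlt_le, Rinv_0_lt_compat, pow_lt; lra.
    + field. apply pow_nonzero. lra.
  - apply (ex_series_Rmult B). apply ex_series_geom. rewrite Rabs_pos_eq.
    + apply Rmult_lt_reg_r with r'. lra. unfold Rdiv. rewrite Rmult_assoc, Rinv_l by lra.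
      unfold r'; lra.
    + apply Rdiv_le_0_compat; lra.
Qed.

Lemma conv_disk_bounded a B : (forall n, Cmod (a n) <= B) -> conv_disk a.
Proof.
  intros H r Hr.
  apply (ex_series_le (K := R_AbsRing) (V := R_CompleteNormedModule) _ (fun n => B * r ^ n)).
  - intros n. unfold norm; simpl. unfold abs; simpl. rewrite Rabs_pos_eq.
    apply Rmult_le_compat_r; auto. apply pow_le; lra.
    apply Rmult_le_pos. apply Cmod_ge_0. apply pow_le; lra.
  - apply (ex_series_Rmult B). apply ex_series_geom. rewrite Rabs_pos_eq; lra.
Qed.

Lemma conv_radius_ge_1 (u : nat -> R) :
  (forall r, 0 <= r < 1 -> ex_series (fun n => u n * r ^ n)) -> Rbar_le 1 (CV_radius u).
Proof.
  intros H. apply Rbar_not_lt_le. intros L.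
  destruct (CV_radius u) as [c| |] eqn:E; simpl in L; try easy.
  - assert (P : 0 <= c) by (generalize (CV_radius_ge_0 u); rewrite E; auto).
    apply (CV_disk_outside u ((c + 1) / 2)).
    + rewrite E. simpl. rewrite Rabs_pos_eq; lra.
    + apply (ex_series_lim_0 (fun n => u n * ((c + 1) / 2) ^ n)). apply H. lra.
  - generalize (CV_radius_ge_0 u). rewrite E. auto.
Qed.

Definition Cderiv (a : nat -> C) (n : nat) : C := (RtoC (INR (n + 1)) * a (S n))%C.

Lemma conv_disk_Cderiv a : conv_disk a -> conv_disk (Cderiv a).
Proof.
  intros H r Hr.
  assert (K : Rbar_lt (Rabs r) (CV_radius (PS_derive (fun n => Cmod (a n))))).
  { rewrite CV_radius_derive. apply Rbar_lt_le_trans with 1.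
    - simpl. rewrite Rabs_pos_eq; lra.
    - now apply conv_radius_ge_1. }
  generalize (CV_disk_inside _ _ K). apply ex_series_ext. intros n. unfold PS_derive, Cderiv.
  rewrite Nat.add_1_r, Cmod_mult, Cmod_R, (Rabs_pos_eq (INR (S n))) by apply pos_INR.
  rewrite Rabs_pos_eq; auto. apply Rmult_le_pos. apply Rmult_le_pos. apply pos_INR. apply Cmod_ge_0.
  apply pow_le; lra.
Qed.

Definition PSum (a : nat -> C) (z : C) : C := CSer (fun n => a n * z ^ n)%C.

Lemma conv_disk_ex a z : conv_disk a -> in_disk z ->
  ex_series (fun n => Cmod (a n * z ^ n)%C).
Proof.
  intros H Hz. apply (ex_series_ext (fun n => Cmod (a n) * Cmod z ^ n)).
  intros n. now rewrite Cmod_mult, Cmod_pow. apply H. split. apply Cmod_ge_0. exact Hz.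
Qed.

Lemma PSum_correct a z : conv_disk a -> in_disk z -> Cseries (fun n => a n * z ^ n)%C (PSum a z).
Proof.
  intros H Hz. apply CSer_correct.
  apply (ex_Cseries _ (fun n => Cmod (a n * z ^ n)%C)). intros; lra. now apply conv_disk_ex.
Qed.

Lemma PSum_0 a : PSum a 0 = a 0%nat.
Proof.
  apply CSer_unique. replace (a 0%nat) with (a 0%nat * 0 ^ 0 + 0)%C by (simpl; ring).
  apply Cseries_unshift. apply (Cseries_ext (fun _ => RtoC 0)). intros; simpl; ring.
  apply (Clim_ext eventually (fun _ => RtoC 0)); [|apply (Clim_const eventually)].
  intros n. induction n; rewrite ?Csum_0, ?Csum_S; auto. rewrite <- IHn. ring.
Qed.

(** The natural estimate has rho^(n-1) on the right; multiplying by [rho] avoids a truncated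
    exponent at n = 0. The induction rests on D' = w D + (n+1) z^n (w - z)^2 for consecutive
    remainders D and D'. *)
Lemma power_remainder (z w : C) rho n : Cmod z <= rho -> Cmod w <= rho -> 0 <= rho ->
  rho * Cmod (w ^ (S n) - z ^ (S n) - RtoC (INR (n + 1)) * z ^ n * (w - z))%C
    <= INR n * INR (n + 1) * rho ^ n * Cmod (w - z) ^ 2.
Proof.
  intros Hz Hw Hr. induction n.
  - replace (w ^ 1 - z ^ 1 - RtoC (INR (0 + 1)) * z ^ 0 * (w - z))%C with (RtoC 0) by (simpl; ring).
    rewrite Cmod_0. simpl. lra.
  - set (D := (w ^ S n - z ^ S n - RtoC (INR (n + 1)) * z ^ n * (w - z))%C) in *.
    replace (w ^ S (S n) - z ^ S (S n) - RtoC (INR (S n + 1)) * z ^ S n * (w - z))%C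
      with (w * D + RtoC (INR (n + 1)) * z ^ n * ((w - z) * (w - z)))%C.
    2: { unfold D. rewrite !Nat.add_1_r, (S_INR (S n)), RtoC_plus. simpl Cpow. ring. }
    assert (A : rho * Cmod (w * D + RtoC (INR (n + 1)) * z ^ n * ((w - z) * (w - z)))%C
       <= rho * (rho * Cmod D) + rho * (INR (n + 1) * rho ^ n * (Cmod (w - z) ^ 2))).
    { rewrite <- Rmult_plus_distr_l. apply Rmult_le_compat_l; auto.
      apply Rle_trans with (1 := Cmod_triangle _ _). rewrite !Cmod_mult, Cmod_R, Cmod_pow.
      rewrite (Rabs_pos_eq (INR (n + 1))) by apply pos_INR.
      apply Rplus_le_compat.
      - apply Rmult_le_compat_r; auto. apply Cmod_ge_0.
      - rewrite <- (Rmult_1_r (Cmod (w - z))) at 2. simpl (_ ^ 2). rewrite !Rmult_1_r.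
        apply Rmult_le_compat_r. apply Rmult_le_pos; apply Cmod_ge_0.
        apply Rmult_le_compat_l. apply pos_INR. apply pow_incr. split; auto. apply Cmod_ge_0. }
    apply Rle_trans with (1 := A).
    apply (Rmult_le_compat_l rho) in IHn; auto.
    apply Rle_trans with (1 := Rplus_le_compat_r _ _ _ IHn).
    rewrite !Nat.add_1_r, !S_INR. simpl.
    assert (0 <= rho * rho ^ n * (Cmod (w - z) * Cmod (w - z))).
    { apply Rmult_le_pos. apply Rmult_le_pos; auto. now apply pow_le.
      apply Rmult_le_pos; apply Cmod_ge_0. }
    generalize (pos_INR n). intros. nra.
Qed.

(** Termwise differentiation: by [power_remainder] the error is at most |w - z|^2 times [Series B],
    where [B] is, up to a shift, the series of moduli of the second derivative at [rho], halfway
    between |z| and 1. *)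
Lemma PSum_Cdiff a z : conv_disk a -> in_disk z -> Cdiff (PSum a) z (PSum (Cderiv a) z).
Proof.
  intros H Hz. unfold in_disk in Hz. pose (rho := (Cmod z + 1) / 2).
  assert (Hr : 0 < rho < 1) by (generalize (Cmod_ge_0 z); unfold rho; lra).
  assert (Hzr : Cmod z < rho) by (unfold rho; lra).
  pose (B := fun n => / rho * (Cmod (a (S n)) * (INR n * INR (n + 1)) * rho ^ n)).
  assert (EB : ex_series B).
  { unfold B. apply (ex_series_Rmult (/ rho)). apply ex_series_incr_1.
    generalize (conv_disk_Cderiv _ (conv_disk_Cderiv _ H) rho ltac:(lra)). intros E.
    apply (ex_series_Rmult rho) in E. revert E. apply ex_series_ext. intros n. unfold Cderiv.
    rewrite !Cmod_mult, !Cmod_R, !Rabs_pos_eq by apply pos_INR. rewrite !Nat.add_1_r. simpl pow.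
    eqR; ring. }
  assert (PB : 0 <= Series B).
  { apply Rle_trans with (@sum_n R_AbelianMonoid B 0).
    - rewrite sum_O. unfold B. simpl. lra.
    - apply sum_n_le_Series; auto. intros k. unfold B.
      apply Rmult_le_pos. apply Rlt_le, Rinv_0_lt_compat; lra.
      repeat apply Rmult_le_pos; auto using Cmod_ge_0, pos_INR. apply pow_le; lra. }
  intros eps Heps. exists (Rmin (rho - Cmod z) (eps / (Series B + 1))). split.
  { apply Rmin_pos. lra. apply Rdiv_lt_0_compat; lra. }
  intros w Hw.
  assert (W1 := Rlt_le_trans _ _ _ Hw (Rmin_l _ _)).
  assert (W2 := Rlt_le_trans _ _ _ Hw (Rmin_r _ _)).
  assert (Hwr : Cmod w < rho).
  { replace w with (z + (w - z))%C by ring. apply Rle_lt_trans with (1 := Cmod_triangle _ _). lra. }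
  assert (S1 := Cseries_shift _ _ (PSum_correct a w H ltac:(unfold in_disk; lra))).
  assert (S2 := Cseries_shift _ _ (PSum_correct a z H ltac:(unfold in_disk; lra))).
  assert (S3 := Cseries_scal (w - z) _ _ (PSum_correct _ z (conv_disk_Cderiv a H)
    ltac:(unfold in_disk; lra))).
  assert (S4 := Cseries_minus _ _ _ _ (Cseries_minus _ _ _ _ S1 S2) S3).
  assert (L : Cmod (PSum a w - PSum a z - PSum (Cderiv a) z * (w - z))
    <= Series (fun n => Cmod (w - z) ^ 2 * B n)).
  { eapply Cseries_le.
    - match type of S4 with Cseries _ ?v => replace (PSum a w - PSum a z - PSum (Cderiv a)
        z * (w - z))%C with v by (simpl; ring) end.
      exact S4.
    - intros n. unfold Cderiv, B. simpl.
      replace (a (S n) * (w * w ^ n) - a (S n) * (z * z ^ n) - (w - z) * (RtoC (INR (n + 1))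
        * a (S n) * z ^ n))%C
        with (a (S n) * (w ^ S n - z ^ S n - RtoC (INR (n + 1)) * z ^ n * (w - z)))%C by (simpl;
          ring).
      rewrite Cmod_mult. 
      generalize (power_remainder z w rho n ltac:(lra) ltac:(lra) ltac:(lra)). intros Q.
      apply (Rmult_le_compat_l (/ rho)) in Q. 2: apply Rlt_le, Rinv_0_lt_compat; lra.
      rewrite <- Rmult_assoc, Rinv_l, Rmult_1_l in Q by lra.
      apply (Rmult_le_compat_l (Cmod (a (S n)))) in Q. 2: apply Cmod_ge_0.
      apply Rle_trans with (1 := Q). apply Req_le. simpl. ring.
    - apply (ex_series_Rmult (Cmod (w - z) ^ 2)). exact EB. }
  apply Rle_trans with (1 := L). rewrite Series_scal_l. 
  simpl. rewrite Rmult_1_r, Rmult_assoc, (Rmult_comm eps). apply Rmult_le_compat_l. apply Cmod_ge_0.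
  apply Rle_trans with (eps / (Series B + 1) * (Series B + 1)).
  - apply Rmult_le_compat; auto; try lra. apply Cmod_ge_0.
  - apply Req_le. field. lra.
Qed.

Definition expansion (a : nat -> C) (f : C -> C) : Prop :=
  forall w, in_disk w -> Cseries (fun n => a n * w ^ n)%C (f w).

Lemma expansion_conv_disk a f : expansion a f -> conv_disk a.
Proof. intros H. apply conv_disk_pseries. intros z Hz. exists (f z). now apply H. Qed.

Lemma pseries_Cdiff a g z : expansion a g ->
  in_disk z -> Cdiff g z (PSum (Cderiv a) z).
Proof.
  intros Hg Hz. apply (Cdiff_ext_loc (PSum a)).
  - generalize (in_disk_near z Hz). apply filter_imp. intros w Hw. apply CSer_unique. auto.
  - apply PSum_Cdiff; auto. now apply (expansion_conv_disk a g).
Qed.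

Lemma PSum_real c x : PSum c (RtoC x) = (PSeries (fun k => Re (c k))
  x, PSeries (fun k => Im (c k)) x).
Proof.
  unfold PSum, CSer, PSeries. f_equal; apply Series_ext; intros k; rewrite <- RtoC_pow.
  apply re_scal_r. apply im_scal_r.
Qed.

(** On real arguments the identity splits into real and imaginary parts, where uniqueness for real
    power series applies. *)
Lemma pseries_coef_unique a b : conv_disk a -> conv_disk b ->
  (forall z, in_disk z -> PSum a z = PSum b z) -> forall n, a n = b n.
Proof.
  intros Ha Hb E n.
  assert (CR : forall c, conv_disk c -> Rbar_lt 0 (CV_radius (fun k => Re (c k)))
    /\ Rbar_lt 0 (CV_radius (fun k => Im (c k)))).
  { intros c Hc. split; apply Rbar_lt_le_trans with 1; try (simpl; lra); apply conv_radius_ge_1;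
      intros r Hr;
    apply (ex_series_le (K := R_AbsRing) (V := R_CompleteNormedModule) _ (fun n => Cmod (c n)
      * r ^ n)); auto;
    intros k; unfold norm; simpl; unfold abs; simpl;
      rewrite Rabs_mult, (Rabs_pos_eq (r ^ k)) by (apply pow_le; lra);
    apply Rmult_le_compat_r; try (apply pow_le; lra). apply re_le_Cmod. apply im_le_Cmod. }
  assert (N : locally 0 (fun x => PSum a (RtoC x) = PSum b (RtoC x))).
  { exists (mkposreal 1 Rlt_0_1). intros x Hx. apply E. unfold in_disk. rewrite Cmod_R.
    apply ball_Rabs in Hx. now rewrite Rminus_0_r in Hx. }
  destruct (CR a Ha) as [a1 a2]. destruct (CR b Hb) as [b1 b2].
  assert (E1 : Re (a n) = Re (b n)).
  { apply (PSeries_ext_recip (fun k => Re (a k)) (fun k => Re (b k))); auto. revert N.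
    apply filter_imp.
    intros x Hx. rewrite !PSum_real in Hx. now injection Hx. }
  assert (E2 : Im (a n) = Im (b n)).
  { apply (PSeries_ext_recip (fun k => Im (a k)) (fun k => Im (b k))); auto. revert N.
    apply filter_imp.
    intros x Hx. rewrite !PSum_real in Hx. now injection Hx. }
  destruct (a n), (b n). simpl in *. now rewrite E1, E2.
Qed.

(** * Integrals of complex-valued functions of a real variable *)

Definition is_CInt (f : R -> C) (a b : R) (l : C) : Prop := @is_RInt C_R_NormedModule f a b l.

Definition CInt (f : R -> C) (a b : R) : C :=
  (RInt (fun t => Re (f t)) a b, RInt (fun t => Im (f t)) a b).

Definition Ccont (f : R -> C) (x : R) : Prop := Clim (locally x) f (f x).

Lemma norm_C_R (z : C) : @norm R_AbsRing C_R_NormedModule z = Cmod z.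
Proof.
  destruct z as [x y]. change (sqrt (Rabs x ^ 2 + Rabs y ^ 2) = sqrt (x ^ 2 + y ^ 2)).
  now rewrite !RPow_abs, !Rabs_pos_eq by apply pow2_ge_0.
Qed.

Lemma is_CInt_Re f a b l : is_CInt f a b l -> is_RInt (fun t => Re (f t)) a b (Re l).
Proof. apply (is_RInt_fct_extend_fst (U := R_NormedModule) (V := R_NormedModule)). Qed.

Lemma is_CInt_Im f a b l : is_CInt f a b l -> is_RInt (fun t => Im (f t)) a b (Im l).
Proof. apply (is_RInt_fct_extend_snd (U := R_NormedModule) (V := R_NormedModule)). Qed.

Lemma is_CInt_Re_Im f a b l : is_RInt (fun t => Re (f t)) a b (Re l) ->
  is_RInt (fun t => Im (f t)) a b (Im l) -> is_CInt f a b l.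
Proof.
  intros H1 H2. destruct l as [u v].
  apply (is_RInt_fct_extend_pair (U := R_NormedModule) (V := R_NormedModule)); auto.
Qed.

Lemma CInt_unique f a b l : is_CInt f a b l -> CInt f a b = l.
Proof.
  intros H. destruct l as [u v]. unfold CInt.
  f_equal; apply is_RInt_unique; [apply (is_CInt_Re _ _ _ _ H)|apply (is_CInt_Im _ _ _ _ H)].
Qed.

Lemma CInt_correct f a b : a <= b -> (forall x, a <= x <= b -> Ccont f x) ->
  is_CInt f a b (CInt f a b).
Proof.
  intros Hab H. apply is_CInt_Re_Im; apply (RInt_correct (V := R_CompleteNormedModule));
  apply (ex_RInt_continuous (V := R_CompleteNormedModule)); intros x;
  rewrite Rmin_left, Rmax_right by auto; intros Hx.
  - apply (Clim_Re (locally x) _ _ (H x Hx)).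
  - apply (Clim_Im (locally x) _ _ (H x Hx)).
Qed.

Lemma is_CInt_ext f g a b l : a <= b -> (forall x, a < x < b -> f x = g x) ->
  is_CInt f a b l -> is_CInt g a b l.
Proof.
  intros Hab H. apply (is_RInt_ext (V := C_R_NormedModule)).
  rewrite Rmin_left, Rmax_right; auto.
Qed.

Lemma is_CInt_plus f g a b l m : is_CInt f a b l -> is_CInt g a b m ->
  is_CInt (fun x => f x + g x)%C a b (l + m)%C.
Proof. apply (is_RInt_plus (V := C_R_NormedModule)). Qed.

Lemma is_CInt_scal c f a b l : is_CInt f a b l -> is_CInt (fun x => c * f x)%C a b (c * l)%C.
Proof.
  intros H. assert (H1 := is_CInt_Re _ _ _ _ H). assert (H2 := is_CInt_Im _ _ _ _ H).
  apply is_CInt_Re_Im.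
  - rewrite re_mult. apply (is_RInt_ext (fun t => minus (scal (Re c) (Re (f t))) (scal (Im c)
      (Im (f t))))).
    intros x _. rewrite re_mult. reflexivity.
    apply (is_RInt_minus (V := R_NormedModule)); apply (is_RInt_scal (V := R_NormedModule)); auto.
  - rewrite im_mult. apply (is_RInt_ext (fun t => plus (scal (Re c) (Im (f t))) (scal (Im c)
      (Re (f t))))).
    intros x _. rewrite im_mult. reflexivity.
    apply (is_RInt_plus (V := R_NormedModule)); apply (is_RInt_scal (V := R_NormedModule)); auto.
Qed.

Lemma is_CInt_minus f g a b l m : is_CInt f a b l -> is_CInt g a b m ->
  is_CInt (fun x => f x - g x)%C a b (l - m)%C.
Proof. apply (is_RInt_minus (V := C_R_NormedModule)). Qed.

Lemma is_CInt_Chasles f a b c l m : is_CInt f a b l -> is_CInt f b c m -> is_CInt f a c (l + m)%C.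
Proof. apply (is_RInt_Chasles (V := C_R_NormedModule)). Qed.

Lemma is_CInt_bound f g a b l m : a <= b -> (forall x, a <= x <= b -> Cmod (f x) <= g x) ->
  is_CInt f a b l -> is_RInt g a b m -> Cmod l <= m.
Proof.
  intros Hab H H1 H2. rewrite <- norm_C_R. apply (norm_RInt_le (V := C_R_NormedModule) f g a b);
    auto.
  intros x Hx. rewrite norm_C_R. auto.
Qed.

Lemma is_CInt_bound_const f a b l M : a <= b -> (forall x, a <= x <= b -> Cmod (f x) <= M) ->
  is_CInt f a b l -> Cmod l <= (b - a) * M.
Proof.
  intros Hab H H1. apply (is_CInt_bound f (fun _ => M) a b); auto.
  apply (is_RInt_const (V := R_NormedModule)).
Qed.

Lemma ex_RInt_segment (h : R -> R) a b : a <= b -> (forall x, a <= x <= b -> continuous h x) ->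
  ex_RInt h a b.
Proof.
  intros Hab H. apply (ex_RInt_continuous (V := R_CompleteNormedModule)).
  now rewrite Rmin_left, Rmax_right.
Qed.

Definition Rdiff (f : R -> C) (x : R) (l : C) : Prop := @is_derive R_AbsRing C_R_NormedModule f x l.

Lemma Rdiff_iff f x l : Rdiff f x l <->
  forall eps, 0 < eps -> exists d, 0 < d /\
    forall y, Rabs (y - x) < d -> Cmod (f y - f x - RtoC (y - x) * l) <= eps * Rabs (y - x).
Proof.
  split.
  - intros [_ H] eps Heps. specialize (H x (fun P h => h) (mkposreal eps Heps)).
    destruct H as [d K]. exists d. split; [apply cond_pos|]. intros y Hy.
    specialize (K y Hy). rewrite norm_C_R in K. 
    replace (RtoC (y - x) * l)%C with (@scal R_AbsRing C_R_NormedModule (minus y x) l).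
    exact K. apply scal_R_Cmult.
  - intros H. split; [apply is_linear_scal_l|]. intros x' Hx eps.
    apply (@is_filter_lim_locally_unique R_AbsRing R_NormedModule) in Hx. subst x'.
    destruct (H eps (cond_pos eps)) as [d [Hd K]]. exists (mkposreal d Hd). intros y Hy.
    specialize (K y Hy). rewrite norm_C_R. rewrite scal_R_Cmult. exact K.
Qed.

Lemma Rdiff_Ccont f x l : Rdiff f x l -> Ccont f x.
Proof.
  intros H. apply (Clim_filterlim (locally x)).
  apply (ex_derive_continuous (K := R_AbsRing) (V := C_R_NormedModule)). now exists l.
Qed.

Lemma Rdiff_Re_Im f x l : is_derive (fun t => Re (f t)) x (Re l) ->
  is_derive (fun t => Im (f t)) x (Im l) ->
  Rdiff f x l.
Proof.
  assert (K : forall h v, is_derive h x v -> forall eps, 0 < eps -> exists d, 0 < d /\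
    forall y, Rabs (y - x) < d -> Rabs (h y - h x - (y - x) * v) <= eps * Rabs (y - x)).
  { intros h v [_ H] eps Heps. specialize (H x (fun P h => h) (mkposreal eps Heps)).
    destruct H as [d H]. exists d. split; [apply cond_pos|]. intros y Hy. exact (H y Hy). }
  intros H1 H2. apply Rdiff_iff. intros eps Heps.
  destruct (K _ _ H1 (eps / 2) ltac:(lra)) as [d1 [D1 K1]].
  destruct (K _ _ H2 (eps / 2) ltac:(lra)) as [d2 [D2 K2]].
  exists (Rmin d1 d2). split; [now apply Rmin_pos|]. intros y Hy.
  specialize (K1 y (Rlt_le_trans _ _ _ Hy (Rmin_l _ _))).
  specialize (K2 y (Rlt_le_trans _ _ _ Hy (Rmin_r _ _))).
  apply Rle_trans with (1 := Cmod_le_Re_Im _).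
  rewrite !re_minus, !im_minus, re_scal_l, im_scal_l. lra.
Qed.

Lemma Rdiff_comp G g x l v : Cdiff G (g x) l -> Rdiff g x v -> Rdiff (fun t => G (g t)) x (v * l)%C.
Proof.
  intros H1 H2. assert (Cg := Rdiff_Ccont _ _ _ H2). rewrite Rdiff_iff in *.
  intros eps Heps.
  pose (A := Cmod v + 1). pose (B := Cmod l + 1).
  assert (PA : 0 < A) by (unfold A; generalize (Cmod_ge_0 v); lra).
  assert (PB : 0 < B) by (unfold B; generalize (Cmod_ge_0 l); lra).
  destruct (H1 (eps / 2 / A)) as [d1 [D1 K1]].
  { apply Rdiv_lt_0_compat; lra. }
  destruct (H2 (Rmin 1 (eps / 2 / B))) as [d2 [D2 K2]].
  { apply Rmin_pos. lra. apply Rdiv_lt_0_compat; lra. }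
  destruct (Cg (mkposreal d1 D1)) as [d3 K3]. simpl in K3.
  exists (Rmin d2 d3). split; [apply Rmin_pos; auto; apply cond_pos|]. intros y Hy.
  specialize (K2 y (Rlt_le_trans _ _ _ Hy (Rmin_l _ _))).
  specialize (K3 y (Rlt_le_trans _ _ _ Hy (Rmin_r _ _))).
  specialize (K1 _ K3).
  assert (P := Rabs_pos (y - x)).
  assert (L1 : Cmod (g y - g x) <= A * Rabs (y - x)).
  { replace (g y - g x)%C with ((g y - g x - RtoC (y - x) * v) + RtoC (y - x) * v)%C by ring.
    apply Rle_trans with (1 := Cmod_triangle _ _). rewrite Cmod_mult, Cmod_R.
    assert (Rmin 1 (eps / 2 / B) * Rabs (y - x) <= 1 * Rabs (y - x)) by (apply Rmult_le_compat_r;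
      auto; apply Rmin_l).
    unfold A. lra. }
  assert (L2 : Cmod (g y - g x - RtoC (y - x) * v) * Cmod l <= eps / 2 * Rabs (y - x)).
  { apply Rle_trans with ((eps / 2 / B * Rabs (y - x)) * B).
    - apply Rmult_le_compat; auto using Cmod_ge_0. apply Rle_trans with (1 := K2).
      apply Rmult_le_compat_r; auto; apply Rmin_r. unfold B; lra.
    - apply Req_le. field. lra. }
  replace (G (g y) - G (g x) - RtoC (y - x) * (v * l))%C with
    ((G (g y) - G (g x) - l * (g y - g x)) + (g y - g x - RtoC (y - x) * v) * l)%C by ring.
  apply Rle_trans with (1 := Cmod_triangle _ _). rewrite Cmod_mult.
  apply Rle_trans with (eps / 2 * Rabs (y - x) + eps / 2 * Rabs (y - x)); [|lra].
  apply Rplus_le_compat; auto. apply Rle_trans with (1 := K1).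
  apply Rle_trans with (eps / 2 / A * (A * Rabs (y - x))).
  - apply Rmult_le_compat_l; auto. apply Rlt_le, Rdiv_lt_0_compat; lra.
  - apply Req_le. field. lra.
Qed.

Lemma is_CInt_derive F f a b : a <= b -> (forall x, a <= x <= b -> Rdiff F x (f x)) ->
  (forall x, a <= x <= b -> Ccont f x) -> is_CInt f a b (F b - F a)%C.
Proof.
  intros Hab H1 H2.
  apply (is_RInt_derive (V := C_R_CompleteNormedModule) F f a b).
  - rewrite Rmin_left, Rmax_right by auto. exact H1.
  - rewrite Rmin_left, Rmax_right by auto. intros x Hx. apply (Clim_filterlim (locally x)).
    now apply H2.
Qed.

Lemma CInt_lim {T} (F : (T -> Prop) -> Prop) {FF : Filter F} (f : T -> R -> C) g a b (s : T ->
  C) l (tau : T -> R) :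
  a <= b -> F (fun j => is_CInt (f j) a b (s j) /\ forall x, a <= x <= b ->
    Cmod (f j x - g x) <= tau j) ->
  filterlim tau F (locally 0) -> is_CInt g a b l -> Clim F s l.
Proof.
  intros Hab H Ht Hg. apply (Clim_squeeze F _ _ (fun j => (b - a) * tau j)).
  - revert H. apply filter_imp. intros j [h1 h2].
    apply (is_CInt_bound_const (fun x => f j x - g x)%C); auto. now apply is_CInt_minus.
  - now apply Rlim0_scal.
Qed.

Lemma Ccont_const c x : Ccont (fun _ => c) x.
Proof. apply (Clim_const (locally x)). Qed.

Lemma Ccont_id x : Ccont (fun t => RtoC t) x.
Proof. apply (Clim_RtoC (locally x)). apply filterlim_id. Qed.

Lemma Ccont_comp f g x : Clim (Cnear (g x)) f (f (g x)) -> Ccont g x -> Ccont (fun t => f (g t)) x.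
Proof.
  intros H K. apply (Clim_comp (locally x) (Cnear (g x)) g f); auto.
  intros P [eps HP]. generalize (K eps). unfold filtermap. apply filter_imp. intros y Hy.
  apply HP, Hy.
Qed.

(** * Cauchy's formula and Taylor expansion *)

(** Halving both sides writes [J] as a sum over four quarters; if three of them are below a quarter
    of the bound, the triangle inequality leaves it to the fourth. [J] is any additive function of
    parameter rectangles, so that it can later be an integral around a curved image. *)
Lemma goursat_step (J : R -> R -> R -> R -> C) A B C' D n w h eta a c :
  (forall a m b c d, A <= a <= m -> m <= b <= B -> C' <= c <= d -> d <= D ->
     J a b c d = (J a m c d + J m b c d)%C) ->
  (forall a b c m d, A <= a <= b -> b <= B -> C' <= c <= m -> m <= d <= D ->
     J a b c d = (J a b c m + J a b m d)%C) ->
  0 <= w -> 0 <= h ->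
  A <= a -> a + w / 2 ^ n <= B -> C' <= c -> c + h / 2 ^ n <= D ->
  eta / 4 ^ n <= Cmod (J a (a + w / 2 ^ n) c (c + h / 2 ^ n)) ->
  exists a' c', a <= a' /\ a' + w / 2 ^ S n <= a + w / 2 ^ n /\
    c <= c' /\ c' + h / 2 ^ S n <= c + h / 2 ^ n /\
    eta / 4 ^ S n <= Cmod (J a' (a' + w / 2 ^ S n) c' (c' + h / 2 ^ S n)).
Proof.
  intros add1 add2 Hw Hh HA HB HC HD HJ.
  assert (P2 : 0 < 2 ^ n) by (apply pow_lt; lra). assert (P4 : 0 < 4 ^ n) by (apply pow_lt; lra).
  assert (Ew : w / 2 ^ n = w / 2 ^ S n + w / 2 ^ S n) by (simpl; field; lra).
  assert (Eh : h / 2 ^ n = h / 2 ^ S n + h / 2 ^ S n) by (simpl; field; lra).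
  assert (E4 : eta / 4 ^ S n = eta / 4 ^ n / 4) by (simpl; field; lra).
  assert (Pw : 0 <= w / 2 ^ S n) by (apply Rdiv_le_0_compat; auto; apply pow_lt; lra).
  assert (Ph : 0 <= h / 2 ^ S n) by (apply Rdiv_le_0_compat; auto; apply pow_lt; lra).
  rewrite E4, Ew, Eh in *. clear E4. set (w' := w / 2 ^ S n) in *. set (h' := h / 2 ^ S n) in *.
  set (e := eta / 4 ^ n) in *.
  rewrite (add1 a (a + w')), (add2 a (a + w') c (c + h')), (add2 (a + w') (a + (w' + w'))
    c (c + h')) in HJ by lra.
  set (J1 := J a (a + w') c (c + h')) in *. set (J2 := J a (a + w') (c + h') (c + (h' + h'))) in *.
  set (J3 := J (a + w') (a + (w' + w')) c (c + h')) in *.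
  set (J4 := J (a + w') (a + (w' + w')) (c + h') (c + (h' + h'))) in *.
  assert (Q := Cmod_triangle (J1 + J2) (J3 + J4)).
  assert (Q1 := Cmod_triangle J1 J2). assert (Q2 := Cmod_triangle J3 J4).
  destruct (Rle_dec (e / 4) (Cmod J1)) as [K1|K1].
  { exists a, c. repeat split; try lra. exact K1. }
  destruct (Rle_dec (e / 4) (Cmod J2)) as [K2|K2].
  { exists a, (c + h'). repeat split; try lra. now rewrite (Rplus_assoc c). }
  destruct (Rle_dec (e / 4) (Cmod J3)) as [K3|K3].
  { exists (a + w'), c. repeat split; try lra. now rewrite (Rplus_assoc a). }
  exists (a + w'), (c + h'). repeat split; try lra. rewrite (Rplus_assoc c), (Rplus_assoc a).
  fold J4. lra.
Qed.

Lemma nested_interval (u v : nat -> R) : (forall n, u n <= u (S n)) -> (forall n, v (S n) <= v n) ->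
  (forall n, u n <= v n) -> exists x, forall n, u n <= x <= v n.
Proof.
  intros Hu Hv H.
  assert (Mu : forall n m, (n <= m)%nat -> u n <= u m).
  { intros n m L. induction L. lra. apply Rle_trans with (1 := IHL). apply Hu. }
  assert (Mv : forall n m, (n <= m)%nat -> v m <= v n).
  { intros n m L. induction L. lra. apply Rle_trans with (2 := IHL). apply Hv. }
  assert (K : forall n m, u n <= v m).
  { intros n m. apply Rle_trans with (u (max n m)). apply Mu; lia.
    apply Rle_trans with (1 := H _). apply Mv; lia. }
  destruct (completeness (fun x => exists n, x = u n)) as [x [X1 X2]].
  - exists (v 0%nat). intros x [n ->]. apply K.
  - exists (u 0%nat). now exists 0%nat.
  - exists x. intros n. split. apply X1. now exists n. apply X2. intros y [m ->]. apply K.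
Qed.

(* Some quarter of a rectangle carries at least a quarter of J, whereas J is quadratically small
   around the common point of the nested quarters. *)
Lemma goursat_rect (J : R -> R -> R -> R -> C) A B C' D :
  A <= B -> C' <= D ->
  (forall a m b c d, A <= a <= m -> m <= b <= B -> C' <= c <= d -> d <= D ->
     J a b c d = (J a m c d + J m b c d)%C) ->
  (forall a b c m d, A <= a <= b -> b <= B -> C' <= c <= m -> m <= d <= D ->
     J a b c d = (J a b c m + J a b m d)%C) ->
  (forall x y, A <= x <= B -> C' <= y <= D -> forall eps, 0 < eps -> exists delta, 0 < delta /\
     forall a b c d, A <= a <= x -> x <= b <= B -> C' <= c <= y -> y <= d <= D ->
       b - a < delta -> d - c < delta -> Cmod (J a b c d) <= eps * ((b - a) + (d - c)) ^ 2) ->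
  J A B C' D = 0.
Proof.
  intros HAB HCD add1 add2 small. apply Cmod_eq_0. apply Rle_antisym; [|apply Cmod_ge_0].
  apply Rnot_lt_le. intros Heta. set (eta := Cmod (J A B C' D)) in *.
  pose (w := B - A). pose (h := D - C').
  pose (P := fun n (q : R * R) => A <= fst q /\ fst q + w / 2 ^ n <= B /\ C' <= snd q /\
     snd q + h / 2 ^ n <= D /\ eta / 4 ^ n <= Cmod (J (fst q) (fst q + w / 2 ^ n) (snd q)
       (snd q + h / 2 ^ n))).
  (* The corner of each rectangle is kept together with its invariant [P n], from which the next
     quarter is chosen; description turns the existence of a quarter into a function that can be
     iterated. *)
  assert (step : forall n (q : {q | P n q}), {q' : {q | P (S n) q} |
     fst (proj1_sig q) <= fst (proj1_sig q') /\
     fst (proj1_sig q') + w / 2 ^ S n <= fst (proj1_sig q) + w / 2 ^ n /\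
     snd (proj1_sig q) <= snd (proj1_sig q') /\
     snd (proj1_sig q') + h / 2 ^ S n <= snd (proj1_sig q) + h / 2 ^ n}).
  { intros n [[a c] [H1 [H2 [H3 [H4 H5]]]]]. simpl in H1, H2, H3, H4, H5.
    apply constructive_indefinite_description.
    destruct (goursat_step J A B C' D n w h eta a c) as [a' [c' [K1 [K2 [K3 [K4 K5]]]]]]; auto;
      try (unfold w, h; lra).
    assert (Q : P (S n) (a', c')). { repeat split; unfold fst, snd; auto; lra. }
    exists (exist _ _ Q). unfold proj1_sig, fst, snd. auto. }
  assert (P0 : P 0%nat (A, C')).
  { assert (E1 : A + w / 2 ^ 0 = B) by (unfold w; simpl; field).
    assert (E2 : C' + h / 2 ^ 0 = D) by (unfold h; simpl; field).
    unfold P, fst, snd. rewrite E1, E2. repeat split; try lra. fold eta. simpl. lra. }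
  pose (q := fix q n : {q | P n q} := match n with O => exist _ _ P0 | S n => proj1_sig (step n (q
    n)) end).
  pose (a := fun n => fst (proj1_sig (q n))). pose (c := fun n => snd (proj1_sig (q n))).
  assert (S1 : forall n, a n <= a (S n) /\ a (S n) + w / 2 ^ S n <= a n + w / 2 ^ n /\
     c n <= c (S n) /\ c (S n) + h / 2 ^ S n <= c n + h / 2 ^ n).
  { intros n. unfold a, c. change (q (S n)) with (proj1_sig (step n (q n))).
    apply (proj2_sig (step n (q n))). }
  assert (S2 : forall n, P n (a n, c n)).
  { intros n. replace (a n, c n) with (proj1_sig (q n)). apply (proj2_sig (q n)). unfold a, c.
    now destruct (proj1_sig (q n)). }
  assert (P2 : forall n, 0 < 2 ^ n) by (intros; apply pow_lt; lra).
  assert (Pw : forall n, 0 <= w / 2 ^ n) by (intros n; apply Rdiv_le_0_compat; auto; unfold w; lra).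
  assert (Ph : forall n, 0 <= h / 2 ^ n) by (intros n; apply Rdiv_le_0_compat; auto; unfold h; lra).
  destruct (nested_interval a (fun n => a n + w / 2 ^ n)) as [x Hx].
  { intros n. apply S1. } { intros n. apply S1. } { intros n. generalize (Pw n). lra. }
  destruct (nested_interval c (fun n => c n + h / 2 ^ n)) as [y Hy].
  { intros n. apply S1. } { intros n. apply S1. } { intros n. generalize (Ph n). lra. }
  assert (Pos : 0 < (w + h) ^ 2 + 1) by (generalize (pow2_ge_0 (w + h)); lra).
  (* The lower bound eta / 4^n and the squared half-perimeter shrink at the same rate, so any eps
     with eps (w + h)^2 < eta gives a contradiction; the added 1 covers a degenerate rectangle. *)
  destruct (small x y) with (eps := eta / 2 / ((w + h) ^ 2 + 1)) as [delta [Hd Hs]].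
  { destruct (S2 0%nat) as [H1 [H2 _]]. simpl in H1, H2. generalize (Hx 0%nat). simpl. lra. }
  { destruct (S2 0%nat) as [_ [_ [H1 [H2 _]]]]. simpl in H1, H2. generalize (Hy 0%nat). simpl.
    lra. }
  { apply Rdiv_lt_0_compat; lra. }
  assert (N : exists n, (w + h + 1) / 2 ^ n < delta).
  { destruct (pow_lt_1_zero (1 / 2)) with (y := delta / (w + h + 1)) as [n Hn].
    - rewrite Rabs_pos_eq; lra.
    - apply Rdiv_lt_0_compat; auto. unfold w, h; lra.
    - exists n. specialize (Hn n (Nat.le_refl n)).
      assert (0 < w + h + 1) by (unfold w, h; lra).
      rewrite Rabs_pos_eq in Hn by (apply pow_le; lra).
      unfold Rdiv at 1 in Hn. rewrite Rmult_1_l, pow_inv in Hn.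
      apply Rmult_lt_compat_l with (r := w + h + 1) in Hn; auto.
      replace ((w + h + 1) * (delta / (w + h + 1))) with delta in Hn by (field; lra). exact Hn. }
  destruct N as [n Hn].
  assert (Ew : w / 2 ^ n < delta /\ h / 2 ^ n < delta).
  { assert (P1 : 0 < 1 / 2 ^ n) by (apply Rdiv_lt_0_compat; auto; lra).
    replace ((w + h + 1) / 2 ^ n) with (w / 2 ^ n + h / 2 ^ n + 1 / 2 ^ n) in Hn by (field;
      generalize (P2 n); lra).
    generalize (Pw n) (Ph n). lra. }
  destruct (S2 n) as [H1 [H2 [H3 [H4 H5]]]]. simpl in H1, H2, H3, H4, H5.
  specialize (Hs (a n) (a n + w / 2 ^ n) (c n) (c n + h / 2 ^ n)).
  specialize (Hx n). specialize (Hy n). simpl in Hx, Hy.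
  assert (Hs' := Hs ltac:(lra) ltac:(lra) ltac:(lra) ltac:(lra) ltac:(lra) ltac:(lra)).
  replace (a n + w / 2 ^ n - a n + (c n + h / 2 ^ n - c n)) with ((w + h) / 2 ^ n)
    in Hs' by (field; generalize (P2 n); lra).
  assert (K := Rle_trans _ _ _ H5 Hs').
  replace (((w + h) / 2 ^ n) ^ 2) with ((w + h) ^ 2 / 4 ^ n) in K.
  2: { replace (4 ^ n) with (2 ^ n * 2 ^ n) by (rewrite <- Rpow_mult_distr; f_equal; ring).
       field. generalize (P2 n); lra. }
  assert (P4 : 0 < 4 ^ n) by (apply pow_lt; lra).
  apply (Rmult_le_compat_r (4 ^ n)) in K; [|lra].
  replace (eta / 4 ^ n * 4 ^ n) with eta in K by (field; lra).
  replace (eta / 2 / ((w + h) ^ 2 + 1) * ((w + h) ^ 2 / 4 ^ n) * 4 ^ n) with (eta / 2 * ((w + h)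
    ^ 2 / ((w + h) ^ 2 + 1))) in K by (field; lra).
  assert ((w + h) ^ 2 / ((w + h) ^ 2 + 1) <= 1).
  { apply Rmult_le_reg_r with ((w + h) ^ 2 + 1); auto. unfold Rdiv.
    rewrite Rmult_assoc, Rinv_l; lra. }
  assert (eta / 2 * ((w + h) ^ 2 / ((w + h) ^ 2 + 1)) <= eta / 2 * 1) by (apply Rmult_le_compat_l;
    lra).
  lra.
Qed.

(** * The unit circle, and Goursat's theorem on swept regions *)

Definition expi (t : R) : C := (cos t, sin t).

Lemma expi_Cmod t : Cmod (expi t) = 1.
Proof.
  unfold expi, Cmod; simpl. rewrite !Rmult_1_r. replace (cos t * cos t + sin t * sin t) with 1.
  apply sqrt_1. generalize (sin2_cos2 t). unfold Rsqr. lra.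
Qed.

Lemma expi_plus a b : expi (a + b) = (expi a * expi b)%C.
Proof. unfold expi, Cmult; simpl. rewrite cos_plus, sin_plus. f_equal; ring. Qed.

Lemma expi_0 : expi 0 = 1.
Proof. unfold expi. now rewrite cos_0, sin_0. Qed.

Lemma expi_2PI : expi (2 * PI) = 1.
Proof. unfold expi. now rewrite cos_2PI, sin_2PI. Qed.

Lemma expi_nz t : expi t <> 0.
Proof. apply Cmod_gt_0. rewrite expi_Cmod. lra. Qed.

Lemma expi_pow t n : (expi t ^ n)%C = expi (INR n * t).
Proof.
  induction n. simpl. now rewrite Rmult_0_l, expi_0.
  rewrite S_INR. replace ((INR n + 1) * t) with (t + INR n * t) by ring.
  rewrite expi_plus, <- IHn. reflexivity.
Qed.

Lemma expi_inv t : (/ expi t)%C = expi (- t).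
Proof.
  assert (E : (expi t * expi (- t))%C = 1) by (rewrite <- expi_plus, Rplus_opp_r; apply expi_0).
  replace (expi (- t)) with (/ expi t * (expi t * expi (- t)))%C by (field; apply expi_nz).
  rewrite E. ring.
Qed.

Lemma expi_Rdiff t : Rdiff expi t (Ci * expi t)%C.
Proof.
  apply Rdiff_Re_Im.
  - apply (is_derive_ext cos). reflexivity. rewrite re_mult. simpl.
    replace (0 * cos t - 1 * sin t) with (- sin t) by ring. apply is_derive_cos.
  - apply (is_derive_ext sin). reflexivity. rewrite im_mult. simpl.
    replace (0 * sin t + 1 * cos t) with (cos t) by ring. apply is_derive_sin.
Qed.

Lemma expi_Ccont t : Ccont expi t.
Proof. exact (Rdiff_Ccont _ _ _ (expi_Rdiff t)). Qed.

Lemma expi_lipschitz a b : Cmod (expi b - expi a) <= Rabs (b - a).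
Proof.
  assert (K : forall a b, a <= b -> Cmod (expi b - expi a) <= b - a).
  { clear a b. intros a b H. replace (b - a) with ((b - a) * 1) by ring.
    apply (is_CInt_bound_const (fun t => Ci * expi t)%C); auto.
    - intros x _. rewrite Cmod_mult, Cmod_Ci, expi_Cmod. lra.
    - apply is_CInt_derive; auto. intros; apply expi_Rdiff.
      intros x _. apply (Clim_mult (locally x)). apply (Clim_const (locally x)). apply expi_Ccont. }
  destruct (Rle_dec a b).
  - rewrite Rabs_pos_eq by lra. auto.
  - rewrite Rabs_left by lra. replace (expi b - expi a)%C with (- (expi a - expi b))%C by ring.
    rewrite Cmod_opp. generalize (K b a ltac:(lra)). lra.
Qed.

(** A primitive of the affine approximation of g at z0; it makes the main part of every edge
    integral a difference of endpoint values. *)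
Lemma Cdiff_quadratic g0 g1 z0 z : Cdiff (fun w => g0 * w + g1 / 2 * (w - z0)
  ^ 2)%C z (g0 + g1 * (z - z0))%C.
Proof.
  intros eps Heps. pose (A := Cmod (g1 / 2)%C + 1).
  assert (PA : 0 < A) by (unfold A; generalize (Cmod_ge_0 (g1 / 2)%C); lra).
  exists (eps / A). split. apply Rdiv_lt_0_compat; lra. intros w Hw.
  replace (g0 * w + g1 / 2 * (w - z0) ^ 2 - (g0 * z + g1 / 2 * (z - z0) ^ 2)
    - (g0 + g1 * (z - z0)) * (w - z))%C
    with ((g1 / 2) * (w - z) * (w - z))%C.
  2: { field. }
  rewrite !Cmod_mult. apply Rmult_le_compat_r. apply Cmod_ge_0.
  apply Rle_trans with (A * (eps / A)).
  - apply Rmult_le_compat; auto using Cmod_ge_0. unfold A; lra. lra.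
  - apply Req_le. field. lra.
Qed.

(* The radial contraction onto z of the circle of radius r, and Goursat's theorem for the
   curved rectangles it sweeps. *)
Definition ray (z : C) (r t theta : R) : C := (z + RtoC t * (RtoC r * expi theta - z))%C.

Definition sweep (z : C) (r : R) (g : C -> C) (a b c d : R) : C :=
  (CInt (fun th => g (ray z r b th) * (RtoC b * (RtoC r * (Ci * expi th)))) c d
   - CInt (fun th => g (ray z r a th) * (RtoC a * (RtoC r * (Ci * expi th)))) c d
   - CInt (fun t => g (ray z r t d) * (RtoC r * expi d - z)) a b
   + CInt (fun t => g (ray z r t c) * (RtoC r * expi c - z)) a b)%C.

Lemma ray_Rdiff_th z r t th : Rdiff (fun s => ray z r t s)
  th (RtoC t * (RtoC r * (Ci * expi th)))%C.
Proof.
  assert (K : Cdiff (fun w => z + RtoC t * (RtoC r * w - z))%C (expi th) (RtoC t * RtoC r)%C).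
  { intros eps Heps. exists 1. split. lra. intros w _.
    match goal with |- Cmod ?u <= _ => replace u with (RtoC 0) by ring end.
    rewrite Cmod_0. apply Rmult_le_pos. lra. apply Cmod_ge_0. }
  generalize (Rdiff_comp _ _ _ _ _ K (expi_Rdiff th)).
  now replace (Ci * expi th * (t * r))%C with (RtoC t * (RtoC r * (Ci * expi th)))%C by ring.
Qed.

Lemma RtoC_Rdiff t : Rdiff (fun s => RtoC s) t 1.
Proof.
  apply Rdiff_iff. intros eps He. exists 1. split. lra. intros y _.
  replace (y - t - RtoC (y - t) * 1)%C with (RtoC 0) by (rewrite RtoC_minus; ring).
  rewrite Cmod_0. apply Rmult_le_pos. lra. apply Rabs_pos.
Qed.

Lemma ray_Rdiff_t z r t th : Rdiff (fun s => ray z r s th) t (RtoC r * expi th - z)%C.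
Proof.
  assert (K : Cdiff (fun w => z + w * (RtoC r * expi th - z))%C (RtoC t) (RtoC r * expi th - z)%C).
  { intros eps Heps. exists 1. split. lra. intros w _.
    match goal with |- Cmod ?u <= _ => replace u with (RtoC 0) by ring end.
    rewrite Cmod_0. apply Rmult_le_pos. lra. apply Cmod_ge_0. }
  generalize (Rdiff_comp _ _ _ _ _ K (RtoC_Rdiff t)). now rewrite Cmult_1_l.
Qed.

(** The affine approximation of g integrates exactly along the edge by [Cdiff_quadratic], so only
    the deviation [e] of g from it is left, times the speed [V] and the parameter length. *)
Lemma edge_estimate g (gam v : R -> C) a b g0 g1 z0 e V : a <= b ->
  (forall x, a <= x <= b -> Rdiff gam x (v x)) -> (forall x, a <= x <= b -> Ccont v x) ->
  (forall x, a <= x <= b -> Clim (Cnear (gam x)) g (g (gam x))) ->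
  (forall x, a <= x <= b -> Cmod (g (gam x) - (g0 + g1 * (gam x - z0))) <= e) ->
  (forall x, a <= x <= b -> Cmod (v x) <= V) ->
  Cmod (CInt (fun x => g (gam x) * v x) a b
    - ((g0 * gam b + g1 / 2 * (gam b - z0) ^ 2) - (g0 * gam a + g1 / 2 * (gam a - z0) ^ 2)))%C
    <= (b - a) * (e * V).
Proof.
  intros Hab H1 H2 H3 H4 H5.
  assert (I1 : is_CInt (fun x => g (gam x) * v x)%C a b (CInt (fun x => g (gam x) * v x)%C a b)).
  { apply CInt_correct; auto. intros x Hx. apply (Clim_mult (locally x)).
    - apply Ccont_comp; auto. apply (Rdiff_Ccont _ _ _ (H1 x Hx)).
    - apply (H2 x Hx). }
  assert (I2 := is_CInt_derive (fun x => (g0 * gam x + g1 / 2 * (gam x - z0) ^ 2)%C)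
     (fun x => v x * (g0 + g1 * (gam x - z0)))%C a b Hab).
  assert (I3 := is_CInt_minus _ _ _ _ _ _ I1 (I2
    (fun x Hx => Rdiff_comp _ _ _ _ _ (Cdiff_quadratic g0 g1 z0 (gam x)) (H1 x Hx))
    ltac:(intros x Hx; apply (Clim_mult (locally x)); [apply (H2 x Hx)|];
      apply (Clim_plus (locally x)); [apply (Clim_const (locally x))|];
      apply (Clim_mult (locally x)); [apply (Clim_const (locally x))|];
      apply (Clim_minus (locally x)); [apply (Rdiff_Ccont _ _ _ (H1 x Hx))|apply (Clim_const
        (locally x))]))).
  apply (is_CInt_bound_const _ _ _ _ _ Hab) with (2 := I3).
  intros x Hx.
  replace (g (gam x) * v x - v x * (g0 + g1 * (gam x - z0)))%C with
    ((g (gam x) - (g0 + g1 * (gam x - z0))) * v x)%C by ring.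
  rewrite Cmod_mult. apply Rmult_le_compat; auto using Cmod_ge_0.
Qed.

Lemma ray_lipschitz z r t th t' th' : 0 <= r <= 1 -> Cmod z <= 1 -> 0 <= t <= 1 ->
  Cmod (ray z r t' th' - ray z r t th) <= 2 * Rabs (t' - t) + Rabs (th' - th).
Proof.
  intros Hr Hz Ht. unfold ray.
  replace (z + RtoC t' * (RtoC r * expi th' - z) - (z + RtoC t * (RtoC r * expi th - z)))%C
    with (RtoC (t' - t) * (RtoC r * expi th' - z) + RtoC t * RtoC r * (expi th' - expi th))%C
    by (rewrite RtoC_minus; ring).
  apply Rle_trans with (1 := Cmod_triangle _ _). rewrite !Cmod_mult, !Cmod_R.
  rewrite (Rabs_pos_eq t), (Rabs_pos_eq r), (Rmult_comm 2) by lra. apply Rplus_le_compat.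
  - apply Rmult_le_compat_l. apply Rabs_pos. apply Rle_trans with (1 := Cmod_triangle _ _).
    rewrite Cmod_opp, Cmod_mult, Cmod_R, expi_Cmod, Rabs_pos_eq; lra.
  - generalize (expi_lipschitz th th') (Cmod_ge_0 (expi th' - expi th)). intros.
    rewrite <- (Rmult_1_l (Rabs (th' - th))). apply Rmult_le_compat; auto.
    apply Rmult_le_pos; lra. nra.
Qed.

Lemma sweep_zero z r g t0 t1 th0 th1 : 0 <= r <= 1 -> Cmod z <= 1 -> 0 <= t0 <= t1 -> t1 <= 1 ->
  th0 <= th1 ->
  (forall t th, t0 <= t <= t1 -> th0 <= th <= th1 -> exists l, Cdiff g (ray z r t th) l) ->
  sweep z r g t0 t1 th0 th1 = 0.
Proof.
  intros Hr Hz Ht Ht1 Hth Hg.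
  assert (Gc : forall t th, t0 <= t <= t1 -> th0 <= th <= th1 ->
     Clim (Cnear (ray z r t th)) g (g (ray z r t th))).
  { intros t th h1 h2. destruct (Hg t th h1 h2) as [l Hl]. apply (Cdiff_continuous _ _ _ Hl). }
  assert (vth : forall t x, Ccont (fun th => RtoC t * (RtoC r * (Ci * expi th)))%C x).
  { intros t x. repeat (apply (Clim_mult (locally x)); [apply (Clim_const (locally x))|]).
    apply expi_Ccont. }
  assert (I1 : forall t c d, t0 <= t <= t1 -> th0 <= c <= d -> d <= th1 ->
    is_CInt (fun th => g (ray z r t th) * (RtoC t * (RtoC r * (Ci * expi th))))%C c d
       (CInt (fun th => g (ray z r t th) * (RtoC t * (RtoC r * (Ci * expi th))))%C c d)).
  { intros t c d h1 h2 h3. apply CInt_correct. lra. intros x Hx.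
    apply (Clim_mult (locally x)); [|apply vth].
    apply (Ccont_comp g (fun th => ray z r t th)). apply Gc; lra.
    apply (Rdiff_Ccont _ _ _ (ray_Rdiff_th z r t x)). }
  assert (I2 : forall th a b, th0 <= th <= th1 -> t0 <= a <= b -> b <= t1 ->
    is_CInt (fun t => g (ray z r t th) * (RtoC r * expi th - z))%C a b
       (CInt (fun t => g (ray z r t th) * (RtoC r * expi th - z))%C a b)).
  { intros th a b h1 h2 h3. apply CInt_correct. lra. intros x Hx.
    apply (Clim_mult (locally x)); [|apply (Clim_const (locally x))].
    apply (Ccont_comp g (fun t => ray z r t th)). apply Gc; lra.
    apply (Rdiff_Ccont _ _ _ (ray_Rdiff_t z r x th)). }
  apply goursat_rect; try lra.
  - intros a m b c d h1 h2 h3 h4. unfold sweep.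
    rewrite (CInt_unique _ _ _ _ (is_CInt_Chasles _ _ _ _ _ _ (I2 d a m ltac:(lra) ltac:(lra)
      ltac:(lra)) (I2 d m b ltac:(lra) ltac:(lra) ltac:(lra)))).
    rewrite (CInt_unique _ _ _ _ (is_CInt_Chasles _ _ _ _ _ _ (I2 c a m ltac:(lra) ltac:(lra)
      ltac:(lra)) (I2 c m b ltac:(lra) ltac:(lra) ltac:(lra)))).
    ring.
  - intros a b c m d h1 h2 h3 h4. unfold sweep.
    rewrite (CInt_unique _ _ _ _ (is_CInt_Chasles _ _ _ _ _ _ (I1 a c m ltac:(lra) ltac:(lra)
      ltac:(lra)) (I1 a m d ltac:(lra) ltac:(lra) ltac:(lra)))).
    rewrite (CInt_unique _ _ _ _ (is_CInt_Chasles _ _ _ _ _ _ (I1 b c m ltac:(lra) ltac:(lra)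
      ltac:(lra)) (I1 b m d ltac:(lra) ltac:(lra) ltac:(lra)))).
    ring.
  - intros x y Hx Hy eps Heps. set (z0 := ray z r x y).
    (* [ray] is 2-Lipschitz in the radial and 1-Lipschitz in the angular parameter, so a cell of
       half-perimeter [S] stays within [2 * S] of [z0]. With speeds at most 2 and 1, the factor 1/8
       keeps the four edge errors below eps S^2 in total. *)
    destruct (Hg x y Hx Hy) as [l Hl]. destruct (Hl (eps / 8) ltac:(lra)) as [dl [Hd K]].
    exists (dl / 8). split. lra. intros a b c d h1 h2 h3 h4 h5 h6.
    set (S := (b - a) + (d - c)).
    assert (Near : forall t th, a <= t <= b -> c <= th <= d ->
      Cmod (g (ray z r t th) - (g z0 + l * (ray z r t th - z0))) <= eps / 8 * (2 * S)).
    { intros t th k1 k2.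
      assert (D : Cmod (ray z r t th - z0) <= 2 * S).
      { apply Rle_trans with (1 := ray_lipschitz z r x y t th Hr Hz ltac:(lra)).
        assert (Rabs (t - x) <= b - a) by (apply Rabs_le; lra).
        assert (Rabs (th - y) <= d - c) by (apply Rabs_le; lra). unfold S. lra. }
      replace (g (ray z r t th) - (g z0 + l * (ray z r t th - z0)))%C
        with (g (ray z r t th) - g z0 - l * (ray z r t th - z0))%C by ring.
      apply Rle_trans with (1 := K (ray z r t th) ltac:(apply Rle_lt_trans with (1 := D);
        unfold S; lra)).
      apply Rmult_le_compat_l; auto. lra. }
    assert (Vt : forall th, Cmod (RtoC r * expi th - z) <= 2).
    { intros th. apply Rle_trans with (1 := Cmod_triangle _ _).
      rewrite Cmod_opp, Cmod_mult, Cmod_R, expi_Cmod, Rabs_pos_eq; lra. }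
    assert (Vth : forall t th, 0 <= t <= 1 -> Cmod (RtoC t * (RtoC r * (Ci * expi th))) <= 1).
    { intros t th k. rewrite !Cmod_mult, !Cmod_R, expi_Cmod, Cmod_Ci, !Rabs_pos_eq by lra. nra. }
    assert (Q1 : forall t, a <= t <= b -> _) by (intros t k;
      exact (edge_estimate g (fun th => ray z r t th)
        (fun th => (RtoC t * (RtoC r * (Ci * expi th)))%C) c d
        (g z0) l z0 (eps / 8 * (2 * S)) 1 ltac:(lra) (fun th _ => ray_Rdiff_th z r t th)
          (fun th _ => vth t th)
        (fun th k' => Gc t th ltac:(lra) ltac:(lra)) (fun th k' => Near t th k k')
          (fun th k' => Vth t th ltac:(lra)))).
    assert (Q2 : forall th, c <= th <= d -> _) by (intros th k;
      exact (edge_estimate g (fun t => ray z r t th) (fun t => (RtoC r * expi th - z)%C) a b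
        (g z0) l z0 (eps / 8 * (2 * S)) 2 ltac:(lra) (fun t _ => ray_Rdiff_t z r t th)
          (fun t _ => Ccont_const _ t)
        (fun t k' => Gc t th ltac:(lra) ltac:(lra)) (fun t k' => Near t th k' k)
          (fun t k' => Vt th))).
    assert (B1 := Q1 a ltac:(lra)). assert (B2 := Q1 b ltac:(lra)).
    assert (B3 := Q2 c ltac:(lra)). assert (B4 := Q2 d ltac:(lra)). cbv beta in B1, B2, B3, B4.
    unfold sweep. clear Q1 Q2.
    (* The increments of the quadratic primitive cancel around the closed boundary, which is what
       [ring] verifies; the four deviations are then generalized and bounded separately. *)
    match goal with |- Cmod (?i2 - ?i1 - ?i4 + ?i3) <= _ =>
      match type of B1 with Cmod (_ - ?p1) <= _ =>
      match type of B2 with Cmod (_ - ?p2) <= _ =>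
      match type of B3 with Cmod (_ - ?p3) <= _ =>
      match type of B4 with Cmod (_ - ?p4) <= _ =>
        replace (i2 - i1 - i4 + i3)%C with ((i2 - p2) - (i1 - p1) - (i4 - p4)
          + (i3 - p3))%C by ring;
        generalize dependent (i2 - p2)%C; generalize dependent (i1 - p1)%C;
        generalize dependent (i3 - p3)%C; generalize dependent (i4 - p4)%C
      end end end end end.
    intros e4 B4 e3 B3 e1 B1 e2 B2.
    apply Rle_trans with (Cmod e2 + Cmod e1 + Cmod e4 + Cmod e3).
    { apply Rle_trans with (1 := Cmod_triangle _ _). apply Rplus_le_compat_r.
      apply Rle_trans with (1 := Cmod_triangle _ _). rewrite Cmod_opp. apply Rplus_le_compat_r.
      apply Rle_trans with (1 := Cmod_triangle _ _). rewrite Cmod_opp. lra. }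
    assert (0 <= S) by (unfold S; lra).
    assert (b - a <= S) by (unfold S; lra). assert (d - c <= S) by (unfold S; lra).
    apply Rle_trans with (2 * ((d - c) * (eps / 8 * (2 * S) * 1)) + 2 * ((b - a)
      * (eps / 8 * (2 * S) * 2))). lra.
    replace (eps * S ^ 2) with (eps * S * ((b - a) + (d - c))) by (unfold S; ring).
    assert (0 <= eps * S) by (apply Rmult_le_pos; lra). nra.
Qed.

(* Caratheodory's formulation: the difference quotient extends continuously. *)
Lemma Cdiff_slope f z l : Cdiff f z l <->
  exists q, q z = l /\ Clim (Cnear z) q l /\ forall w, (f w - f z)%C = (q w * (w - z))%C.
Proof.
  split.
  - intros H. exists (fun w => if Ceq_dec w z then l else ((f w - f z) / (w - z))%C).
    destruct (Ceq_dec z z) as [_|n]; [|easy]. repeat split.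
    + intros eps. destruct (H (eps / 2)) as [d [Hd K]]. generalize (cond_pos eps); lra.
      apply (Cnear_intro _ _ d Hd). intros w Hw. destruct (Ceq_dec w z) as [e|n].
      * replace (l - l)%C with (RtoC 0) by ring. rewrite Cmod_0. apply cond_pos.
      * assert (N : (w - z)%C <> 0) by now apply Cminus_eq_contra.
        assert (P : 0 < Cmod (w - z)) by now apply Cmod_gt_0.
        replace ((f w - f z) / (w - z) - l)%C with ((f w - f z - l * (w - z))
          / (w - z))%C by (field; auto).
        rewrite Cmod_div by auto. apply Rmult_lt_reg_r with (1 := P).
        unfold Rdiv. rewrite Rmult_assoc, Rinv_l, Rmult_1_r by lra.
        apply Rle_lt_trans with (1 := K w Hw). apply Rmult_lt_compat_r; auto.
        generalize (cond_pos eps); lra.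
    + intros w. destruct (Ceq_dec w z) as [->|n]. ring.
      field. now apply Cminus_eq_contra.
  - intros [q [E [Hq Hf]]] eps Heps. specialize (Hq (mkposreal eps Heps)).
    apply Cnear_elim in Hq. destruct Hq as [d [Hd K]]. exists d. split; auto. intros w Hw.
    rewrite Hf. replace (q w * (w - z) - l * (w - z))%C with ((q w - l) * (w - z))%C by ring.
    rewrite Cmod_mult. apply Rmult_le_compat_r. apply Cmod_ge_0. apply Rlt_le, (K w Hw).
Qed.

(** * Rules of complex differentiation *)

Lemma Cdiff_id z : Cdiff (fun w => w) z 1.
Proof.
  apply Cdiff_slope. exists (fun _ => RtoC 1). repeat split.
  apply (Clim_const (Cnear z)). intros; ring.
Qed.

Lemma Cdiff_const c z : Cdiff (fun _ => c) z 0.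
Proof.
  apply Cdiff_slope. exists (fun _ => RtoC 0). repeat split.
  apply (Clim_const (Cnear z)). intros; ring.
Qed.

Lemma Cdiff_plus f g z l m : Cdiff f z l -> Cdiff g z m -> Cdiff (fun w => f w + g w)%C z (l + m)%C.
Proof.
  rewrite !Cdiff_slope. intros [p [p1 [p2 p3]]] [q [q1 [q2 q3]]].
  exists (fun w => p w + q w)%C. repeat split. now rewrite p1, q1.
  apply (Clim_plus (Cnear z)); auto. intros w.
  replace (f w + g w - (f z + g z))%C with ((f w - f z) + (g w - g z))%C by ring. rewrite p3, q3.
  ring.
Qed.

Lemma Cdiff_mult f g z l m : Cdiff f z l -> Cdiff g z m ->
  Cdiff (fun w => f w * g w)%C z (l * g z + f z * m)%C.
Proof.
  intros H1 H2. assert (Cg := Cdiff_continuous _ _ _ H2). revert H1 H2.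
  rewrite !Cdiff_slope. intros [p [p1 [p2 p3]]] [q [q1 [q2 q3]]].
  exists (fun w => p w * g w + f z * q w)%C. repeat split. now rewrite p1, q1.
  apply (Clim_plus (Cnear z)); apply (Clim_mult (Cnear z)); auto. apply (Clim_const (Cnear z)).
  intros w.
  replace (f w * g w - f z * g z)%C with ((f w - f z) * g w + f z * (g w - g z))%C by ring.
  rewrite p3, q3. ring.
Qed.

Lemma Cdiff_inv (f : C -> C) z l : f z <> RtoC 0 -> Cdiff f z l ->
  Cdiff (fun w => / f w)%C z (- l / (f z * f z))%C.
Proof.
  intros N H. assert (Cf := Cdiff_continuous _ _ _ H).
  assert (NN : Cnear z (fun w => f w <> RtoC 0)).
  { generalize (Cf (mkposreal _ (proj1 (Cmod_gt_0 _) N))). apply filter_imp. intros w Hw E.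
    simpl in Hw.
    rewrite E in Hw. replace (0 - f z)%C with (- f z)%C in Hw by ring. rewrite Cmod_opp in Hw.
    lra. }
  apply Cnear_elim in NN. destruct NN as [d0 [Hd0 NN]].
  apply Cdiff_slope in H. destruct H as [p [p1 [p2 p3]]].
  assert (L : Clim (Cnear z) (fun w => - p w / (f w * f z))%C (- l / (f z * f z))%C).
  { apply (Clim_div (Cnear z)). now apply Cmult_neq_0. now apply (Clim_opp (Cnear z)).
    apply (Clim_mult (Cnear z)); auto. apply (Clim_const (Cnear z)). }
  intros eps Heps. specialize (L (mkposreal eps Heps)). apply Cnear_elim in L.
  destruct L as [d [Hd K]].
  exists (Rmin d d0). split. now apply Rmin_pos. intros w Hw.
  specialize (K w (Rlt_le_trans _ _ _ Hw (Rmin_l _ _))).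
  specialize (NN w (Rlt_le_trans _ _ _ Hw (Rmin_r _ _))). simpl in K.
  replace (/ f w - / f z - - l / (f z * f z) * (w - z))%C
    with ((- p w / (f w * f z) - - l / (f z * f z)) * (w - z))%C.
  - rewrite Cmod_mult. apply Rmult_le_compat_r. apply Cmod_ge_0. lra.
  - replace (/ f w - / f z)%C with (- (f w - f z) / (f w * f z))%C by (field; auto).
    rewrite p3. field; auto.
Qed.

Lemma analytic_Cdiff f z : analytic_on_disk f -> in_disk z -> exists l, Cdiff f z l.
Proof. intros H Hz. destruct (H z Hz) as [l Hl]. exists l. now apply Cdiff_is_derive. Qed.

(** * Cauchy's formula on a circle *)

Lemma circle_minus_nz z r th : Cmod z < r -> (RtoC r * expi th - z)%C <> 0.
Proof.
  intros H E. assert (K : z = (RtoC r * expi th)%C).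
  { symmetry. now apply Ceq_minus. }
  rewrite K, Cmod_mult, Cmod_R, expi_Cmod in H. generalize (Rle_abs r). lra.
Qed.

Lemma ray_in_disk z r t th : 0 < r < 1 -> Cmod z < r -> 0 <= t <= 1 -> in_disk (ray z r t th).
Proof.
  intros Hr Hz Ht. unfold in_disk, ray.
  replace (z + RtoC t * (RtoC r * expi th - z))%C with (RtoC (1 - t)
    * z + RtoC t * RtoC r * expi th)%C
    by (rewrite RtoC_minus; ring).
  apply Rle_lt_trans with (1 := Cmod_triangle _ _).
  rewrite !Cmod_mult, !Cmod_R, expi_Cmod, !Rabs_pos_eq by lra.
  assert ((1 - t) * Cmod z <= (1 - t) * r) by (apply Rmult_le_compat_l; lra). nra.
Qed.

Lemma circle_in_disk r th : 0 <= r < 1 -> in_disk (RtoC r * expi th).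
Proof. intros H. unfold in_disk. rewrite Cmod_mult, Cmod_R, expi_Cmod, Rabs_pos_eq; lra. Qed.

Lemma circle_Ccont r th : Ccont (fun s => RtoC r * expi s)%C th.
Proof. apply (Clim_mult (locally th)). apply (Clim_const (locally th)). apply expi_Ccont. Qed.

Lemma kernel_Ccont r z th : Cmod z < r -> Ccont (fun s => RtoC r * expi s / (RtoC r * expi s -
  z))%C th.
Proof.
  intros H. apply (Clim_div (locally th)). now apply circle_minus_nz. apply circle_Ccont.
  apply (Clim_minus (locally th)). apply circle_Ccont. apply (Clim_const (locally th)).
Qed.

Lemma is_CInt_Ci f a b l : is_CInt (fun x => f x * Ci)%C a b l -> is_CInt f a b (l * - Ci)%C.
Proof.
  intros H. assert (E : (Ci * Ci)%C = (- (1))%C).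
  { unfold Ci, Cmult, Copp, RtoC; simpl. f_equal; ring. }
  replace (l * - Ci)%C with ((- Ci) * l)%C by ring.
  apply (is_RInt_ext (V := C_R_NormedModule) (fun x => (- Ci) * (f x * Ci))%C).
  - intros x _. eqC. transitivity (- (Ci * Ci) * f x)%C. ring. rewrite E. ring.
  - now apply (is_CInt_scal (- Ci)%C).
Qed.

(** [sweep_zero] is applied to the difference quotient (f(w) - f(z)) / (w - z), with t0 > 0 keeping
    w away from z. The rays at angles 0 and 2 pi coincide, so their contributions cancel. Along the
    contracted circles dw / (w - z) does not depend on t, hence the same kernel on both sides; the
    constant factor i is divided out. *)
Lemma cauchy_homotopy f z r t0 : analytic_on_disk f -> 0 < r < 1 -> Cmod z < r -> 0 < t0 <= 1 ->
  CInt (fun th => (f (RtoC r * expi th) - f z)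
    * (RtoC r * expi th / (RtoC r * expi th - z)))%C 0 (2 * PI) =
  CInt (fun th => (f (ray z r t0 th) - f z) * (RtoC r * expi th / (RtoC r * expi th - z)))%C 0 (2 *
    PI).
Proof.
  intros Hf Hr Hz Ht. assert (Ppi := PI_RGT_0).
  pose (g := fun w => ((f w - f z) * / (w - z))%C).
  assert (RN : forall t th, 0 < t -> (ray z r t th - z)%C <> 0).
  { intros t th k. unfold ray. replace (z + RtoC t * (RtoC r * expi th - z)
      - z)%C with (RtoC t * (RtoC r * expi th - z))%C by ring.
    apply Cmult_neq_0. intros E. apply RtoC_inj in E. lra. now apply circle_minus_nz. }
  assert (Hg : forall t th, t0 <= t <= 1 -> 0 <= th <= 2 * PI ->
    exists l, Cdiff g (ray z r t th) l).
  { intros t th k1 k2. destruct (analytic_Cdiff f (ray z r t th) Hf) as [l Hl].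
    apply ray_in_disk; auto; lra.
    eexists. apply Cdiff_mult.
    - apply (Cdiff_plus f (fun _ => - f z)%C). exact Hl. apply Cdiff_const.
    - apply Cdiff_inv. apply RN; lra. apply (Cdiff_plus (fun w => w) (fun _ => - z)%C).
      apply Cdiff_id. apply Cdiff_const. }
  assert (S0 := sweep_zero z r g t0 1 0 (2 * PI) ltac:(lra) ltac:(lra) ltac:(lra) ltac:(lra)
    ltac:(lra) Hg).
  unfold sweep in S0. rewrite expi_2PI, expi_0 in S0.
  assert (E0 : CInt (fun t => g (ray z r t (2 * PI))
    * (r * 1 - z))%C t0 1 = CInt (fun t => g (ray z r t 0) * (r * 1 - z))%C t0 1).
  { unfold ray. rewrite expi_2PI, expi_0. reflexivity. }
  rewrite E0 in S0.
  assert (T : forall t, t0 <= t <= 1 ->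
     CInt (fun th => (f (ray z r t th) - f z) * (RtoC r * expi th / (RtoC r * expi th - z)))%C 0 (2
       * PI) =
     (CInt (fun th => g (ray z r t th) * (t * (r * (Ci * expi th))))%C 0 (2 * PI) * - Ci)%C).
  { intros t k. apply CInt_unique. apply is_CInt_Ci.
    apply (is_CInt_ext (fun th => g (ray z r t th) * (t * (r * (Ci * expi th))))%C). lra.
    - intros th _. unfold g, ray.
      set (w := f (z + t * (r * expi th - z))%C).
      replace (z + t * (r * expi th - z) - z)%C with (RtoC t * (r * expi th - z))%C by ring.
      field. split. now apply circle_minus_nz. intros E. apply RtoC_inj in E. lra.
    - apply CInt_correct. lra. intros th k2. apply (Clim_mult (locally th)).
      + apply (Ccont_comp g (fun th => ray z r t th)). destruct (Hg t th k k2) as [l Hl].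
        apply (Cdiff_continuous _ _ _ Hl). apply (Rdiff_Ccont _ _ _ (ray_Rdiff_th z r t th)).
      + repeat (apply (Clim_mult (locally th)); [apply (Clim_const (locally th))|]).
        apply expi_Ccont. }
  rewrite (T t0) by lra.
  transitivity (CInt (fun th => (f (ray z r 1 th) - f z)
    * (RtoC r * expi th / (RtoC r * expi th - z)))%C 0 (2 * PI)).
  { assert (Er : forall th, ray z r 1 th = (RtoC r * expi th)%C) by (intros; unfold ray; ring).
    unfold CInt. f_equal; apply RInt_ext; intros th _; now rewrite Er. }
  rewrite (T 1) by lra. f_equal.
  match type of S0 with (?A - ?B - ?D + ?D)%C = _ => replace A with ((A - B - D + D)
    + B)%C by ring end.
  rewrite S0. ring.
Qed.

(** After contracting to [t0], the first factor is small by continuity of f at z while the kernel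
    stays below r / (r - |z|). Subtracting f(z) inside the integral makes the value 0 and spares the
    integral of the kernel alone. *)
Lemma cauchy_formula f z r : analytic_on_disk f -> 0 < r < 1 -> Cmod z < r ->
  is_CInt (fun th => (f (RtoC r * expi th) - f z)
    * (RtoC r * expi th / (RtoC r * expi th - z)))%C 0 (2 * PI) 0.
Proof.
  intros Hf Hr Hz. assert (Ppi := PI_RGT_0).
  assert (Fc : forall w, in_disk w -> Clim (Cnear w) f (f w)).
  { intros w Hw. destruct (analytic_Cdiff f w Hf Hw) as [l Hl]. apply (Cdiff_continuous _ _ _ Hl). }
  assert (I : forall t, 0 <= t <= 1 -> is_CInt (fun th => (f (ray z r t th) - f z)
    * (RtoC r * expi th / (RtoC r * expi th - z)))%C 0 (2 * PI)
     (CInt (fun th => (f (ray z r t th) - f z)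
       * (RtoC r * expi th / (RtoC r * expi th - z)))%C 0 (2 * PI))).
  { intros t k. apply CInt_correct. lra. intros th _. apply (Clim_mult (locally th)).
    - apply (Clim_minus (locally th)); [|apply (Clim_const (locally th))].
      apply (Ccont_comp f (fun th => ray z r t th)). apply Fc, ray_in_disk; auto; lra.
      apply (Rdiff_Ccont _ _ _ (ray_Rdiff_th z r t th)).
    - now apply kernel_Ccont. }
  assert (V : CInt (fun th => (f (RtoC r * expi th) - f z)
    * (RtoC r * expi th / (RtoC r * expi th - z)))%C 0 (2 * PI) = 0).
  { apply Cmod_eq_0. apply Rle_antisym; [|apply Cmod_ge_0]. apply le_epsilon. intros e He.
    rewrite Rplus_0_l.
    pose (A := 2 * PI * (r / (r - Cmod z))).
    assert (PA : 0 < A). { unfold A. apply Rmult_lt_0_compat. lra. apply Rdiv_lt_0_compat; lra. }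
    assert (Pe : 0 < e / A) by (apply Rdiv_lt_0_compat; lra).
    assert (Hzd : in_disk z) by (unfold in_disk; lra).
    destruct (Cnear_elim _ _ (Fc z Hzd (mkposreal _ Pe))) as [d [Hd K]]. simpl in K.
    (* [ray] moves at speed at most 2 in t, so the contracted circle lies within d / 2 of z. *)
    pose (t0 := Rmin 1 (d / 4)). assert (0 < t0 <= 1 /\ t0 <= d / 4).
    { unfold t0. repeat split. apply Rmin_pos; lra. apply Rmin_l. apply Rmin_r. }
    rewrite (cauchy_homotopy f z r t0) by (auto; lra).
    replace e with ((2 * PI - 0) * (e / A * (r / (r - Cmod z)))) by (unfold A; field; lra).
    apply (is_CInt_bound_const _ 0 (2 * PI) _ _ ltac:(lra)) with (2 := I t0 ltac:(lra)).
    intros th _. rewrite Cmod_mult. apply Rmult_le_compat; try apply Cmod_ge_0.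
    - apply Rlt_le, K. generalize (ray_lipschitz z r 0 th t0 th ltac:(lra) ltac:(lra) ltac:(lra)).
      replace (ray z r 0 th) with z by (unfold ray; ring).
      rewrite !Rminus_diag, Rabs_R0, Rminus_0_r, Rabs_pos_eq by lra.
      lra.
    - rewrite Cmod_div by now apply circle_minus_nz.
      rewrite Cmod_mult, Cmod_R, expi_Cmod, Rabs_pos_eq, Rmult_1_r by lra.
      apply Rmult_le_compat_l. lra. apply Rinv_le_contravar. lra.
      generalize (Cmod_triangle_inv (RtoC r * expi th) z).
      rewrite Cmod_mult, Cmod_R, expi_Cmod, (Rabs_pos_eq r) by lra.
      generalize (Rle_abs (r * 1 - Cmod z)). lra. }
  rewrite <- V.
  assert (Er : forall th, ray z r 1 th = (RtoC r * expi th)%C) by (intros; unfold ray; ring).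
  apply (is_CInt_ext (fun th => (f (ray z r 1 th) - f z)
    * (RtoC r * expi th / (RtoC r * expi th - z)))%C). lra.
  intros th _. now rewrite Er.
  replace (CInt (fun th => (f (RtoC r * expi th) - f z)
    * (RtoC r * expi th / (RtoC r * expi th - z)))%C 0 (2 * PI)) with
   (CInt (fun th => (f (ray z r 1 th) - f z) * (RtoC r * expi th / (RtoC r * expi th - z)))%C 0 (2
     * PI)).
  apply I; lra.
  unfold CInt. f_equal; apply RInt_ext; intros th _; now rewrite Er.
Qed.

(** * Taylor coefficients as circle integrals *)

Lemma expi_scal_Rdiff k t : Rdiff (fun s => expi (k * s)) t (RtoC k * Ci * expi (k * t))%C.
Proof.
  apply Rdiff_Re_Im.
  - apply (is_derive_ext (fun s => cos (k * s))). reflexivity.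
    replace (Re (RtoC k * Ci * expi (k * t))) with (- k * sin (k * t))
      by (unfold RtoC, Ci, expi, Cmult, Re; simpl; ring).
    auto_derive; auto. ring.
  - apply (is_derive_ext (fun s => sin (k * s))). reflexivity.
    replace (Im (RtoC k * Ci * expi (k * t))) with (k * cos (k * t))
      by (unfold RtoC, Ci, expi, Cmult, Im; simpl; ring).
    auto_derive; auto. ring.
Qed.

Lemma circle_inv_pow r th n : 0 < r ->
  ((/ (RtoC r * expi th)) ^ n)%C = (RtoC ((/ r) ^ n) * expi (- INR n * th))%C.
Proof.
  intros Hr. replace (/ (RtoC r * expi th))%C with (RtoC (/ r) * expi (- th))%C.
  - rewrite Cpow_mult_l, <- RtoC_pow, expi_pow. do 2 f_equal. ring.
  - rewrite <- expi_inv, RtoC_inv by lra. field. split. apply expi_nz.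
    intros E. apply RtoC_inj in E. lra.
Qed.

Lemma circle_inv_pow_Ccont r th n : 0 < r -> Ccont (fun s => (/ (RtoC r * expi s)) ^ n)%C th.
Proof.
  intros Hr. apply (Clim_pow (locally th)), (Clim_inv (locally th)).
  - apply Cmult_neq_0. intros E. apply RtoC_inj in E. lra. apply expi_nz.
  - apply circle_Ccont.
Qed.

Lemma int_circle_pow r n : 0 < r -> is_CInt (fun th => (/ (RtoC r * expi th))
  ^ (S n))%C 0 (2 * PI) 0.
Proof.
  intros Hr. assert (Ppi := PI_RGT_0).
  set (k := - INR (S n)). assert (Nk : k <> 0) by (unfold k;
    generalize (lt_0_INR (S n) ltac:(lia)); lra).
  pose (c := (RtoC ((/ r) ^ S n) * (- Ci) * RtoC (/ k))%C).
  replace (RtoC 0) with (c * expi (k * (2 * PI)) - c * expi (k * 0))%C.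
  - apply (is_CInt_derive (fun th => c * expi (k * th))%C).
    + lra.
    + intros x _. rewrite circle_inv_pow by auto.
      assert (D := expi_scal_Rdiff k x).
      assert (Q : Cdiff (fun w => c * w)%C (expi (k * x)) c).
      { generalize (Cdiff_mult (fun _ => c) (fun w => w) (expi (k * x)) _ _ (Cdiff_const c _)
          (Cdiff_id _)).
        now replace (0 * expi (k * x) + c * 1)%C with c by ring. }
      generalize (Rdiff_comp _ (fun s => expi (k * s)) _ _ _ Q D). fold k.
      replace (RtoC k * Ci * expi (k * x) * c)%C with (RtoC ((/ r) ^ S n) * expi (k * x))%C; auto.
      unfold c. transitivity (RtoC (/ r ^ S n) * expi (k * x) * (RtoC k * RtoC (/ k))
        * (- (Ci * Ci)))%C.
      2: { rewrite pow_inv. ring. }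
      rewrite <- RtoC_mult, Rinv_r by auto. rewrite pow_inv. rewrite Cmult_1_r.
      replace (- (Ci * Ci))%C with (RtoC 1). ring. unfold Ci, Cmult, Copp, RtoC; simpl.
      f_equal; ring.
    + intros x _. now apply circle_inv_pow_Ccont.
  - rewrite Rmult_0_r, expi_0. replace (k * (2 * PI)) with (- (INR (S n) * (2 * PI)))
      by (unfold k; ring).
    rewrite <- expi_inv, <- expi_pow, expi_2PI, Cpow_1_l. field.
Qed.

(** Cauchy's coefficient integral written in the angle, where dw / (i w) becomes the angular element
    and w^(-n) remains. For analytic f it is the same for all radii in (0, 1), by [tcoef_indep]. *)
Definition tcoef (f : C -> C) (r : R) (n : nat) : C :=
  (RtoC (/ (2 * PI)) * CInt (fun th => f (RtoC r * expi th) * (/ (RtoC r * expi th)) ^ n)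
    0 (2 * PI))%C.

Lemma tcoef_correct f r n : analytic_on_disk f -> 0 < r < 1 ->
  is_CInt (fun th => f (RtoC r * expi th) * (/ (RtoC r * expi th)) ^ n)%C 0 (2 * PI)
    (RtoC (2 * PI) * tcoef f r n)%C.
Proof.
  intros Hf Hr. assert (Ppi := PI_RGT_0). unfold tcoef.
  rewrite Cmult_assoc, <- RtoC_mult, Rinv_r, Cmult_1_l by lra.
  apply CInt_correct. lra. intros th _. apply (Clim_mult (locally th)).
  - apply (Ccont_comp f (fun s => RtoC r * expi s)%C).
    destruct (analytic_Cdiff f (RtoC r * expi th)%C Hf) as [l Hl]. apply circle_in_disk; lra.
    apply (Cdiff_continuous _ _ _ Hl). apply circle_Ccont.
  - apply circle_inv_pow_Ccont. lra.
Qed.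

(** The term with f(w) produces the Taylor polynomial; in the term with f(z) every nonzero power of
    1 / w integrates to 0, so only the summand n = 0 contributes. *)
Lemma taylor_partial f z r N : analytic_on_disk f -> 0 < r < 1 -> Cmod z < r ->
  is_CInt (fun th => (f (RtoC r * expi th) - f z) * Csum (fun n => (z / (RtoC r * expi th)) ^ n)
    N)%C
    0 (2 * PI) (RtoC (2 * PI) * (Csum (fun n => tcoef f r n * z ^ n) N - f z))%C.
Proof.
  intros Hf Hr Hz. assert (Ppi := PI_RGT_0). induction N.
  - apply (is_CInt_ext (fun th => f (RtoC r * expi th) * (/ (RtoC r * expi th)) ^ 0 - f z)%C). lra.
    + intros th _. rewrite Csum_0. simpl. ring.
    + rewrite Csum_0. replace (RtoC (2 * PI) * (tcoef f r 0 * z ^ 0 - f z))%C with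
        (RtoC (2 * PI) * tcoef f r 0 - f z * RtoC (2 * PI))%C by (simpl; ring).
      apply is_CInt_minus. now apply tcoef_correct.
      apply (is_CInt_ext (fun th => f z * 1)%C). lra. intros; ring. apply is_CInt_scal.
      replace (RtoC (2 * PI)) with (RtoC (2 * PI) - RtoC 0)%C by ring.
      apply (is_CInt_derive (fun t => RtoC t)). lra. intros; apply RtoC_Rdiff.
      intros; apply Ccont_const.
  - rewrite Csum_S.
    replace (RtoC (2 * PI) * (Csum (fun n => tcoef f r n * z ^ n) N + tcoef f r (S N)
      * z ^ S N - f z))%C with
      (RtoC (2 * PI) * (Csum (fun n => tcoef f r n * z ^ n) N - f z) +
       (z ^ S N * (RtoC (2 * PI) * tcoef f r (S N)) - (f z * z ^ S N) * 0))%C by ring.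
    assert (I := is_CInt_plus _ _ _ _ _ _ IHN
       (is_CInt_minus _ _ _ _ _ _ (is_CInt_scal (z ^ S N)%C _ _ _ _ (tcoef_correct f r (S N) Hf Hr))
          (is_CInt_scal (f z * z ^ S N)%C _ _ _ _ (int_circle_pow r N ltac:(lra))))).
    apply (is_CInt_ext _ _ 0 (2 * PI) _ ltac:(lra)) with (2 := I).
    intros th _. rewrite Csum_S. unfold Cdiv. rewrite !Cpow_mult_l. ring.
Qed.

Lemma geometric_remainder (q : C) N : q <> 1 ->
  (Csum (fun n => q ^ n) N = (1 - q ^ S N) / (1 - q))%C.
Proof.
  intros Hq. assert (Hq' : (1 - q)%C <> 0) by (apply Cminus_eq_contra; auto).
  induction N. rewrite Csum_0. simpl. field; auto.
  rewrite Csum_S, IHN. simpl. field; auto.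
Qed.

(** The kernel w / (w - z) is the sum of the powers of z / w. Subtracting [taylor_partial] from
    [cauchy_formula] leaves the integrand [h] times (z / w)^(N+1), so the error is geometric with
    ratio |z| / r. *)
Lemma taylor f z r : analytic_on_disk f -> 0 < r < 1 -> Cmod z < r ->
  Cseries (fun n => tcoef f r n * z ^ n)%C (f z).
Proof.
  intros Hf Hr Hz. assert (Ppi := PI_RGT_0).
  pose (h := fun th => ((f (RtoC r * expi th) - f z)
    * (RtoC r * expi th / (RtoC r * expi th - z)))%C).
  assert (Hh : forall th, Ccont h th).
  { intros th. apply (Clim_mult (locally th)).
    - apply (Clim_minus (locally th)); [|apply (Clim_const (locally th))].
      apply (Ccont_comp f (fun s => RtoC r * expi s)%C).
      destruct (analytic_Cdiff f (RtoC r * expi th)%C Hf) as [l Hl]. apply circle_in_disk; lra.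
      apply (Cdiff_continuous _ _ _ Hl). apply circle_Ccont.
    - now apply kernel_Ccont. }
  assert (EI : ex_RInt (fun th => Cmod (h th)) 0 (2 * PI)).
  { apply (ex_RInt_continuous (V := R_CompleteNormedModule)). intros th _.
    apply (Clim_Cmod (locally th)). apply Hh. }
  destruct EI as [I HI].
  pose (q := Cmod z / r).
  assert (Hq : 0 <= q < 1).
  { unfold q. split. apply Rdiv_le_0_compat. apply Cmod_ge_0. lra.
    apply Rmult_lt_reg_r with r. lra. unfold Rdiv. rewrite Rmult_assoc, Rinv_l; lra. }
  apply (Clim_squeeze eventually _ _ (fun N => / (2 * PI) * I * q * q ^ N)).
  - apply filter_forall. intros N.
    assert (J := is_CInt_minus _ _ _ _ _ _ (cauchy_formula f z r Hf Hr Hz)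
      (taylor_partial f z r N Hf Hr Hz)).
    assert (B : Cmod (0 - RtoC (2 * PI) * (Csum (fun n => tcoef f r n * z ^ n)
      N - f z))%C <= q ^ S N * I).
    { apply (is_CInt_bound _ (fun th => q ^ S N * Cmod (h th)) 0 (2 * PI)) with (3 := J). lra.
      - intros th _.
        assert (Ne : (RtoC r * expi th)%C <> 0).
        { apply Cmult_neq_0. intros E. apply RtoC_inj in E. lra. apply expi_nz. }
        assert (Nz := circle_minus_nz z r th Hz).
        assert (N1 : (z / (RtoC r * expi th))%C <> 1).
        { intros E. apply Nz. replace z with (z / (RtoC r * expi th) * (RtoC r * expi th))%C.
          rewrite E. ring. field. split. apply expi_nz. intros E'. apply RtoC_inj in E'. lra. }
        rewrite geometric_remainder by auto.
        replace ((f (RtoC r * expi th) - f z) * (RtoC r * expi th / (RtoC r * expi th - z)) -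
          (f (RtoC r * expi th) - f z) * ((1 - (z / (RtoC r * expi th)) ^ S N)
            / (1 - z / (RtoC r * expi th))))%C
          with ((z / (RtoC r * expi th)) ^ S N * h th)%C.
        + rewrite Cmod_mult, Cmod_pow, Cmod_div, Cmod_mult, Cmod_R, expi_Cmod, Rabs_pos_eq,
            Rmult_1_r by (auto; lra).
          apply Rle_refl.
        + unfold h. set (p := (z / (RtoC r * expi th))%C) in *.
          set (zz := (RtoC r * expi th)%C) in *.
          assert (Ep : z = (p * zz)%C) by (unfold p; field; auto).
          assert (N2 : (1 - p)%C <> 0) by (apply Cminus_eq_contra; auto).
          rewrite Ep at 2 4. replace (zz - p * zz)%C with ((1 - p) * zz)%C by ring. field. auto.
      - apply (is_RInt_scal (V := R_NormedModule)). exact HI. }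
    replace (0 - RtoC (2 * PI) * (Csum (fun n => tcoef f r n * z ^ n) N - f z))%C with
      (- (RtoC (2 * PI) * (Csum (fun n => tcoef f r n * z ^ n) N - f z)))%C in B by ring.
    rewrite Cmod_opp, Cmod_mult, Cmod_R, Rabs_pos_eq in B by lra.
    apply Rmult_le_reg_l with (2 * PI). lra. apply Rle_trans with (1 := B). apply Req_le. simpl.
    field. lra.
  - apply (Rlim0_scal eventually). apply is_lim_seq_geom. rewrite Rabs_pos_eq; lra.
Qed.

(** Both families expand f on the disk of radius [m], the smaller radius; after rescaling by [m] the
    expansions live on the unit disk, where coefficients are unique. *)
Lemma tcoef_indep f r r' n : analytic_on_disk f -> 0 < r < 1 -> 0 < r' < 1 ->
  tcoef f r n = tcoef f r' n.
Proof.
  intros Hf Hr Hr'. pose (m := Rmin r r').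
  assert (Hm : 0 < m < 1 /\ m <= r /\ m <= r').
  { unfold m. generalize (Rmin_l r r') (Rmin_r r r') (Rmin_pos r r'). lra. }
  assert (D : forall s, 0 < s < 1 -> m <= s -> forall z, in_disk z ->
    Cseries (fun n => tcoef f s n * RtoC m ^ n * z ^ n)%C (f (RtoC m * z)%C)).
  { intros s Hs Ms z Hz. apply (Cseries_ext (fun n => tcoef f s n * (RtoC m * z) ^ n)%C).
    intros k. rewrite Cpow_mult_l. ring. apply taylor; auto.
    rewrite Cmod_mult, Cmod_R, Rabs_pos_eq by lra. unfold in_disk in Hz.
    apply Rlt_le_trans with (m * 1); [|lra]. apply Rmult_lt_compat_l; lra. }
  assert (CD : forall s, 0 < s < 1 -> m <= s -> conv_disk (fun n => tcoef f s n * RtoC m ^ n)%C).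
  { intros s Hs Ms. apply conv_disk_pseries. intros z Hz. exists (f (RtoC m * z)%C). now apply D. }
  assert (E : (tcoef f r n * RtoC m ^ n)%C = (tcoef f r' n * RtoC m ^ n)%C).
  { apply (pseries_coef_unique (fun n => tcoef f r n * RtoC m ^ n)%C (fun n => tcoef f r' n * RtoC
      m ^ n)%C); try (apply CD; lra).
    intros z Hz. unfold PSum. rewrite (CSer_unique _ _ (D r Hr ltac:(lra) z Hz)).
    now rewrite (CSer_unique _ _ (D r' Hr' ltac:(lra) z Hz)). }
  assert (N : (RtoC m ^ n)%C <> 0). { apply Cpow_nz. intros K. apply RtoC_inj in K. lra. }
  replace (tcoef f r n) with (tcoef f r n * RtoC m ^ n / RtoC m ^ n)%C by (field; auto).
  rewrite E. field; auto.
Qed.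

(** * The moment series converges for functions of Korenblum growth *)

Lemma ex_series_pos_bounded (u : nat -> R) M : (forall n, 0 <= u n) ->
  (forall n, @sum_n R_AbelianMonoid u n <= M) -> ex_series u.
Proof.
  intros H B. destruct (ex_finite_lim_seq_incr (@sum_n R_AbelianMonoid u) M) as [l Hl]; auto.
  - intros n. rewrite sum_Sn. unfold plus; simpl. generalize (H (S n)). lra.
  - exists l. exact Hl.
Qed.

Lemma ln_ge_1_inv y : 0 < y -> 1 - / y <= ln y.
Proof.
  intros H. generalize (exp_ineq1_le (- ln y)). rewrite exp_Ropp, exp_ln by auto. lra.
Qed.

(** Follows from exp(y) >= 1 + y and ln(y) >= 1 - 1/y; the right side telescopes, which bounds the
    sums of k^(-q-1) without comparing with an integral. *)
Lemma Rpower_telescope q x : 0 < q -> 0 < x ->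
  q * Rpower (x + 1) (- q - 1) <= Rpower x (- q) - Rpower (x + 1) (- q).
Proof.
  intros Hq Hx.
  replace (Rpower x (- q)) with (Rpower (x + 1) (- q) * exp (q * ln ((x + 1) / x))).
  - replace (Rpower (x + 1) (- q - 1)) with (Rpower (x + 1) (- q) * / (x + 1)).
    2: { unfold Rminus. rewrite Rpower_plus. f_equal. rewrite Rpower_Ropp, Rpower_1; lra. }
    generalize (exp_ineq1_le (q * ln ((x + 1) / x))).
    assert (L := ln_ge_1_inv ((x + 1) / x) ltac:(apply Rdiv_lt_0_compat; lra)).
    replace (1 - / ((x + 1) / x)) with (/ (x + 1)) in L by (field; lra).
    intros E. assert (P : 0 < Rpower (x + 1) (- q)) by apply exp_pos.
    apply (Rmult_le_compat_l q) in L; [|lra]. 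
    set (e := exp _) in *. nra.
  - unfold Rpower. rewrite <- exp_plus. f_equal. rewrite ln_div by lra. ring.
Qed.

Lemma Rpower_pos x y : 0 < Rpower x y.
Proof. apply exp_pos. Qed.

Lemma ex_series_Rpower q : 0 < q -> ex_series (fun k => Rpower (INR k + 2) (- q - 1)).
Proof.
  intros Hq. apply (ex_series_pos_bounded _ (/ q)).
  - intros n. apply Rlt_le, Rpower_pos.
  - assert (K : forall n, @sum_n R_AbelianMonoid (fun k => Rpower (INR k + 2) (- q - 1)) n
        <= / q * (1 - Rpower (INR n + 2) (- q))).
    { intros n. induction n.
      - rewrite sum_O. generalize (Rpower_telescope q 1 Hq ltac:(lra)). simpl INR.
        replace (1 + 1) with (0 + 2) by ring.
        replace (Rpower 1 (- q)) with 1 by (unfold Rpower; rewrite ln_1, Rmult_0_r, exp_0; auto).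
        intros E. apply Rmult_le_reg_l with q; auto. rewrite <- Rmult_assoc, Rinv_r; lra.
      - rewrite sum_Sn. unfold plus; simpl. generalize (Rpower_telescope q (INR n + 2)
          Hq ltac:(generalize (pos_INR n); lra)).
        intros E. apply Rle_trans with (1 := Rplus_le_compat_r _ _ _ IHn).
        replace (match n with 0%nat => 1 | S _ => INR n + 1 end) with (INR n + 1) by (destruct n;
          simpl; lra).
        replace (INR n + 1 + 2) with (INR n + 2 + 1) by ring.
        apply Rmult_le_reg_l with q; auto. rewrite Rmult_plus_distr_l, <- !Rmult_assoc, Rinv_r;
          lra. }
    intros n. apply Rle_trans with (1 := K n). rewrite <- (Rmult_1_r (/ q)) at 2.
    apply Rmult_le_compat_l. apply Rlt_le, Rinv_0_lt_compat; auto.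
    generalize (Rpower_pos (INR n + 2) (- q)); lra.
Qed.

Lemma abel_summation (a u : nat -> C) N :
  (Csum (fun k => a k * u k) N = Csum (fun k => Csum a k * (u k - u (S k)))
    N + Csum a N * u (S N))%C.
Proof.
  induction N; rewrite ?Csum_0. ring.
  rewrite !Csum_S, IHN. ring.
Qed.

Lemma inv_INR_diff n k : (/ RtoC (INR (n + k + 1)) - / RtoC (INR (n + S k + 1)))%C =
  RtoC (/ (INR (n + k + 1) * INR (n + S k + 1))).
Proof.
  assert (P : 0 < INR (n + k + 1)) by (apply lt_0_INR; lia).
  replace (n + S k + 1)%nat with (S (n + k + 1)) by lia. rewrite S_INR.
  rewrite <- !RtoC_inv by lra. rewrite <- RtoC_minus. f_equal. field. lra.
Qed.

(** After Abel summation the terms are of order k^s k^(-2) and the boundary term of order N^(s-1).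
    The majorant [v] does not involve n (its factor 2 comes from k + 1 >= (k + 2) / 2), so the
    moments are bounded uniformly and their power series converges on the disk. *)
Lemma moment_series (a : nat -> C) K s : 0 < s < 1 ->
  (forall k, Cmod (Csum a k) <= K * Rpower (INR k + 2) s) ->
  exists B, forall n, exists b, Cseries (fun k => Cdiv (a k) (RtoC (INR (n + k + 1))))
    b /\ Cmod b <= B.
Proof.
  intros Hs HA.
  assert (PK : 0 <= K).
  { apply Rmult_le_reg_r with (Rpower (INR 0 + 2) s). apply Rpower_pos. rewrite Rmult_0_l.
    apply Rle_trans with (2 := HA 0%nat). apply Cmod_ge_0. }
  pose (v := fun k => 2 * K * Rpower (INR k + 2) (- (1 - s) - 1)).
  assert (Ev : ex_series v) by (apply (ex_series_Rmult (2 * K)), ex_series_Rpower; lra).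
  assert (V : forall n k, Cmod (Csum a k * (/ RtoC (INR (n + k + 1))
    - / RtoC (INR (n + S k + 1))))%C <= v k).
  { intros n k. rewrite inv_INR_diff, Cmod_mult, Cmod_R.
    assert (P1 : INR k + 1 <= INR (n + k + 1)) by (rewrite !plus_INR; simpl;
      generalize (pos_INR n); lra).
    assert (P2 : INR k + 2 <= INR (n + S k + 1)) by (rewrite !plus_INR, S_INR; simpl;
      generalize (pos_INR n); lra).
    generalize (pos_INR k). intros Pk.
    rewrite Rabs_pos_eq. 2: { apply Rlt_le, Rinv_0_lt_compat, Rmult_lt_0_compat; lra. }
    apply Rle_trans with ((K * Rpower (INR k + 2) s) * (2 * (/ (INR k + 2) * / (INR k + 2)))).
    - apply Rmult_le_compat; auto using Cmod_ge_0.
      apply Rlt_le, Rinv_0_lt_compat, Rmult_lt_0_compat; lra.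
      replace (2 * (/ (INR k + 2) * / (INR k + 2))) with (/ ((INR k + 2) / 2 * (INR k + 2)))
        by (field; lra).
      apply Rinv_le_contravar. apply Rmult_lt_0_compat; lra. apply Rmult_le_compat; lra.
    - unfold v. replace (- (1 - s) - 1) with (s + (- (1) + - (1))) by ring.
      rewrite !Rpower_plus, Rpower_Ropp, Rpower_1 by lra. apply Req_le. ring. }
  assert (L0 : forall n, Clim eventually (fun N => Csum a N * / RtoC (INR (n + S N + 1)))%C 0).
  { intros n. apply (Clim_squeeze eventually _ _ (fun N => K * Rpower (INR N + 2) (- (1 - s)))).
    - apply filter_forall. intros N.
      assert (P2 : INR N + 2 <= INR (n + S N + 1)) by (rewrite !plus_INR, S_INR; simpl;
        generalize (pos_INR n); lra).
      generalize (pos_INR N). intros Pk.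
      replace (Csum a N * / RtoC (INR (n + S N + 1))
        - 0)%C with (Csum a N * / RtoC (INR (n + S N + 1)))%C by ring.
      rewrite <- RtoC_inv, Cmod_mult, Cmod_R by lra.
      rewrite Rabs_pos_eq. 2: { apply Rlt_le, Rinv_0_lt_compat; lra. }
      replace (- (1 - s)) with (s + - (1)) by ring.
      rewrite Rpower_plus, Rpower_Ropp, Rpower_1, <- Rmult_assoc by lra.
      apply Rmult_le_compat; auto using Cmod_ge_0. apply Rlt_le, Rinv_0_lt_compat; lra.
      apply Rinv_le_contravar; lra.
    - apply (Rlim0_scal eventually). unfold Rpower.
      apply (filterlim_comp _ _ _ (fun N => - (1 - s) * ln (INR N + 2))
        exp eventually (Rbar_locally m_infty)).
      2: apply is_lim_exp_m.
      apply (is_lim_seq_ext (fun N => - ((1 - s) * ln (INR N + 2)))). intros; ring.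
      apply (is_lim_seq_opp _ p_infty).
      replace p_infty with (Rbar_mult (1 - s) p_infty).
      2: { simpl. destruct (Rle_dec 0 (1 - s)); [|lra].
      destruct (Rle_lt_or_eq_dec 0 (1 - s) r); auto; lra. }
      apply is_lim_seq_scal_l.
      apply (filterlim_comp _ _ _ (fun N => INR N + 2) ln eventually (Rbar_locally p_infty)).
      2: apply is_lim_ln_p.
      apply (is_lim_seq_plus _ _ p_infty 2 p_infty). apply is_lim_seq_INR. apply is_lim_seq_const.
      easy. }
  exists (Series v). intros n.
  destruct (ex_Cseries _ _ (V n) Ev) as [b Hb]. exists b. split.
  - apply (Clim_ext eventually (fun N => Csum (fun k => Csum a k * (/ RtoC (INR (n + k + 1))
      - / RtoC (INR (n + S k + 1)))) N
       + Csum a N * / RtoC (INR (n + S N + 1)))%C).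
    intros N. symmetry. apply (abel_summation a (fun k => / RtoC (INR (n + k + 1)))%C).
    replace b with (b + 0)%C by ring. apply (Clim_plus eventually); auto.
  - apply (Cseries_le _ _ v Hb); auto.
Qed.

(** * Growth of the partial sums of Taylor coefficients *)

Lemma sin_half_ge th : 0 <= th <= PI -> th / 6 <= sin (th / 2).
Proof.
  intros H. assert (P4 := PI_4).
  destruct (pre_sin_bound (th / 2) 0) as [L _]; try lra.
  apply Rle_trans with (2 := L). unfold sin_approx, sin_term. simpl.
  (* x - x^3 / 6 >= x / 3 holds for 0 <= x <= 2, and pi <= 4 keeps x in that range. *)
  set (x := th / 2). assert (0 <= x <= 2) by (unfold x; lra).
  replace (th / 6) with (x / 3) by (unfold x; field). 
  replace (_ + _) with (x - x * x * x / 6) by field. nra.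
Qed.

Lemma exp_le_compat x y : x <= y -> exp x <= exp y.
Proof. intros [H|H]. now apply Rlt_le, exp_increasing. subst; lra. Qed.

Lemma exp_pow_INR x n : exp x ^ n = exp (INR n * x).
Proof.
  induction n. simpl. now rewrite Rmult_0_l, exp_0.
  rewrite S_INR, Rmult_plus_distr_r, exp_plus, Rmult_1_l, <- IHn. simpl. ring.
Qed.

(** On a circle at distance 1 / m from the boundary the powers of w up to N + 1 are bounded, so the
    geometric sum is both O(m) and O(1 / |w - 1|). The two summands on the right account for angles
    near 0 and near 2 pi. *)
Lemma dirichlet_bound r m N th : (m = INR N + 2) -> r = 1 - / m -> 0 <= th <= 2 * PI ->
  Cmod (Csum (fun k => (/ (RtoC r * expi th)) ^ k)%C N) <=
  2 * exp 2 * (/ (/ m + th / 6) + / (/ m + (2 * PI - th) / 6)).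
Proof.
  intros Em Er Hth. generalize (pos_INR N). intros PN.
  assert (Hm : 0 < / m <= 1 / 2).
  { split. apply Rinv_0_lt_compat; lra. replace (1 / 2) with (/ 2) by field.
    apply Rinv_le_contravar; lra. }
  set (w := (/ (RtoC r * expi th))%C).
  assert (Nz : (RtoC r * expi th)%C <> 0).
  { apply Cmult_neq_0. intros E; apply RtoC_inj in E; lra. apply expi_nz. }
  assert (Cw : Cmod w = / r).
  { unfold w. rewrite Cmod_inv, Cmod_mult, Cmod_R, expi_Cmod, Rabs_pos_eq, Rmult_1_r by (auto;
      lra). auto. }
  assert (Ir : 1 <= / r) by (rewrite <- Rinv_1; apply Rinv_le_contravar; lra).
  (* As m >= 2, 1 / r <= 1 + 2 / m <= exp(2 / m), and the exponent N + 1 is below m. *)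
  assert (Pw : forall k, (k <= S N)%nat -> (/ r) ^ k <= exp 2).
  { intros k Hk. apply Rle_trans with ((/ r) ^ S N). apply Rle_pow; auto.
    apply Rle_trans with (exp (/ m * 2) ^ S N).
    - apply pow_incr. split. lra. 
      apply Rle_trans with (1 + / m * 2). 2: apply exp_ineq1_le.
      apply Rmult_le_reg_l with r. lra. rewrite Rinv_r by lra. rewrite Er. nra.
    - rewrite exp_pow_INR. apply exp_le_compat. rewrite S_INR.
      apply Rle_trans with (m * (/ m * 2)). 
      + apply Rmult_le_compat_r; lra.
      + apply Req_le. field. lra. }
  set (D := Csum (fun k => w ^ k)%C N).
  assert (B1 : Cmod D <= m * exp 2).
  { apply Rle_trans with (@sum_n R_AbelianMonoid (fun k => (/ r) ^ k) N).
    apply Csum_Cmod. intros k. rewrite Cmod_pow, Cw. lra.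
    apply Rle_trans with ((INR N + 1) * exp 2).
    2: { apply Rmult_le_compat_r. apply Rlt_le, exp_pos. lra. }
    assert (Q : forall n, (n <= S N)%nat -> @sum_n R_AbelianMonoid (fun k => (/ r) ^ k)
      n <= (INR n + 1) * exp 2).
    { induction n; intros Hn; rewrite ?sum_O, ?sum_Sn, ?S_INR. generalize (Pw 0%nat ltac:(lia)).
      simpl. lra.
      unfold plus; simpl. generalize (Pw (S n) ltac:(lia)) (IHn ltac:(lia)). simpl. lra. }
    apply Q. lia. }
  assert (B2 : Cmod (w - 1) * Cmod D <= 2 * exp 2).
  { rewrite <- Cmod_mult. replace ((w - 1) * D)%C with (w ^ S N - 1)%C.
    - apply Rle_trans with (1 := Cmod_triangle _ _). rewrite Cmod_opp, Cmod_1, Cmod_pow, Cw.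
      generalize (Pw (S N) ltac:(lia)) (exp_ineq1_le 2). lra.
    - destruct (Ceq_dec w 1) as [E|n].
      + rewrite E, Cpow_1_l. ring.
      + unfold D. rewrite geometric_remainder by auto. generalize (w ^ S N)%C. intros p. field.
        apply Cminus_eq_contra. auto. }
  assert (B3 : 2 * sin (th / 2) <= Cmod (w - 1)).
  { assert (W : Cmod (w - 1) * r = Cmod (1 - RtoC r * expi th)%C).
    { replace (1 - RtoC r * expi th)%C with ((w - 1) * (RtoC r * expi th))%C.
      - rewrite !Cmod_mult, Cmod_R, expi_Cmod, (Rabs_pos_eq r) by lra. ring.
      - unfold w. field. split. apply expi_nz. intros E; apply RtoC_inj in E; lra. }
    assert (Sp : 0 <= sin (th / 2)) by (apply sin_ge_0; lra).
    (* Since r <= 1, the right side is at least (2 r sin(th / 2))^2, and |1 - r e^(i th)| is r |w -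
       1|. *)
    assert (W2 : Cmod (1 - RtoC r * expi th)%C ^ 2 = (1 - r) ^ 2 + 4 * r * sin (th / 2) ^ 2).
    { rewrite Cmod2_alt. unfold expi, Cminus, Copp, Cplus, Cmult, RtoC, Re, Im; simpl.
      assert (E1 : cos th = 1 - 2 * sin (th / 2) * sin (th / 2)).
      { rewrite <- cos_2a_sin. f_equal. field. }
      assert (E2 := sin2_cos2 th). unfold Rsqr in E2.
      replace (sin (th / 2) * (sin (th / 2) * 1)) with ((1 - cos th) / 2) by (rewrite E1; field).
      transitivity (1 - 2 * r * cos th + r * r * (sin th * sin th + cos th * cos th)). ring.
      rewrite E2. field. }
    apply Rmult_le_reg_r with r. lra. rewrite W.
    apply Rsqr_incr_0_var; [|apply Cmod_ge_0].
    unfold Rsqr. replace (Cmod (1 - RtoC r * expi th)%C * Cmod (1 - RtoC r * expi th)%C)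
      with (Cmod (1 - RtoC r * expi th)%C ^ 2) by ring.
    rewrite W2. assert (0 <= sin (th / 2) ^ 2 * r * (1 - r)).
    { apply Rmult_le_pos; [|lra]. apply Rmult_le_pos; [|lra]. apply pow2_ge_0. }
    generalize (pow2_ge_0 (1 - r)). intros. nra. }
  assert (B4 : (/ m + sin (th / 2)) * Cmod D <= 2 * exp 2).
  { assert (/ m * Cmod D <= exp 2).
    { apply Rmult_le_reg_l with m. lra. rewrite <- Rmult_assoc, Rinv_r; lra. }
    assert (2 * sin (th / 2) * Cmod D <= 2 * exp 2).
    { apply Rle_trans with (2 := B2). apply Rmult_le_compat_r; auto. apply Cmod_ge_0. }
    lra. }
  assert (PD := Cmod_ge_0 D). assert (Pe := exp_pos 2).
  assert (Gen : forall x, 0 <= x -> x <= sin (th / 2) -> Cmod D <= 2 * exp 2 * / (/ m + x)).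
  { intros x H0 H1. apply Rmult_le_reg_r with (/ m + x). lra. rewrite Rmult_assoc, Rinv_l by lra.
    nra. }
  rewrite Rmult_plus_distr_l.
  assert (Pos : forall x, 0 <= x -> 0 <= 2 * exp 2 * / (/ m + x)).
  { intros x H0. apply Rmult_le_pos. lra. apply Rlt_le, Rinv_0_lt_compat; lra. }
  destruct (Rle_dec th PI).
  - generalize (Gen (th / 6) ltac:(lra) (sin_half_ge th ltac:(lra))) (Pos ((2 * PI - th) / 6)
      ltac:(lra)). lra.
  - assert (E : (2 * PI - th) / 6 <= sin (th / 2)).
    { replace (sin (th / 2)) with (sin ((2 * PI - th) / 2)). apply sin_half_ge; lra.
      replace ((2 * PI - th) / 2) with (PI - th / 2) by field. apply sin_PI_x. }
    generalize (Gen ((2 * PI - th) / 6) ltac:(lra) E) (Pos (th / 6) ltac:(lra)). lra.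
Qed.

Lemma kernel_integral m : 2 <= m ->
  is_RInt (fun th => / (/ m + th / 6) + / (/ m + (2 * PI - th) / 6)) 0 (2 * PI)
    (12 * ln (1 + PI * m / 3)).
Proof.
  intros Hm. assert (Ppi := PI_RGT_0). assert (Im : 0 < / m) by (apply Rinv_0_lt_compat; lra).
  replace (12 * ln (1 + PI * m / 3)) with
    (minus (6 * ln (/ m + 2 * PI / 6) - 6 * ln (/ m + (2 * PI - 2 * PI) / 6))
       (6 * ln (/ m + 0 / 6) - 6 * ln (/ m + (2 * PI - 0) / 6))).
  - apply (is_RInt_derive (V := R_CompleteNormedModule) (fun th => 6 * ln (/ m + th / 6)
      - 6 * ln (/ m + (2 * PI - th) / 6))).
    + rewrite Rmin_left, Rmax_right by lra. intros x Hx. auto_derive. repeat split; lra.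
      field. assert (0 <= m * x) by (apply Rmult_le_pos; lra).
      assert (0 <= m * (2 * PI - x)) by (apply Rmult_le_pos; lra).
      repeat split; try lra.
    + rewrite Rmin_left, Rmax_right by lra. intros x Hx.
      apply (ex_derive_continuous (K := R_AbsRing) (V := R_NormedModule)). auto_derive.
      repeat split; lra.
  - unfold minus, plus, opp; simpl.
    replace (/ m + (2 * PI - 2 * PI) / 6) with (/ m) by (field; lra).
    replace (/ m + 0 / 6) with (/ m) by (field; lra).
    replace (/ m + (2 * PI - 0) / 6) with (/ m * (1 + PI * m / 3)) by (field; lra).
    replace (/ m + 2 * PI / 6) with (/ m * (1 + PI * m / 3)) by (field; lra).
    rewrite ln_mult; [ring|auto|]. nra.
Qed.

(** The radius 1/2 on the right is a mere normalization; r stays free, to be tied to N later. *)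
Lemma tcoef_partial f r N : analytic_on_disk f -> 0 < r < 1 ->
  is_CInt (fun th => f (RtoC r * expi th) * Csum (fun k => (/ (RtoC r * expi th))
    ^ k)%C N)%C 0 (2 * PI)
      (RtoC (2 * PI) * Csum (tcoef f (1 / 2)) N)%C.
Proof.
  intros Hf Hr. assert (Ppi := PI_RGT_0). induction N.
  - rewrite Csum_0, (tcoef_indep f (1 / 2) r) by (auto; lra).
    apply (is_CInt_ext (fun th => f (RtoC r * expi th) * (/ (RtoC r * expi th)) ^ 0)%C). lra.
    intros; now rewrite Csum_0. exact (tcoef_correct f r 0 Hf Hr).
  - rewrite Csum_S, (tcoef_indep f (1 / 2) r (S N)) by (auto; lra). rewrite Cmult_plus_distr_l.
    apply (is_CInt_ext (fun th => f (RtoC r * expi th) * Csum (fun k => (/ (RtoC r * expi th))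
      ^ k)%C N +
        f (RtoC r * expi th) * (/ (RtoC r * expi th)) ^ S N)%C). lra.
    intros; rewrite Csum_S; ring. apply is_CInt_plus. exact IHN.
    exact (tcoef_correct f r (S N) Hf Hr).
Qed.

(** The exponent is alpha + (1 - alpha) / 2: half of the gap between alpha and 1 absorbs the
    logarithm of the kernel, and the result is still below 1, as [moment_series] requires. *)
Lemma partial_sum_bound f M alpha : analytic_on_disk f -> 0 < alpha < 1 ->
  (forall z, in_disk z -> Cmod (f z) <= M * Rpower (1 - Cmod z ^ 2) (- alpha)) ->
  exists K, forall N, Cmod (Csum (tcoef f (1 / 2)) N) <= K * Rpower (INR N + 2) ((1 + alpha) / 2).
Proof.
  intros Hf Ha HM. assert (Ppi := PI_RGT_0). assert (P4 := PI_4).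
  assert (PM : 0 <= M).
  { apply Rmult_le_reg_r with (Rpower (1 - Cmod 0 ^ 2) (- alpha)). apply Rpower_pos.
    rewrite Rmult_0_l.
    apply Rle_trans with (2 := HM 0 ltac:(unfold in_disk; rewrite Cmod_0; lra)). apply Cmod_ge_0. }
  exists (/ (2 * PI) * (M * (2 * exp 2) * (12 * (3 * (2 / (1 - alpha)))))). intros N.
  generalize (pos_INR N). intros PN.
  (* On this circle f is O(N^alpha) and the kernel of the partial sum has mean O(log N). *)
  set (m := INR N + 2). set (r := 1 - / m).
  assert (Hm : 0 < / m <= 1 / 2).
  { split. apply Rinv_0_lt_compat; unfold m; lra. replace (1 / 2) with (/ 2) by field.
    apply Rinv_le_contravar; unfold m; lra. }
  assert (Hr : 0 < r < 1) by (unfold r; lra).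
  assert (I : is_CInt (fun th => f (RtoC r * expi th) * Csum (fun k => (/ (RtoC r * expi th))
    ^ k)%C N)%C 0 (2 * PI)
      (RtoC (2 * PI) * Csum (tcoef f (1 / 2)) N)%C).
  { now apply tcoef_partial. }
  assert (B : Cmod (RtoC (2 * PI) * Csum (tcoef f (1 / 2))
    N)%C <= (M * Rpower m alpha * (2 * exp 2)) * (12 * ln (1 + PI * m / 3))).
  { apply (is_CInt_bound _ (fun th => (M * Rpower m alpha * (2 * exp 2)) * (/ (/ m + th / 6)
      + / (/ m + (2 * PI - th) / 6))) 0 (2 * PI)) with (3 := I).
    - lra.
    - intros th Hth. rewrite Cmod_mult.
      rewrite Rmult_assoc. apply Rmult_le_compat; try apply Cmod_ge_0.
      + apply Rle_trans with (1 := HM _ (circle_in_disk r th ltac:(lra))).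
        apply Rmult_le_compat_l; auto. rewrite Cmod_mult, Cmod_R, expi_Cmod, Rabs_pos_eq, Rmult_1_r
          by lra.
        replace m with (/ / m) by (apply Rinv_inv). 
        replace (Rpower (/ / m) alpha) with (Rpower (/ m) (- alpha)).
        2: { unfold Rpower. f_equal. rewrite (ln_Rinv (/ m)) by lra. ring. }
        rewrite !Rpower_Ropp. apply Rinv_le_contravar. apply Rpower_pos.
        apply Rle_Rpower_l. lra. split. lra. unfold r. nra.
      + apply (dirichlet_bound r m N th); auto.
    - apply (is_RInt_scal (V := R_NormedModule)). apply kernel_integral. unfold m; lra. }
  rewrite Cmod_mult, Cmod_R, Rabs_pos_eq in B by lra.
  (* With m >= 2 and pi <= 4 the argument is at most m^3; then ln m is compared with a power of m
     through exp(x) >= 1 + x. *)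
  assert (L : ln (1 + PI * m / 3) <= 3 * (2 / (1 - alpha)) * Rpower m ((1 - alpha) / 2)).
  { assert (M2 : 2 <= m) by (unfold m; lra).
    apply Rle_trans with (3 * ln m).
    - replace (3 * ln m) with (ln (m ^ 3)) by (rewrite ln_pow by lra; simpl; ring).
      apply ln_le. nra. assert (4 <= m * m) by nra. simpl. nra.
    - rewrite Rmult_assoc. apply Rmult_le_compat_l. lra.
      unfold Rpower. apply Rle_trans with (2 / (1 - alpha) * ((1 - alpha) / 2 * ln m)).
      + apply Req_le. field. lra.
      + apply Rmult_le_compat_l. apply Rdiv_le_0_compat; lra.
        generalize (exp_ineq1_le ((1 - alpha) / 2 * ln m)). lra. }
  apply Rmult_le_reg_l with (2 * PI). lra. apply Rle_trans with (1 := B).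
  replace ((1 + alpha) / 2) with (alpha + (1 - alpha) / 2) by field. rewrite Rpower_plus.
  assert (0 <= M * Rpower m alpha * (2 * exp 2) * 12).
  { generalize (Rpower_pos m alpha) (exp_pos 2). intros. repeat apply Rmult_le_pos; lra. }
  replace (2 * PI * (/ (2 * PI) * (M * (2 * exp 2) * (12 * (3 * (2 / (1 - alpha)))))
    * (Rpower m alpha * Rpower m ((1 - alpha) / 2))))
    with ((M * Rpower m alpha * (2 * exp 2) * 12) * (3 * (2 / (1 - alpha)) * Rpower m ((1 - alpha)
      / 2))) by (field; lra).
  rewrite <- Rmult_assoc. apply Rmult_le_compat_l; auto.
Qed.

(** * Improper integrals of nonnegative functions over (0,1) *)

Lemma ex_RInt_cont (h : R -> R) a b : 0 < a -> a <= b -> b < 1 ->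
  (forall x, 0 < x < 1 -> continuous h x) -> ex_RInt h a b.
Proof.
  intros Ha Hab Hb H. apply ex_RInt_segment; auto. intros x Hx. apply H. lra.
Qed.

Lemma RInt_mono_interval (h : R -> R) a b a' b' : 0 < a' -> a' <= a -> a <= b -> b <= b' ->
  b' < 1 ->
  (forall x, 0 < x < 1 -> 0 <= h x) -> (forall x, 0 < x < 1 -> continuous h x) ->
  RInt h a b <= RInt h a' b'.
Proof.
  intros H0 H1 H2 H3 H4 Hp Hc.
  assert (E : forall x y, 0 < x -> x <= y -> y < 1 -> ex_RInt h x y) by (intros;
    now apply ex_RInt_cont).
  assert (P : forall x y, 0 < x -> x <= y -> y < 1 -> 0 <= RInt h x y).
  { intros x y p1 p2 p3. apply RInt_ge_0; auto. intros t Ht. apply Hp. lra. }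
  rewrite <- (RInt_Chasles h a' a b') by (apply E; lra).
  rewrite <- (RInt_Chasles h a b b') by (apply E; lra).
  unfold plus; simpl. generalize (P a' a ltac:(lra) ltac:(lra) ltac:(lra)) (P b b' ltac:(lra)
    ltac:(lra) ltac:(lra)). lra.
Qed.

(** For h >= 0 the integral over [x, y] increases with the interval, so one interval with value
    above S - eps forces all larger ones to within eps of S; these form a set of the product
    filter. *)
Lemma integral01_eq (h : R -> R) S :
  (forall x, 0 < x < 1 -> 0 <= h x) -> (forall x, 0 < x < 1 -> continuous h x) ->
  (forall a b, 0 < a -> a <= b -> b < 1 -> RInt h a b <= S) ->
  (forall eps, 0 < eps -> exists a b, 0 < a /\ a <= b /\ b < 1 /\ S - eps < RInt h a b) ->
  integral01 h = S.
Proof.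
  intros Hp Hc HB HA. unfold integral01. apply is_RInt_gen_unique.
  intros P [eps HP]. destruct (HA eps (cond_pos eps)) as [a0 [b0 [H1 [H2 [H3 H4]]]]].
  apply Filter_prod with (Q := fun x => 0 < x <= a0) (R := fun x => b0 <= x < 1).
  - exists (mkposreal a0 H1). intros y Hy Hy0. apply ball_Rabs, Rabs_lt_between in Hy.
    simpl in Hy. lra.
  - assert (H5 : 0 < 1 - b0) by lra. exists (mkposreal _ H5). intros y Hy Hy0.
    apply ball_Rabs, Rabs_lt_between in Hy.
    simpl in Hy. lra.
  - intros x y Hx Hy. exists (RInt h x y). split.
    + apply (RInt_correct (V := R_CompleteNormedModule)). apply ex_RInt_cont; auto; lra.
    + apply HP, Rabs_ball.
      generalize (HB x y ltac:(lra) ltac:(lra) ltac:(lra))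
        (RInt_mono_interval h a0 b0 x y ltac:(lra) ltac:(lra) ltac:(lra) ltac:(lra) ltac:(lra)
          Hp Hc).
      intros. apply Rabs_lt_between. lra.
Qed.

(** The bound [M] only ensures that the supremum exists; the two conclusions are all that is later
    known about an improper integral. *)
Lemma integral01_spec (h : R -> R) M :
  (forall x, 0 < x < 1 -> 0 <= h x) -> (forall x, 0 < x < 1 -> continuous h x) ->
  (forall a b, 0 < a -> a <= b -> b < 1 -> RInt h a b <= M) ->
  (forall a b, 0 < a -> a <= b -> b < 1 -> RInt h a b <= integral01 h) /\
  (forall eps, 0 < eps -> exists a b, 0 < a /\ a <= b /\ b < 1 /\ integral01 h - eps < RInt h a b).
Proof.
  intros Hp Hc HB.
  destruct (completeness (fun v => exists a b, 0 < a /\ a <= b /\ b < 1 /\ v = RInt h a b))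
    as [S [S1 S2]].
  - exists M. intros v [a [b [H1 [H2 [H3 ->]]]]]. auto.
  - exists (RInt h (1/2) (1/2)), (1/2), (1/2). lra.
  - assert (A : forall eps, 0 < eps -> exists a b, 0 < a /\ a <= b /\ b < 1 /\ S - eps < RInt h a
      b).
    { intros eps He. apply Classical_Prop.NNPP. intros N.
      assert (S <= S - eps); [|lra]. apply S2. intros v [a [b [H1 [H2 [H3 ->]]]]].
      apply Rnot_lt_le. intros L. apply N. exists a, b. auto. }
    assert (B : forall a b, 0 < a -> a <= b -> b < 1 -> RInt h a b <= S).
    { intros a b H1 H2 H3. apply S1. exists a, b. auto. }
    rewrite (integral01_eq h S); auto.
Qed.

Lemma Ccont_locally_bounded F x : Ccont F x -> exists d B, 0 < d /\ 0 <= B /\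
  forall y, Rabs (y - x) < d -> Cmod (F y) <= B.
Proof.
  intros H. destruct (Clim_bounded (locally x) F _ H) as [d Hd].
  exists d, (Cmod (F x) + 1). split. apply cond_pos. split. generalize (Cmod_ge_0 (F x)); lra.
  intros y Hy. apply Hd. exact Hy.
Qed.

(** [F] is continuous up to the endpoints while the majorant [k] may blow up there. Two end pieces
    of length t are bounded by local bounds of [F], the middle by [k]; t is chosen so that the ends
    cost at most e. *)
Lemma CInt01_bound F (k : R -> R) C0 l : (forall x, 0 <= x <= 1 -> Ccont F x) -> is_CInt F 0 1 l ->
  (forall x, 0 < x < 1 -> Cmod (F x) <= k x) -> (forall x, 0 < x < 1 -> continuous k x) ->
  (forall a b, 0 < a -> a <= b -> b < 1 -> RInt k a b <= C0) -> Cmod l <= C0.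
Proof.
  intros HF Hl Hk Hc HC. apply le_epsilon. intros e He.
  destruct (Ccont_locally_bounded F 0 (HF 0 ltac:(lra))) as [d1 [B1 [D1 [P1 Q1]]]].
  destruct (Ccont_locally_bounded F 1 (HF 1 ltac:(lra))) as [d2 [B2 [D2 [P2 Q2]]]].
  pose (t := Rmin (1/2) (Rmin (Rmin (d1/2) (d2/2)) (e / (B1 + B2 + 1)))).
  assert (Ht : 0 < t <= 1/2 /\ t < d1 /\ t < d2 /\ t <= e / (B1 + B2 + 1)).
  { assert (0 < e / (B1 + B2 + 1)) by (apply Rdiv_lt_0_compat; lra).
    unfold t. repeat split.
    - repeat apply Rmin_pos; lra.
    - apply Rmin_l.
    - eapply Rle_lt_trans. apply Rmin_r. eapply Rle_lt_trans. apply Rmin_l. eapply Rle_lt_trans.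
      apply Rmin_l. lra.
    - eapply Rle_lt_trans. apply Rmin_r. eapply Rle_lt_trans. apply Rmin_l. eapply Rle_lt_trans.
      apply Rmin_r. lra.
    - eapply Rle_trans. apply Rmin_r. apply Rmin_r. }
  clearbody t.
  assert (I1 := CInt_correct F 0 t ltac:(lra) (fun x H => HF x ltac:(lra))).
  assert (I2 := CInt_correct F t (1 - t) ltac:(lra) (fun x H => HF x ltac:(lra))).
  assert (I3 := CInt_correct F (1 - t) 1 ltac:(lra) (fun x H => HF x ltac:(lra))).
  assert (I := is_CInt_Chasles _ _ _ _ _ _ (is_CInt_Chasles _ _ _ _ _ _ I1 I2) I3).
  rewrite <- (CInt_unique _ _ _ _ Hl), (CInt_unique _ _ _ _ I).
  apply Rle_trans with (1 := Cmod_triangle _ _).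
  apply Rle_trans with (1 := Rplus_le_compat_r _ _ _ (Cmod_triangle _ _)).
  assert (L1 : Cmod (CInt F 0 t) <= (t - 0) * B1).
  { apply (is_CInt_bound_const F 0 t); auto. lra. intros x Hx. apply Q1.
    rewrite Rminus_0_r, Rabs_pos_eq; lra. }
  assert (L3 : Cmod (CInt F (1 - t) 1) <= (1 - (1 - t)) * B2).
  { apply (is_CInt_bound_const F (1 - t) 1); auto. lra. intros x Hx. apply Q2.
    rewrite Rabs_left1; lra. }
  assert (L2 : Cmod (CInt F t (1 - t)) <= C0).
  { apply Rle_trans with (RInt k t (1 - t)). 2: apply HC; lra.
    apply (is_CInt_bound F k t (1 - t)); auto. lra. intros x Hx; apply Hk; lra.
    apply (RInt_correct (V := R_CompleteNormedModule)). apply ex_RInt_cont; auto; lra. }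
  assert (t * (B1 + B2 + 1) <= e).
  { apply Rle_trans with (e / (B1 + B2 + 1) * (B1 + B2 + 1)).
    apply Rmult_le_compat_r; lra. apply Req_le. field. lra. }
  lra.
Qed.

Lemma is_derive_Rpower p x : 0 < x -> is_derive (fun s => Rpower s p) x (p * Rpower x (p - 1)).
Proof. intros H. apply is_derive_Reals. now apply derivable_pt_lim_power. Qed.

Lemma is_derive_Rpower_1m p x : x < 1 -> is_derive (fun s => Rpower (1 - s) p)
  x (- p * Rpower (1 - x) (p - 1)).
Proof.
  intros H. replace (- p * Rpower (1 - x) (p - 1)) with (scal (-1) (p * Rpower (1 - x) (p - 1)))
    by (unfold scal; simpl; unfold mult; simpl; ring).
  apply (is_derive_comp (fun s => Rpower s p) (fun s => 1 - s)). apply is_derive_Rpower; lra.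
  auto_derive; auto; ring.
Qed.

Lemma Rpower_1m_integral alpha a b : alpha < 1 -> 0 < a -> a <= b -> b < 1 ->
  RInt (fun s => Rpower (1 - s) (- alpha)) a b <= / (1 - alpha).
Proof.
  intros Ha H0 Hab Hb.
  rewrite (is_RInt_unique _ _ _ (minus (- / (1 - alpha) * Rpower (1 - b) (1 - alpha))
    (- / (1 - alpha) * Rpower (1 - a) (1 - alpha)))).
  - unfold minus, plus, opp; simpl.
    assert (P := Rinv_0_lt_compat (1 - alpha) ltac:(lra)).
    assert (L : Rpower (1 - a) (1 - alpha) <= 1).
    { unfold Rpower. apply Rle_trans with (exp 0). 2: rewrite exp_0; lra. apply exp_le_compat.
      assert (ln (1 - a) <= ln 1) by (apply ln_le; lra). rewrite ln_1 in H. nra. }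
    assert (P2 := Rpower_pos (1 - b) (1 - alpha)). nra.
  - apply (is_RInt_derive (V := R_CompleteNormedModule) (fun s => - / (1 - alpha) * Rpower (1 - s)
      (1 - alpha))).
    + rewrite Rmin_left, Rmax_right by auto. intros x Hx.
      replace (Rpower (1 - x) (- alpha)) with (- / (1 - alpha) * (- (1 - alpha) * Rpower (1 - x)
        (1 - alpha - 1))).
      apply (is_derive_scal (fun s => Rpower (1 - s) (1 - alpha))), is_derive_Rpower_1m. lra.
      replace (1 - alpha - 1) with (- alpha) by ring. field. lra.
    + rewrite Rmin_left, Rmax_right by auto. intros x Hx.
      apply (ex_derive_continuous (K := R_AbsRing) (V := R_NormedModule)). unfold Rpower.
      auto_derive. lra.
Qed.

Lemma RInt_dominated (h k : R -> R) M a b : 0 < a -> a <= b -> b < 1 ->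
  (forall x, 0 < x < 1 -> continuous h x) -> (forall x, 0 < x < 1 -> continuous k x) ->
  (forall x, 0 < x < 1 -> h x <= k x) -> RInt k a b <= M -> RInt h a b <= M.
Proof.
  intros Ha Hab Hb Ch Ck L B. apply Rle_trans with (2 := B).
  apply RInt_le; auto; try (now apply ex_RInt_cont). intros x Hx. apply L. lra.
Qed.

(** * Integral formulas for the Hilbert matrix operator *)

Lemma at_left_1_unit : at_left 1 (fun rho => 0 < rho < 1).
Proof.
  exists (mkposreal 1 Rlt_0_1). intros y Hy Hy0. apply ball_Rabs, Rabs_lt_between in Hy.
  simpl in Hy. lra.
Qed.

(** If the radius of convergence exceeds 1 this is continuity inside the disk; Abel's theorem proper
    concerns radius exactly 1. *)
Lemma abel_real (u : nat -> R) : ex_series u ->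
  filterlim (PSeries u) (at_left 1) (locally (PSeries u 1)).
Proof.
  intros H.
  assert (E1 : ex_pseries u 1).
  { apply ex_pseries_R. revert H. apply ex_series_ext. intros n. eqR. rewrite pow1. ring. }
  assert (C1 : Rbar_le 1 (CV_radius u)).
  { apply Rbar_not_lt_le. intros L. apply (CV_disk_outside u 1).
    rewrite Rabs_R1. exact L. apply (is_lim_seq_ext u). intros n; rewrite pow1; ring.
    now apply ex_series_lim_0. }
  assert (K : Rbar_lt 1 (CV_radius u) \/ CV_radius u = 1).
  { destruct (CV_radius u) as [c| |]; simpl in *; try tauto. destruct C1; [left|right]; auto.
    now f_equal. }
  destruct K as [K|K].
  - intros P HP.
    assert (Q : continuity_pt (PSeries u) 1) by (apply PSeries_continuity; now rewrite Rabs_R1).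
    apply continuity_pt_filterlim in Q. destruct (Q P HP) as [d Hd]. exists d. intros y Hy _.
    now apply Hd.
  - generalize (Abel u). rewrite K. simpl. intros A. apply A; auto. lra.
Qed.

Lemma abel u sigma : Cseries u sigma -> Clim (at_left 1) (fun rho => PSum u (RtoC rho)) sigma.
Proof.
  intros H. apply (Clim_ext (at_left 1) (fun rho => (PSeries (fun k => Re (u k))
    rho, PSeries (fun k => Im (u k)) rho))).
  intros; now rewrite PSum_real.
  assert (HR : is_series (fun k => Re (u k)) (Re sigma)).
  { apply (filterlim_ext (fun n => Re (Csum u n))). intros; apply Csum_Re.
    apply (Clim_Re eventually _ _ H). }
  assert (HI : is_series (fun k => Im (u k)) (Im sigma)).
  { apply (filterlim_ext (fun n => Im (Csum u n))). intros; apply Csum_Im.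
    apply (Clim_Im eventually _ _ H). }
  assert (One : forall (v : nat -> R) (s : R), is_series v s -> PSeries v 1 = s).
  { intros v s Hv. apply is_series_unique. revert Hv. apply is_series_ext. intros n. eqR.
    rewrite pow1. ring. }
  apply (Clim_Re_Im (at_left 1)).
  - simpl. rewrite <- (One _ _ HR). apply abel_real. now exists (Re sigma).
  - simpl. rewrite <- (One _ _ HI). apply abel_real. now exists (Im sigma).
Qed.

(** * Images of the monomials and the change of path *)

Lemma geom_Cseries w : Cmod w < 1 -> Cseries (fun n => w ^ n)%C (/ (1 - w))%C.
Proof.
  intros H. assert (N : w <> 1) by (intros ->; rewrite Cmod_1 in H; lra).
  assert (N' : (1 - w)%C <> 0) by (apply Cminus_eq_contra; auto).
  apply (Clim_squeeze eventually _ _ (fun n => Cmod w / Cmod (1 - w) * Cmod w ^ n)).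
  - apply filter_forall. intros n. rewrite geometric_remainder by auto.
    replace ((1 - w ^ S n) / (1 - w) - / (1 - w))%C with (- (w * w ^ n / (1 - w)))%C by (simpl;
      field; auto).
    rewrite Cmod_opp, Cmod_div, Cmod_mult, Cmod_pow by auto. apply Req_le. field.
    apply Rgt_not_eq, Cmod_gt_0; auto.
  - apply (Rlim0_scal eventually). apply is_lim_seq_geom. rewrite Rabs_pos_eq; auto.
    apply Cmod_ge_0.
Qed.

Lemma conv_disk_INR : conv_disk (fun n => RtoC (INR (n + 1))).
Proof.
  assert (B : conv_disk (fun _ => RtoC 1)) by (apply (conv_disk_bounded _ 1); intros;
    rewrite Cmod_1; lra).
  intros r Hr. generalize (conv_disk_Cderiv _ B r Hr).
  apply ex_series_ext. intros n. unfold Cderiv. now rewrite Cmult_1_r.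
Qed.

Lemma Cseries_times_n (a : nat -> C) w s : Cseries (fun n => RtoC (INR (n + 1)) * a (S n)
  * w ^ n)%C s ->
  Cseries (fun n => RtoC (INR n) * a n * w ^ n)%C (w * s)%C.
Proof.
  intros H. replace (w * s)%C with (RtoC (INR 0) * a 0%nat * w ^ 0 + w * s)%C by (simpl; ring).
  apply (Cseries_unshift (fun n => RtoC (INR n) * a n * w ^ n)%C).
  apply (Cseries_ext (fun n => w * (RtoC (INR (n + 1)) * a (S n) * w ^ n))%C).
  intros n. rewrite Nat.add_1_r. simpl Cpow. ring. now apply Cseries_scal.
Qed.

Lemma geom_deriv_Cseries w : Cmod w < 1 -> Cseries (fun n => RtoC (INR (n + 1))
  * w ^ n)%C (/ ((1 - w) * (1 - w)))%C.
Proof.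
  intros H. assert (N : w <> 1) by (intros ->; rewrite Cmod_1 in H; lra).
  assert (N' : (1 - w)%C <> 0) by (apply Cminus_eq_contra; auto).
  assert (E := PSum_correct _ w conv_disk_INR H). set (s := PSum _ w) in E.
  assert (E2 := Cseries_times_n (fun _ => RtoC 1) w s).
  assert (E3 := Cseries_minus _ _ _ _ E (E2 ltac:(revert E; apply Cseries_ext; intros; ring))).
  assert (E4 : (s - w * s)%C = (/ (1 - w))%C).
  { apply (Cseries_unique (fun n => w ^ n)%C); [|now apply geom_Cseries]. revert E3.
    apply Cseries_ext.
    intros n. rewrite Nat.add_1_r, S_INR, RtoC_plus. ring. }
  replace (/ ((1 - w) * (1 - w)))%C with s; auto.
  replace s with ((s - w * s) / (1 - w))%C by (field; auto). rewrite E4. field; auto.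
Qed.

Lemma Cdiff_comp F g z l m : Cdiff F (g z) l -> Cdiff g z m -> Cdiff (fun w => F (g w)) z (l * m)%C.
Proof.
  intros H1 H2. assert (Cg := Cdiff_continuous _ _ _ H2). revert H1 H2.
  rewrite !Cdiff_slope. intros [p [p1 [p2 p3]]] [q [q1 [q2 q3]]].
  exists (fun w => p (g w) * q w)%C. repeat split. now rewrite p1, q1.
  - apply (Clim_mult (Cnear z)); auto. apply (Clim_comp (Cnear z) (Cnear (g z)) g p); auto.
    intros P [eps HP]. generalize (Cg eps). unfold filtermap. apply filter_imp. intros y Hy.
    apply HP, Hy.
  - intros w. rewrite p3, q3. ring.
Qed.

Lemma Cdiff_pow z n : Cdiff (fun w => w ^ S n)%C z (RtoC (INR (n + 1)) * z ^ n)%C.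
Proof.
  induction n.
  - replace (RtoC (INR (0 + 1)) * z ^ 0)%C with (RtoC 1 * z ^ 0 + z * 0)%C by (simpl; ring).
    apply (Cdiff_mult (fun w => w) (fun w => w ^ 0)%C). apply Cdiff_id.
    exact (Cdiff_const (RtoC 1) z).
  - replace (RtoC (INR (S n + 1)) * z ^ S n)%C with (RtoC 1 * z ^ S n + z * (RtoC (INR (n + 1))
      * z ^ n))%C.
    apply (Cdiff_mult (fun w => w) (fun w => w ^ S n)%C); auto. apply Cdiff_id.
    rewrite !Nat.add_1_r, (S_INR (S n)), RtoC_plus. simpl Cpow. ring.
Qed.

(** The Taylor coefficients of the derivative of the image of z^k under the Hilbert matrix
    operator. *)
Definition monomial_coef (k n : nat) : C := RtoC (INR (n + 1) / INR (n + k + 2)).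

Lemma conv_disk_monomial k : conv_disk (monomial_coef k).
Proof.
  apply (conv_disk_bounded _ 1). intros n. unfold monomial_coef. rewrite Cmod_R.
  assert (0 < INR (n + k + 2)) by (apply lt_0_INR; lia).
  assert (INR (n + 1) <= INR (n + k + 2)) by (apply le_INR; lia).
  rewrite Rabs_pos_eq by (apply Rdiv_le_0_compat; auto; apply pos_INR).
  apply Rmult_le_reg_r with (INR (n + k + 2)); auto. unfold Rdiv. rewrite Rmult_assoc, Rinv_l; lra.
Qed.

(** On coefficients, multiplication by n + k + 2 cancels the denominator and leaves the series of 1
    / (1 - w)^2. The operator on the left is the derivative of u^(k+2) times the sum, up to a factor
    u^(k+1). *)
Lemma monomial_ode k w : Cmod w < 1 ->
  (RtoC (INR (k + 2)) * PSum (monomial_coef k) w + w * PSum (Cderiv (monomial_coef k))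
    w)%C = (/ ((1 - w) * (1 - w)))%C.
Proof.
  intros H. assert (E1 := PSum_correct _ w (conv_disk_monomial k) H).
  assert (E2 := PSum_correct _ w (conv_disk_Cderiv _ (conv_disk_monomial k)) H).
  apply Cseries_times_n in E2.
  apply (Cseries_unique (fun n => RtoC (INR (n + 1)) * w ^ n)%C); [|now apply geom_deriv_Cseries].
  generalize (Cseries_plus _ _ _ _ (Cseries_scal (RtoC (INR (k + 2))) _ _ E1) E2).
  apply Cseries_ext.
  intros n. unfold monomial_coef.
  assert (0 < INR (n + k + 2)) by (apply lt_0_INR; lia).
  assert (Q : RtoC (INR (n + 1)) = ((RtoC (INR n) + RtoC (INR (k + 2))) * RtoC (INR (n + 1)
    / INR (n + k + 2)))%C).
  { rewrite <- RtoC_plus, <- RtoC_mult, <- plus_INR, Nat.add_assoc. f_equal. field. lra. }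
  rewrite Q. ring.
Qed.

(** A primitive in the complex variable: integrating zeta^(k+1) / (1 - z zeta)^2 along any path from
    0 to 1 in the closed disk becomes the fundamental theorem of calculus. *)
Lemma monomial_primitive k z zeta : Cmod (z * zeta) < 1 ->
  Cdiff (fun u => u ^ S (S k) * PSum (monomial_coef k) (z * u))%C zeta
    (zeta ^ S k / ((1 - z * zeta) * (1 - z * zeta)))%C.
Proof.
  intros H.
  assert (D2 : Cdiff (fun u => PSum (monomial_coef k) (z * u))
    zeta (PSum (Cderiv (monomial_coef k)) (z * zeta) * z)%C).
  { apply (Cdiff_comp (PSum (monomial_coef k)) (fun u => z * u)%C).
    apply PSum_Cdiff; auto. apply conv_disk_monomial.
    generalize (Cdiff_mult (fun _ => z) (fun w => w) zeta _ _ (Cdiff_const z _) (Cdiff_id _)).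
    now replace (0 * zeta + z * 1)%C with z by ring. }
  generalize (Cdiff_mult _ _ _ _ _ (Cdiff_pow zeta (S k)) D2).
  match goal with |- Cdiff _ _ ?a -> Cdiff _ _ ?b => replace b with a; auto end.
  unfold Cdiv. rewrite <- (monomial_ode k _ H). replace (S k + 1)%nat with (k + 2)%nat by lia.
  simpl Cpow. ring.
Qed.

Definition phi (z : C) (s : R) : C := (RtoC s / (1 - RtoC (1 - s) * z))%C.

Lemma phi_den_ge z s : 0 <= s <= 1 -> 1 - (1 - s) * Cmod z <= Cmod (1 - RtoC (1 - s) * z).
Proof.
  intros Hs. generalize (Cmod_triangle_inv 1 (RtoC (1 - s) * z)).
  rewrite Cmod_1, Cmod_mult, Cmod_R, (Rabs_pos_eq (1 - s)) by lra.
  generalize (Rle_abs (1 - (1 - s) * Cmod z)). lra.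
Qed.

Lemma phi_den_pos z s : in_disk z -> 0 <= s <= 1 -> 0 < 1 - (1 - s) * Cmod z.
Proof. intros Hz Hs. unfold in_disk in Hz. generalize (Cmod_ge_0 z). intros. nra. Qed.

Lemma phi_den_nz z s : in_disk z -> 0 <= s <= 1 -> (1 - RtoC (1 - s) * z)%C <> 0.
Proof.
  intros Hz Hs. apply Cmod_gt_0. generalize (phi_den_ge z s Hs) (phi_den_pos z s Hz Hs). lra.
Qed.

Lemma phi_Cmod_le z s : in_disk z -> 0 <= s <= 1 -> Cmod (phi z s) <= s / (1 - (1 - s) * Cmod z).
Proof.
  intros Hz Hs. unfold phi. rewrite Cmod_div by now apply phi_den_nz.
  rewrite Cmod_R, Rabs_pos_eq by lra. apply Rmult_le_compat_l. lra.
  apply Rinv_le_contravar. now apply phi_den_pos. now apply phi_den_ge.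
Qed.

Lemma phi_Cmod_le_1 z s : in_disk z -> 0 <= s <= 1 -> Cmod (phi z s) <= 1.
Proof.
  intros Hz Hs. apply Rle_trans with (1 := phi_Cmod_le z s Hz Hs).
  assert (P := phi_den_pos z s Hz Hs). apply Rmult_le_reg_r with (1 := P).
  unfold Rdiv. rewrite Rmult_assoc, Rinv_l by lra. unfold in_disk in Hz. generalize (Cmod_ge_0 z).
  intros; nra.
Qed.

Lemma phi_Rdiff z s : in_disk z -> 0 <= s <= 1 ->
  Rdiff (phi z) s ((1 - z) / ((1 - RtoC (1 - s) * z) * (1 - RtoC (1 - s) * z)))%C.
Proof.
  intros Hz Hs. assert (N := phi_den_nz z s Hz Hs).
  assert (E : (1 - RtoC (1 - s) * z)%C = ((1 - z) + z * RtoC s)%C) by (rewrite RtoC_minus; ring).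
  assert (D1 : Cdiff (fun u => (1 - z) + z * u)%C (RtoC s) z).
  { generalize (Cdiff_plus _ _ _ _ _ (Cdiff_const (1 - z)%C (RtoC s))
      (Cdiff_mult (fun _ => z) (fun w => w) (RtoC s) _ _ (Cdiff_const z _) (Cdiff_id _))).
    now replace (0 + (0 * s + z * 1))%C with z by ring. }
  rewrite E in *.
  generalize (Rdiff_comp _ _ _ _ _ (Cdiff_mult _ _ _ _ _ (Cdiff_id (RtoC s))
    (Cdiff_inv (fun u => (1 - z) + z * u)%C _ _ N D1)) (RtoC_Rdiff s)).
  match goal with |- Rdiff _ _ ?a -> Rdiff _ _ ?b => replace b with a by (field; auto) end.
  apply is_derive_ext. intros t. unfold phi, Cdiv.
  replace (1 - RtoC (1 - t) * z)%C with ((1 - z) + z * RtoC t)%C by (rewrite RtoC_minus; ring).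
  reflexivity.
Qed.

Lemma phi_Ccont z s : in_disk z -> 0 <= s <= 1 -> Ccont (phi z) s.
Proof. intros Hz Hs. exact (Rdiff_Ccont _ _ _ (phi_Rdiff z s Hz Hs)). Qed.

Lemma one_minus_nz z : in_disk z -> (1 - z)%C <> 0.
Proof. intros H. apply Cminus_eq_contra. intros E. unfold in_disk in H. rewrite <- E, Cmod_1 in H.
lra. Qed.

(* Along the path s |-> phi z s from 0 to 1 one has phi' / (1 - z phi)^2 = 1 / (1 - z). *)
Lemma monomial_integral z k : in_disk z ->
  is_CInt (fun s => phi z s ^ S k / (1 - z))%C 0 1 (PSum (monomial_coef k) z).
Proof.
  intros Hz. assert (Nz := one_minus_nz z Hz).
  pose (G := fun u => (u ^ S (S k) * PSum (monomial_coef k) (z * u))%C).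
  replace (PSum (monomial_coef k) z) with (G (phi z 1) - G (phi z 0))%C.
  - apply (is_CInt_derive (fun s => G (phi z s))). lra.
    + intros s Hs. assert (N := phi_den_nz z s Hz Hs).
      assert (Hm : Cmod (z * phi z s) < 1).
      { rewrite Cmod_mult. unfold in_disk in Hz.
        generalize (phi_Cmod_le_1 z s Hz Hs) (Cmod_ge_0 z) (Cmod_ge_0 (phi z s)). intros; nra. }
      generalize (Rdiff_comp _ _ _ _ _ (monomial_primitive k z (phi z s) Hm) (phi_Rdiff z s Hz Hs)).
      match goal with |- Rdiff _ _ ?a -> Rdiff _ _ ?b => replace b with a; auto end.
      replace (1 - z * phi z s)%C with ((1 - z) / (1 - RtoC (1 - s) * z))%C.
      * field. auto.
      * unfold phi. rewrite RtoC_minus in *. field; auto.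
    + intros s Hs. apply (Clim_div (locally s)); auto. apply (Clim_pow (locally s)).
      now apply phi_Ccont.
      apply (Clim_const (locally s)).
  - unfold G. replace (phi z 1) with (RtoC 1). 2: { unfold phi. rewrite Rminus_diag. field. }
    replace (phi z 0) with (RtoC 0). 2: { unfold phi. rewrite Rminus_0_r. field.
    replace (1 - 1 * z)%C with (1 - z)%C by ring. auto. }
    rewrite Cpow_1_l. simpl. replace (z * 1)%C with z by ring. ring.
Qed.

(** * Dilations and the passage to the limit *)

Definition growth (f : C -> C) (M alpha : R) : Prop :=
  forall z, in_disk z -> Cmod (f z) <= M * Rpower (1 - Cmod z ^ 2) (- alpha).

Lemma growth_nonneg f M alpha : growth f M alpha -> 0 <= M.
Proof.
  intros H. apply Rmult_le_reg_r with (Rpower (1 - Cmod 0 ^ 2) (- alpha)). apply Rpower_pos.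
  rewrite Rmult_0_l.
  apply Rle_trans with (2 := H 0 ltac:(unfold in_disk; rewrite Cmod_0; lra)). apply Cmod_ge_0.
Qed.

Lemma disk_scale rho z : 0 <= rho < 1 -> Cmod z <= 1 -> in_disk (RtoC rho * z).
Proof.
  intros Hr Hz. unfold in_disk. rewrite Cmod_mult, Cmod_R, Rabs_pos_eq by lra.
  generalize (Cmod_ge_0 z). intros; nra.
Qed.

Lemma Rpower_neg_le x y a : 0 < x -> x <= y -> 0 <= a -> Rpower y (- a) <= Rpower x (- a).
Proof.
  intros Hx Hxy Ha. rewrite !Rpower_Ropp. apply Rinv_le_contravar. apply Rpower_pos.
  apply Rle_Rpower_l; lra.
Qed.

Lemma growth_scale f M alpha rho z : 0 <= alpha -> growth f M alpha -> 0 <= rho < 1 -> in_disk z ->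
  Cmod (f (RtoC rho * z)%C) <= M * Rpower (1 - Cmod z ^ 2) (- alpha).
Proof.
  intros Ha H Hr Hz. assert (PM := growth_nonneg _ _ _ H). unfold in_disk in Hz.
  assert (Pz := Cmod_ge_0 z).
  apply Rle_trans with (1 := H _ (disk_scale rho z Hr ltac:(lra))).
  apply Rmult_le_compat_l; auto. rewrite Cmod_mult, Cmod_R, Rabs_pos_eq by lra.
  apply Rpower_neg_le; auto. nra. assert (rho * Cmod z <= Cmod z) by nra.
  assert (0 <= rho * Cmod z) by nra. nra.
Qed.

Lemma pseries_continuous a f z : expansion a f ->
  in_disk z -> Clim (Cnear z) f (f z).
Proof. intros Hf Hz. exact (Cdiff_continuous _ _ _ (pseries_Cdiff a f z Hf Hz)). Qed.

Definition tail_bound (a : nat -> C) (rho : R) (K : nat) : R :=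
  Series (fun n => Cmod (a n) * rho ^ n) - @sum_n R_AbelianMonoid (fun n => Cmod (a n) * rho ^ n) K.

(** Uniform over the closed disk, boundary included, because the dilation brings the points inside;
    the paths of integration end at 1. *)
Lemma pseries_tail a f rho w K : expansion a f ->
  0 <= rho < 1 -> Cmod w <= 1 ->
  Cmod (Csum (fun k => a k * RtoC rho ^ k * w ^ k) K - f (RtoC rho * w))%C <= tail_bound a rho K.
Proof.
  intros Hf Hr Hw. assert (H := expansion_conv_disk a f Hf).
  apply (Cseries_tail (fun k => a k * RtoC rho ^ k * w ^ k)%C _ (fun n => Cmod (a n) * rho ^ n)).
  - generalize (Hf _ (disk_scale rho w Hr Hw)). apply Cseries_ext. intros k. rewrite Cpow_mult_l.
    ring.
  - intros n. rewrite !Cmod_mult, !Cmod_pow, Cmod_R, (Rabs_pos_eq rho) by lra.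
    rewrite <- (Rmult_1_r (Cmod (a n) * rho ^ n)) at 2. apply Rmult_le_compat_l.
    apply Rmult_le_pos. apply Cmod_ge_0. apply pow_le; lra.
    rewrite <- (pow1 n). apply pow_incr. split; auto. apply Cmod_ge_0.
  - now apply H.
Qed.

(** The n-th moment of the dilation f(rho z); placing rho^k in the argument of a power series makes
    it the Abel mean of the moment of f. *)
Definition dilated_moment (a : nat -> C) (rho : R) (n : nat) : C :=
  PSum (fun k => a k / RtoC (INR (n + k + 1)))%C (RtoC rho).

Lemma dilated_moment_series a rho n : conv_disk a -> 0 <= rho < 1 ->
  Cseries (fun k => a k * RtoC rho ^ k / RtoC (INR (n + k + 1)))%C (dilated_moment a rho n).
Proof.
  intros H Hr. apply (Cseries_ext (fun k => a k / RtoC (INR (n + k + 1)) * RtoC rho ^ k)%C).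
  intros k. unfold Cdiv. ring.
  apply CSer_correct. apply (ex_Cseries _ (fun n => Cmod (a n) * rho ^ n)); [|now apply H].
  intros k. unfold Cdiv. assert (P : 1 <= INR (n + k + 1)) by (rewrite plus_INR;
    generalize (pos_INR (n + k)); simpl; lra).
  rewrite <- RtoC_inv, !Cmod_mult, Cmod_pow, !Cmod_R, (Rabs_pos_eq rho) by lra.
  rewrite Rabs_pos_eq by (apply Rlt_le, Rinv_0_lt_compat; lra).
  apply Rmult_le_compat_r. apply pow_le; lra. rewrite <- (Rmult_1_r (Cmod (a k))) at 2.
  apply Rmult_le_compat_l. apply Cmod_ge_0. rewrite <- Rinv_1. apply Rinv_le_contravar; lra.
Qed.

Lemma int_pow m : is_CInt (fun t => RtoC t ^ m)%C 0 1 (/ RtoC (INR (m + 1)))%C.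
Proof.
  assert (P : 0 < INR (m + 1)) by (apply lt_0_INR; lia).
  assert (N : RtoC (INR (m + 1)) <> 0) by (intros E; apply RtoC_inj in E; lra).
  replace (/ RtoC (INR (m + 1)))%C with (/ RtoC (INR (m + 1))
    * RtoC 1 ^ S m - / RtoC (INR (m + 1)) * RtoC 0 ^ S m)%C
    by (rewrite Cpow_1_l; simpl; ring).
  apply (is_CInt_derive (fun t => / RtoC (INR (m + 1)) * RtoC t ^ S m)%C). lra.
  - intros x _.
    generalize (Rdiff_comp _ _ _ _ _ (Cdiff_mult (fun _ => / RtoC (INR (m + 1)))%C _ (RtoC x)
      _ _ (Cdiff_const _ _) (Cdiff_pow (RtoC x) m)) (RtoC_Rdiff x)).
    intros D. match type of D with Rdiff _ _ ?a => replace (RtoC x ^ m)%C with a by (field;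
      auto) end. exact D.
  - intros x _. apply (Clim_pow (locally x)). apply Ccont_id.
Qed.

Lemma Csum_CInt (F : nat -> R -> C) (v : nat -> C) a b N : (forall k, is_CInt (F k) a b (v k)) ->
  a <= b ->
  is_CInt (fun t => Csum (fun k => F k t) N) a b (Csum v N).
Proof.
  intros H Hab. induction N.
  - rewrite Csum_0. apply (is_CInt_ext (F 0%nat)); auto. intros; now rewrite Csum_0.
  - rewrite Csum_S. apply (is_CInt_ext (fun t => Csum (fun k => F k t) N + F (S N) t)%C); auto.
    intros; now rewrite Csum_S. apply is_CInt_plus; auto.
Qed.

Lemma tail_bound_lim a rho : conv_disk a -> 0 <= rho < 1 ->
  filterlim (tail_bound a rho) eventually (locally 0).
Proof. intros H Hr. apply Series_tail_lim. now apply H. Qed.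

Lemma RtoC_unit_Cmod t : 0 <= t <= 1 -> Cmod (RtoC t) <= 1.
Proof. intros H. rewrite Cmod_R, Rabs_pos_eq; lra. Qed.

Lemma dilated_moment_Ccont a f rho n x : expansion a f ->
  0 <= rho < 1 -> 0 <= x <= 1 -> Ccont (fun t => RtoC t ^ n * f (RtoC rho * RtoC t))%C x.
Proof.
  intros Hf Hr Hx. apply (Clim_mult (locally x)). apply (Clim_pow (locally x)), Ccont_id.
  apply (Ccont_comp f (fun t => RtoC rho * RtoC t)%C). apply (pseries_continuous a); auto.
  apply disk_scale; auto. now apply RtoC_unit_Cmod.
  apply (Clim_mult (locally x)). apply (Clim_const (locally x)). apply Ccont_id.
Qed.

Lemma dilated_moment_integral a f rho n : expansion a f -> 0 <= rho < 1 ->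
  is_CInt (fun t => RtoC t ^ n * f (RtoC rho * RtoC t))%C 0 1 (dilated_moment a rho n).
Proof.
  intros Hf Hr. assert (H := expansion_conv_disk a f Hf).
  assert (I := CInt_correct _ 0 1 ltac:(lra) (fun x Hx => dilated_moment_Ccont a f rho n x Hf Hr
    Hx)).
  replace (dilated_moment a rho n) with (CInt (fun t => RtoC t ^ n * f (RtoC rho * RtoC t))%C 0 1);
    auto.
  apply (Clim_unique eventually (Csum (fun k => a k * RtoC rho ^ k / RtoC (INR (n + k + 1)))%C)).
  2: now apply dilated_moment_series.
  apply (CInt_lim eventually (fun K t => RtoC t ^ n * Csum (fun k => a k * RtoC rho ^ k * RtoC t ^
    k) K)%C
     (fun t => RtoC t ^ n * f (RtoC rho * RtoC t))%C 0 1 _ _ (tail_bound a rho)); auto.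
  - lra.
  - apply filter_forall. intros K. split.
    + apply (is_CInt_ext (fun t => Csum (fun k => a k * RtoC rho ^ k * RtoC t ^ (n + k)) K)%C). lra.
      intros t _. rewrite <- Csum_scal. apply Csum_ext. intros k. rewrite Cpow_add_r. ring.
      apply (Csum_CInt (fun k t => a k * RtoC rho ^ k * RtoC t ^ (n + k))%C). 2: lra.
      intros k. apply is_CInt_scal. apply int_pow.
    + intros t Ht. replace (RtoC t ^ n * Csum (fun k => a k * RtoC rho ^ k * RtoC t ^ k)
        K - RtoC t ^ n * f (RtoC rho * RtoC t))%C
       with (RtoC t ^ n * (Csum (fun k => a k * RtoC rho ^ k * RtoC t ^ k)
         K - f (RtoC rho * RtoC t)))%C by ring.
      rewrite Cmod_mult. apply Rle_trans with (1 * tail_bound a rho K); [|lra].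
      apply Rmult_le_compat; try apply Cmod_ge_0.
      * rewrite Cmod_pow, <- (pow1 n). apply pow_incr. split. apply Cmod_ge_0.
        now apply RtoC_unit_Cmod.
      * apply pseries_tail; auto. now apply RtoC_unit_Cmod.
  - now apply tail_bound_lim.
Qed.

Lemma Cmod_RtoC_sq t : 0 <= t -> Cmod (RtoC t) ^ 2 = t ^ 2.
Proof. intros H. now rewrite Cmod_R, Rabs_pos_eq. Qed.

Lemma one_minus_sq_bounds x : 0 < x < 1 -> 0 < 1 - x <= 1 - x ^ 2.
Proof. intros H. simpl. nra. Qed.

Lemma continuous_of_ex_derive (h : R -> R) x : ex_derive h x -> continuous h x.
Proof. apply (ex_derive_continuous (K := R_AbsRing) (V := R_NormedModule)). Qed.

(** 1 / (1 - alpha) is the integral of (1 - s)^(-alpha). Uniformity in [rho] and [n] is the point: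
    it supplies the dominating series for rho -> 1. *)
Lemma dilated_moment_bound a f M alpha rho n : expansion a f -> 0 <= rho < 1 ->
  0 < alpha < 1 -> growth f M alpha -> Cmod (dilated_moment a rho n) <= M * / (1 - alpha).
Proof.
  intros Hf Hr Ha HM. assert (PM := growth_nonneg _ _ _ HM).
  apply (CInt01_bound _ (fun s => M * Rpower (1 - s) (- alpha))
    _ _ (fun x Hx => dilated_moment_Ccont a f rho n x Hf Hr Hx)
     (dilated_moment_integral a f rho n Hf Hr)).
  - intros x Hx. rewrite Cmod_mult, <- (Rmult_1_l (M * _)).
    apply Rmult_le_compat; try apply Cmod_ge_0.
    + rewrite Cmod_pow, <- (pow1 n). apply pow_incr. split. apply Cmod_ge_0.
      apply RtoC_unit_Cmod; lra.
    + apply Rle_trans with (1 := growth_scale f M alpha rho (RtoC x) ltac:(lra)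
        HM Hr ltac:(unfold in_disk; rewrite Cmod_R, Rabs_pos_eq; lra)).
      apply Rmult_le_compat_l; auto. rewrite Cmod_RtoC_sq by lra.
      assert (Q := one_minus_sq_bounds x Hx). apply Rpower_neg_le; lra.
  - intros x Hx. apply continuous_of_ex_derive. unfold Rpower. auto_derive. lra.
  - intros u v H1 H2 H3.
    rewrite (RInt_scal (V := R_CompleteNormedModule) (fun s => Rpower (1 - s) (- alpha))).
    2: { apply ex_RInt_cont; auto. intros x Hx. apply continuous_of_ex_derive. unfold Rpower.
    auto_derive. lra. }
    apply (Rmult_le_compat_l M); auto. apply Rpower_1m_integral; lra.
Qed.

Lemma moment_limit a b n : Cseries (fun k => Cdiv (a k) (RtoC (INR (n + k + 1)))) b ->
  Clim (at_left 1) (fun rho => dilated_moment a rho n) b.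
Proof. apply abel. Qed.

(** The derivative at z of the image of the dilation f(rho z), by [dilated_deriv_series]. *)
Definition hilbert_deriv_integral (f : C -> C) (rho : R) (z : C) : C :=
  CInt (fun s => phi z s * f (RtoC rho * phi z s) / (1 - z))%C 0 1.

Lemma hilbert_deriv_Ccont a f rho z s : expansion a f ->
  0 <= rho < 1 -> in_disk z -> 0 <= s <= 1 ->
  Ccont (fun s => phi z s * f (RtoC rho * phi z s) / (1 - z))%C s.
Proof.
  intros Hf Hr Hz Hs. apply (Clim_div (locally s)). now apply one_minus_nz.
  2: apply (Clim_const (locally s)).
  apply (Clim_mult (locally s)). now apply phi_Ccont.
  apply (Ccont_comp f (fun s => RtoC rho * phi z s)%C). apply (pseries_continuous a); auto.
  apply disk_scale; auto. now apply phi_Cmod_le_1.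
  apply (Clim_mult (locally s)). apply (Clim_const (locally s)). now apply phi_Ccont.
Qed.

Lemma hilbert_deriv_is_CInt a f rho z : expansion a f ->
  0 <= rho < 1 -> in_disk z ->
  is_CInt (fun s => phi z s * f (RtoC rho * phi z s)
    / (1 - z))%C 0 1 (hilbert_deriv_integral f rho z).
Proof.
  intros Hf Hr Hz. apply CInt_correct. lra. intros s Hs. now apply (hilbert_deriv_Ccont a).
Qed.

Lemma ex_series_INR_pow z B : in_disk z -> ex_series (fun n => B * (INR (n + 1) * Cmod z ^ n)).
Proof.
  intros Hz. apply (ex_series_Rmult B). generalize (conv_disk_INR (Cmod z) (conj (Cmod_ge_0 z) Hz)).
  apply ex_series_ext. intros n. rewrite Cmod_R, Rabs_pos_eq; auto. apply pos_INR.
Qed.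

(** The images of the Taylor polynomials of the dilation have derivatives [v K] with two limits: the
    series, by domination in n, and the integral along [phi z], by uniform convergence of the
    polynomials on the path. *)
Lemma dilated_deriv_series a f rho z : expansion a f ->
  0 <= rho < 1 -> in_disk z ->
  Cseries (fun n => RtoC (INR (n + 1)) * dilated_moment a rho (S n)
    * z ^ n)%C (hilbert_deriv_integral f rho z).
Proof.
  intros Hf Hr Hz. assert (H := expansion_conv_disk a f Hf). assert (Nz := one_minus_nz z Hz).
  pose (A := Series (fun n => Cmod (a n) * rho ^ n)).
  (* [u K n] is the n-th term of the derivative of the image of the K-th Taylor polynomial, and
     [v K] is the same derivative summed over monomials; exchanging them is harmless since K is
     finite. *)
  pose (u := fun K n => (RtoC (INR (n + 1)) * Csum (fun k => a k * RtoC rho ^ k / RtoC (INR (S n +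
    k + 1))) K * z ^ n)%C).
  pose (v := fun K => Csum (fun k => a k * RtoC rho ^ k * PSum (monomial_coef k) z)%C K).
  assert (Uv : forall K, Cseries (u K) (v K)).
  { assert (E0 : forall k, Cseries (fun n => RtoC (INR (n + 1))
      * (a k * RtoC rho ^ k / RtoC (INR (S n + k + 1))) * z ^ n)%C
       (a k * RtoC rho ^ k * PSum (monomial_coef k) z)%C).
    { intros k. generalize (Cseries_scal (a k * RtoC rho ^ k)%C _ _ (PSum_correct _ z
        (conv_disk_monomial k) Hz)).
      apply Cseries_ext. intros n. unfold monomial_coef.
      replace (S n + k + 1)%nat with (n + k + 2)%nat by lia.
      rewrite RtoC_div by (apply not_0_INR; lia). unfold Cdiv. ring. }
    intros K. unfold v. induction K.
    - rewrite Csum_0. generalize (E0 0%nat). apply Cseries_ext. intros n. unfold u.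
      now rewrite Csum_0.
    - rewrite Csum_S. generalize (Cseries_plus _ _ _ _ IHK (E0 (S K))). apply Cseries_ext.
      intros n. unfold u. rewrite Csum_S. ring. }
  assert (Ub : forall K n, Cmod (u K n) <= A * (INR (n + 1) * Cmod z ^ n)).
  { intros K n. unfold u. rewrite !Cmod_mult, Cmod_pow, Cmod_R, Rabs_pos_eq by apply pos_INR.
    rewrite (Rmult_comm (INR (n + 1))), Rmult_assoc. apply Rmult_le_compat_r.
    apply Rmult_le_pos. apply pos_INR. apply pow_le, Cmod_ge_0.
    apply Rle_trans with (@sum_n R_AbelianMonoid (fun n => Cmod (a n) * rho ^ n) K).
    - apply Csum_Cmod. intros k. unfold Cdiv.
      assert (P : 1 <= INR (S n + k + 1)) by (rewrite plus_INR; generalize (pos_INR (S n + k));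
        simpl (INR 1); lra).
      rewrite <- RtoC_inv, !Cmod_mult, Cmod_pow, !Cmod_R, (Rabs_pos_eq rho) by lra.
      rewrite Rabs_pos_eq by (apply Rlt_le, Rinv_0_lt_compat; lra).
      rewrite <- (Rmult_1_r (Cmod (a k) * rho ^ k)) at 2. apply Rmult_le_compat_l.
      apply Rmult_le_pos. apply Cmod_ge_0. apply pow_le; lra. rewrite <- Rinv_1.
      apply Rinv_le_contravar; lra.
    - apply sum_n_le_Series. intros k. apply Rmult_le_pos. apply Cmod_ge_0. apply pow_le; lra.
      now apply H. }
  assert (Ul : forall n, Clim eventually (fun K => u K n) (RtoC (INR (n + 1))
    * dilated_moment a rho (S n) * z ^ n)%C).
  { intros n. apply (Clim_mult eventually); [|apply (Clim_const eventually)].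
    apply (Clim_mult eventually). apply (Clim_const eventually). now apply dilated_moment_series. }
  assert (Lim : exists s, Cseries (fun n => RtoC (INR (n + 1)) * dilated_moment a rho (S n)
    * z ^ n)%C s).
  { apply (ex_Cseries _ (fun n => A * (INR (n + 1) * Cmod z ^ n))); [|now apply ex_series_INR_pow].
    intros n. apply (Clim_Cmod_le eventually _ _ _ (Ul n)). apply filter_forall. intros K.
    apply Ub. }
  destruct Lim as [s Hs].
  assert (L1 : Clim eventually v s).
  { apply (Cseries_dominated eventually u v _ s (fun n => A * (INR (n + 1) * Cmod z ^ n)))
      with (4 := Hs); auto.
    - apply filter_forall. intros K. split; auto.
    - now apply ex_series_INR_pow. }
  assert (L2 : Clim eventually v (hilbert_deriv_integral f rho z)).
  { apply (CInt_lim eventually (fun K s => Csum (fun k => a k * RtoC rho ^ k * (phi z s ^ S k / (1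
      - z))) K)%C
     (fun s => phi z s * f (RtoC rho * phi z s) / (1 - z))%C 0 1 _ _ (fun K => / Cmod (1 - z)
       * tail_bound a rho K)).
    - lra.
    - apply filter_forall. intros K. split.
      + apply (Csum_CInt (fun k s => a k * RtoC rho ^ k * (phi z s ^ S k / (1 - z)))%C). 2: lra.
        intros k. apply is_CInt_scal. now apply monomial_integral.
      + intros t Ht. 
        replace (Csum (fun k => a k * RtoC rho ^ k * (phi z t ^ S k / (1 - z))) K)%C
          with (phi z t / (1 - z) * Csum (fun k => a k * RtoC rho ^ k * phi z t ^ k) K)%C.
        2: { rewrite <- Csum_scal. apply Csum_ext. intros k. simpl. field. auto. }
        replace (phi z t / (1 - z) * Csum (fun k => a k * RtoC rho ^ k * phi z t ^ k)
          K - phi z t * f (RtoC rho * phi z t) / (1 - z))%C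
          with (/ (1 - z) * (phi z t * (Csum (fun k => a k * RtoC rho ^ k * phi z t ^ k)
            K - f (RtoC rho * phi z t))))%C by (field; auto).
        rewrite !Cmod_mult, Cmod_inv by auto. apply Rmult_le_compat_l.
        apply Rlt_le, Rinv_0_lt_compat. now apply Cmod_gt_0.
        apply Rle_trans with (1 * tail_bound a rho K); [|lra].
        apply Rmult_le_compat; try apply Cmod_ge_0. now apply phi_Cmod_le_1.
        apply pseries_tail; auto. now apply phi_Cmod_le_1.
    - apply (Rlim0_scal eventually). now apply tail_bound_lim.
    - now apply (hilbert_deriv_is_CInt a). }
  now rewrite (Clim_unique eventually _ _ _ L2 L1).
Qed.

Definition hilbert_coefs (f : C -> C) (a b : nat -> C) : Prop :=
  expansion a f /\ conv_disk b /\
  forall n, Cseries (fun k => Cdiv (a k) (RtoC (INR (n + k + 1)))) (b n).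

(** Each coefficient converges by Abel's theorem, and [dilated_moment_bound] dominates them all, so
    Tannery's theorem applies. *)
Lemma hilbert_deriv_limit a b f M alpha z : hilbert_coefs f a b -> 0 < alpha < 1 ->
  growth f M alpha -> in_disk z ->
  Clim (at_left 1) (fun rho => hilbert_deriv_integral f rho z) (PSum (Cderiv b) z).
Proof.
  intros [Hf [Hb Hm]] Hal HM Hz.
  apply (Cseries_dominated (at_left 1) (fun rho n => RtoC (INR (n + 1))
    * dilated_moment a rho (S n) * z ^ n)%C _
    (fun n => Cderiv b n * z ^ n)%C _ (fun n => M * / (1 - alpha) * (INR (n + 1) * Cmod z ^ n))).
  - generalize at_left_1_unit. apply filter_imp. intros rho Hr. split.
    + apply (dilated_deriv_series a); auto. lra.
    + intros n. rewrite !Cmod_mult, Cmod_pow, Cmod_R, Rabs_pos_eq by apply pos_INR.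
      rewrite (Rmult_comm (INR (n + 1))), Rmult_assoc. apply Rmult_le_compat_r.
      apply Rmult_le_pos. apply pos_INR. apply pow_le, Cmod_ge_0.
      apply (dilated_moment_bound a f); auto. lra.
  - now apply ex_series_INR_pow.
  - intros n. unfold Cderiv. apply (Clim_mult (at_left 1)); [|apply (Clim_const (at_left 1))].
    apply (Clim_mult (at_left 1)). apply (Clim_const (at_left 1)). apply moment_limit, Hm.
  - apply PSum_correct; auto. now apply conv_disk_Cderiv.
Qed.

(** * The upper bound *)

Lemma ln_AGM x y : 0 < x -> 0 < y -> ln 2 + (ln x + ln y) / 2 <= ln (x + y).
Proof.
  intros Hx Hy. assert (P := Rmult_lt_0_compat x y Hx Hy).
  assert (H : ln (2 * 2 * (x * y)) <= ln ((x + y) * (x + y))).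
  { apply ln_le. lra. generalize (pow2_ge_0 (x - y)). lra. }
  rewrite (ln_mult (2 * 2)), (ln_mult 2 2), (ln_mult x y), (ln_mult (x + y)) in H by lra. lra.
Qed.

(* The substitution 1 - x^2 = (1-s)(1-r)(p+s)/p^2 for x = s/p, p = 1 - (1-s) r. *)
Lemma real_kernel_eq alpha r s : 0 <= r < 1 -> 0 < s < 1 ->
  let p := 1 - (1 - s) * r in
  Rpower (1 - r ^ 2) (alpha + 1) / (1 - r) * ((s / p) * Rpower (1 - (s / p) ^ 2) (- alpha)) =
  exp ((alpha + 1) * ln (1 + r) + ln s - alpha * ln (1 - s) + (2 * alpha - 1)
    * ln p - alpha * ln (p + s)).
Proof.
  intros Hr Hs p. assert (Hp : 0 < p) by (unfold p; nra).
  replace (1 - r ^ 2) with ((1 - r) * (1 + r)) by ring.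
  replace (1 - (s / p) ^ 2) with ((1 - s) * (1 - r) * (p + s) * / p * / p) by (unfold p in *;
    field; lra).
  assert (Ip : 0 < / p) by now apply Rinv_0_lt_compat.
  assert (Q1 : 0 < (1 - s) * (1 - r)) by (apply Rmult_lt_0_compat; lra).
  assert (Q2 : 0 < (1 - s) * (1 - r) * (p + s)) by (apply Rmult_lt_0_compat; lra).
  assert (Q3 : 0 < (1 - s) * (1 - r) * (p + s) * / p) by (apply Rmult_lt_0_compat; lra).
  unfold Rpower. rewrite !ln_mult by lra. rewrite !ln_Rinv by lra. unfold Rdiv.
  replace (/ (1 - r)) with (exp (- ln (1 - r))) by (rewrite exp_Ropp, exp_ln; lra).
  replace (s * / p) with (exp (ln s + - ln p)) by (rewrite exp_plus, exp_Ropp, !exp_ln; lra).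
  rewrite <- !exp_plus. f_equal. ring.
Qed.

Definition beta_kernel (p alpha s : R) : R := Rpower s p * Rpower (1 - s) (- alpha).

Lemma kernel_bound alpha z s k : 0 < alpha -> in_disk z -> 0 < s < 1 ->
  (alpha <= 2 / 3 /\ k = beta_kernel alpha alpha s \/ 1 / 2 <= alpha /\ k = beta_kernel (1 - alpha)
    alpha s) ->
  Rpower (1 - Cmod z ^ 2) (alpha + 1) / Cmod (1 - z) *
    (Cmod (phi z s) * Rpower (1 - Cmod (phi z s) ^ 2) (- alpha)) <= 2 * k.
Proof.
  intros Ha Hz Hs Hk. unfold in_disk in Hz. set (r := Cmod z) in *.
  assert (Pr : 0 <= r) by apply Cmod_ge_0.
  set (p := 1 - (1 - s) * r).
  assert (Hp : s < p <= 1) by (unfold p; nra).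
  assert (Nz := one_minus_nz z Hz).
  assert (D1 : 1 - r <= Cmod (1 - z)).
  { generalize (Cmod_triangle_inv 1 z). rewrite Cmod_1. fold r. generalize (Rle_abs (1 - r)). lra. }
  assert (Hphi := phi_Cmod_le z s Hz ltac:(lra)). fold r p in Hphi.
  assert (Hx : s / p < 1). { apply Rmult_lt_reg_r with p. lra. unfold Rdiv.
  rewrite Rmult_assoc, Rinv_l; lra. }
  assert (Px : 0 < s / p) by (apply Rdiv_lt_0_compat; lra).
  assert (P0 := Cmod_ge_0 (phi z s)).
  (* Reduction to z = r on the positive axis: |1 - z| >= 1 - r and |phi_z(s)| <= s / p only increase
     the factors. *)
  apply Rle_trans with (Rpower (1 - r ^ 2) (alpha + 1) / (1 - r) * ((s / p) * Rpower (1 - (s / p)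
    ^ 2) (- alpha))).
  { apply Rmult_le_compat.
    - apply Rlt_le, Rdiv_lt_0_compat. apply Rpower_pos. lra.
    - apply Rmult_le_pos; auto. apply Rlt_le, Rpower_pos.
    - apply Rmult_le_compat_l. apply Rlt_le, Rpower_pos. apply Rinv_le_contravar; lra.
    - apply Rmult_le_compat; auto. apply Rlt_le, Rpower_pos.
      apply Rpower_neg_le. nra. nra. lra. }
  unfold p. rewrite real_kernel_eq by lra. fold p.
  assert (L2 : ln (1 + r) <= ln 2) by (apply ln_le; lra).
  assert (Lp0 : ln p <= 0) by (rewrite <- ln_1; apply ln_le; lra).
  assert (E2 : forall y, 2 * exp y = exp (ln 2 + y)) by (intros y; rewrite exp_plus, exp_ln; lra).
  destruct Hk as [[Ha2 ->]|[Ha2 ->]]; unfold beta_kernel, Rpower; rewrite <- exp_plus, E2;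
    apply exp_le_compat.
  - (* p + s >= 2 sqrt (p s) leaves the factor (s / p)^(1 - 3 alpha / 2), which is at most 1
       because alpha <= 2/3. *)
    assert (Lsp : ln s <= ln p) by (apply ln_le; lra).
    assert (A := ln_AGM p s ltac:(lra) ltac:(lra)).
    apply (Rmult_le_compat_l alpha) in A; [|lra].
    apply (Rmult_le_compat_l (alpha + 1)) in L2; [|lra].
    assert (0 <= (1 - 3 * alpha / 2) * (ln p - ln s)) by (apply Rmult_le_pos; lra). lra.
  (* Here p + s - s (1 + r) = 1 - r >= 0, and p^(2 alpha - 1) <= 1 because alpha >= 1/2. *)
  - assert (A : ln s + ln (1 + r) <= ln (p + s)).
    { rewrite <- ln_mult by lra. apply ln_le. apply Rmult_lt_0_compat; lra. unfold p. lra. }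
    apply (Rmult_le_compat_l alpha) in A; [|lra].
    assert (0 <= (2 * alpha - 1) * - ln p) by (apply Rmult_le_pos; lra). lra.
Qed.

Lemma beta_kernel_continuous p alpha s : 0 < s < 1 -> continuous (beta_kernel p alpha) s.
Proof. intros H. apply continuous_of_ex_derive. unfold beta_kernel, Rpower. auto_derive. lra. Qed.

Lemma Rpower_1m_continuous alpha s : 0 < s < 1 -> continuous (fun s => Rpower (1 - s) (- alpha)) s.
Proof. intros H. apply continuous_of_ex_derive. unfold Rpower. auto_derive. lra. Qed.

Lemma Rpower_le_1 s a : 0 < s <= 1 -> 0 <= a -> Rpower s a <= 1.
Proof.
  intros Hs Ha. unfold Rpower. apply Rle_trans with (exp 0); [|rewrite exp_0; lra].
  apply exp_le_compat.
  assert (ln s <= ln 1) by (apply ln_le; lra). rewrite ln_1 in H. nra.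
Qed.

Lemma beta_kernel_integral_le p alpha a b : 0 <= p -> 0 < alpha < 1 -> 0 < a -> a <= b -> b < 1 ->
  RInt (beta_kernel p alpha) a b <= / (1 - alpha).
Proof.
  intros Hp Ha H1 H2 H3. apply (RInt_dominated _ (fun s => Rpower (1 - s) (- alpha))); auto.
  apply beta_kernel_continuous. apply Rpower_1m_continuous.
  - intros x Hx. unfold beta_kernel. rewrite <- (Rmult_1_l (Rpower (1 - x) (- alpha))) at 2.
    apply Rmult_le_compat_r. apply Rlt_le, Rpower_pos. apply Rpower_le_1; lra.
  - apply Rpower_1m_integral; lra.
Qed.

Lemma extremal_continuous alpha t : 0 < t < 1 ->
  continuous (fun t => 1 / Rpower (1 - t ^ 2) alpha) t.
Proof.
  intros H. apply continuous_of_ex_derive. assert (0 < 1 - t ^ 2) by nra.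
  unfold Rpower. auto_derive. repeat split; try lra. apply Rgt_not_eq, exp_pos.
Qed.

Lemma extremal_integral_le alpha a b : 0 < alpha < 1 -> 0 < a -> a <= b -> b < 1 ->
  RInt (fun t => 1 / Rpower (1 - t ^ 2) alpha) a b <= / (1 - alpha).
Proof.
  intros Ha H1 H2 H3. apply (RInt_dominated _ (fun s => Rpower (1 - s) (- alpha))); auto.
  apply extremal_continuous. apply Rpower_1m_continuous.
  - intros x Hx. unfold Rdiv. rewrite Rmult_1_l, <- Rpower_Ropp.
    assert (Q := one_minus_sq_bounds x Hx). apply Rpower_neg_le; lra.
  - apply Rpower_1m_integral; lra.
Qed.

(** The weight at the fixed point z is divided out, so that the bound holds for every dilation and
    passes to rho -> 1. The majorant [k] is left abstract to serve both ranges of alpha. *)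
Lemma hilbert_deriv_bound a b f M alpha z k C0 : hilbert_coefs f a b -> 0 < alpha < 1 ->
  growth f M alpha -> in_disk z ->
  (forall s, 0 < s < 1 -> Rpower (1 - Cmod z ^ 2) (alpha + 1) / Cmod (1 - z) *
    (Cmod (phi z s) * Rpower (1 - Cmod (phi z s) ^ 2) (- alpha)) <= 2 * k s) ->
  (forall s, 0 < s < 1 -> continuous k s) ->
  (forall u v, 0 < u -> u <= v -> v < 1 -> RInt k u v <= C0) ->
  Rpower (1 - Cmod z ^ 2) (alpha + 1) * Cmod (PSum (Cderiv b) z) <= M * (2 * C0).
Proof.
  intros Hab Hal HM Hz Hk Ck Ik. assert (Hf := proj1 Hab). assert (PM := growth_nonneg _ _ _ HM).
  assert (Nz := one_minus_nz z Hz). assert (P1 : 0 < Cmod (1 - z)) by now apply Cmod_gt_0.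
  set (c := Rpower (1 - Cmod z ^ 2) (alpha + 1)) in *. assert (Pc : 0 < c) by apply Rpower_pos.
  assert (B : Cmod (PSum (Cderiv b) z) <= / c * (M * 2) * C0).
  { apply (Clim_Cmod_le (at_left 1) _ _ _ (hilbert_deriv_limit a b f M alpha z Hab Hal HM Hz)).
    generalize at_left_1_unit. apply filter_imp. intros rho Hr.
    apply (CInt01_bound _ (fun s => (/ c * (M * 2)) * k s)
      _ _ (fun s Hs => hilbert_deriv_Ccont a f rho z s Hf ltac:(lra) Hz Hs)
      (hilbert_deriv_is_CInt a f rho z Hf ltac:(lra) Hz)).
    - intros s Hs. rewrite Cmod_div, Cmod_mult by auto.
      assert (Hphi := phi_Cmod_le z s Hz ltac:(lra)).
      assert (Hd : in_disk (phi z s)).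
      { unfold in_disk in *. apply Rle_lt_trans with (1 := Hphi).
        assert (Q := Cmod_ge_0 z). assert (0 < 1 - (1 - s) * Cmod z) by nra.
        apply Rmult_lt_reg_r with (1 - (1 - s) * Cmod z); auto.
        unfold Rdiv. rewrite Rmult_assoc, Rinv_l; nra. }
      assert (G := growth_scale f M alpha rho (phi z s) ltac:(lra) HM ltac:(lra) Hd).
      assert (H1 : Cmod (phi z s) * Cmod (f (RtoC rho * phi z s)%C) <= M * (Cmod (phi z s)
        * Rpower (1 - Cmod (phi z s) ^ 2) (- alpha))).
      { apply Rle_trans with (Cmod (phi z s) * (M * Rpower (1 - Cmod (phi z s) ^ 2) (- alpha))).
        apply Rmult_le_compat_l; auto. apply Cmod_ge_0. lra. }
      apply (Rmult_le_compat_r (/ Cmod (1 - z))) in H1. 2: apply Rlt_le, Rinv_0_lt_compat; auto.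
      apply Rle_trans with (1 := H1). specialize (Hk s Hs).
      apply (Rmult_le_compat_l (M * / c)) in Hk. 2: { apply Rmult_le_pos; auto.
      apply Rlt_le, Rinv_0_lt_compat; auto. }
      replace (M * / c * (2 * k s)) with (/ c * (M * 2) * k s) in Hk by ring.
      apply Rle_trans with (2 := Hk). apply Req_le. field. lra.
    - intros s Hs. apply (continuous_scal_r (K := R_AbsRing) (V := R_NormedModule) (/ c * (M * 2))
        k). auto.
    - intros u v H1 H2 H3.
      rewrite (RInt_scal (V := R_CompleteNormedModule) k). 2: now apply ex_RInt_cont.
      apply (Rmult_le_compat_l (/ c * (M * 2))); auto. apply Rmult_le_pos.
      apply Rlt_le, Rinv_0_lt_compat; auto. lra. }
  apply Rle_trans with (c * (/ c * (M * 2) * C0)).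
  apply Rmult_le_compat_l; lra. apply Req_le. field. lra.
Qed.

Lemma hilbert_value_bound a b f M alpha : hilbert_coefs f a b -> 0 < alpha < 1 ->
  growth f M alpha ->
  Cmod (b 0%nat) <= M * integral01 (fun t => 1 / Rpower (1 - t ^ 2) alpha).
Proof.
  intros [Hf [_ Hm]] Hal HM. assert (PM := growth_nonneg _ _ _ HM).
  destruct (integral01_spec (fun t => 1 / Rpower (1 - t ^ 2) alpha) (/ (1 - alpha))) as [I1 _].
  - intros x _. unfold Rdiv. rewrite Rmult_1_l, <- Rpower_Ropp. apply Rlt_le, Rpower_pos.
  - intros x Hx. now apply extremal_continuous.
  - intros u v H1 H2 H3. now apply extremal_integral_le.
  - apply (Clim_Cmod_le (at_left 1) _ _ _ (moment_limit a (b 0%nat) 0 (Hm 0%nat))).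
    generalize at_left_1_unit. apply filter_imp. intros rho Hr.
    apply (CInt01_bound _ (fun s => M * (1 / Rpower (1 - s ^ 2) alpha)) _ _
     (fun x Hx => dilated_moment_Ccont a f rho 0 x Hf ltac:(lra) Hx)
     (dilated_moment_integral a f rho 0 Hf ltac:(lra))).
    + intros x Hx. simpl. rewrite Cmult_1_l.
      apply Rle_trans with (1 := growth_scale f M alpha rho (RtoC x) ltac:(lra) HM ltac:(lra)
        ltac:(unfold in_disk; rewrite Cmod_R, Rabs_pos_eq; lra)).
      rewrite Cmod_RtoC_sq, Rpower_Ropp by lra. apply Req_le. unfold Rdiv. simpl. ring.
    + intros x Hx. apply (continuous_scal_r (K := R_AbsRing) (V := R_NormedModule)
        M (fun t => 1 / Rpower (1 - t ^ 2) alpha)).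
      now apply extremal_continuous.
    + intros u v H1 H2 H3.
      rewrite (RInt_scal (V := R_CompleteNormedModule) (fun t => 1 / Rpower (1 - t ^ 2) alpha)).
      2: { apply ex_RInt_cont; auto. intros; now apply extremal_continuous. }
      apply (Rmult_le_compat_l M); auto.
Qed.

(** * The lower bound *)

(** The coefficients of (1 - x)^(-alpha), positive and at most 1 when alpha < 1. *)
Fixpoint binomial_coef (alpha : R) (k : nat) : R :=
  match k with O => 1 | S k => binomial_coef alpha k * ((alpha + INR k) / (INR k + 1)) end.

Lemma binomial_coef_bounds alpha k : 0 < alpha < 1 -> 0 < binomial_coef alpha k <= 1.
Proof.
  intros Ha. induction k; simpl. lra.
  generalize (pos_INR k). intros Pk.
  assert (0 < (alpha + INR k) / (INR k + 1)) by (apply Rdiv_lt_0_compat; lra).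
  assert ((alpha + INR k) / (INR k + 1) <= 1).
  { apply Rmult_le_reg_r with (INR k + 1). lra. unfold Rdiv. rewrite Rmult_assoc, Rinv_l; lra. }
  split. apply Rmult_lt_0_compat; lra. nra.
Qed.

Lemma binomial_conv_disk alpha : 0 < alpha < 1 -> conv_disk (fun k => RtoC (binomial_coef alpha k)).
Proof.
  intros Ha. apply (conv_disk_bounded _ 1). intros n. rewrite Cmod_R.
  generalize (binomial_coef_bounds alpha n Ha). intros. rewrite Rabs_pos_eq; lra.
Qed.

Lemma binomial_radius alpha : 0 < alpha < 1 -> Rbar_le 1 (CV_radius (binomial_coef alpha)).
Proof.
  intros Ha. apply conv_radius_ge_1. intros r Hr. generalize (binomial_conv_disk alpha Ha r Hr).
  apply ex_series_ext. intros n. rewrite Cmod_R, Rabs_pos_eq; auto.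
  generalize (binomial_coef_bounds alpha n Ha). lra.
Qed.

(* The sum y of the binomial series solves (1 - x) y' = alpha y. *)
Lemma binomial_series alpha x : 0 < alpha < 1 -> 0 <= x < 1 ->
  PSeries (binomial_coef alpha) x = Rpower (1 - x) (- alpha).
Proof.
  intros Ha Hx. set (c := binomial_coef alpha).
  assert (CR : forall t, 0 <= t < 1 -> Rbar_lt (Rabs t) (CV_radius c)).
  { intros t Ht. apply Rbar_lt_le_trans with 1. simpl. rewrite Rabs_pos_eq; lra.
    now apply binomial_radius. }
  assert (ODE : forall t, 0 <= t < 1 -> (1 - t) * PSeries (PS_derive c) t = alpha * PSeries c t).
  { intros t Ht. assert (E := ex_pseries_derive c t (CR t Ht)).
    rewrite Rmult_minus_distr_r, Rmult_1_l, <- PSeries_incr_1, <- PSeries_minus; auto.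
    2: now apply ex_pseries_incr_1.
    rewrite <- PSeries_scal. apply PSeries_ext. intros n.
    assert (Rec : forall k, INR (S k) * c (S k) = (alpha + INR k) * c k).
    { intros k. unfold c. simpl binomial_coef. rewrite S_INR. field. generalize (pos_INR k); lra. }
    destruct n as [|n].
    - change (INR 1 * c 1%nat + - 0 = alpha * c 0%nat). rewrite Rec. simpl. ring.
    - change (INR (S (S n)) * c (S (S n)) + - (INR (S n) * c (S n)) = alpha * c (S n)).
      rewrite Rec. ring. }
  destruct (Req_dec x 0) as [->|Nx].
  { rewrite PSeries_0, Rminus_0_r. unfold Rpower. rewrite ln_1, Rmult_0_r, exp_0. reflexivity. }
  assert (H : PSeries c 0 * Rpower (1 - 0) alpha = PSeries c x * Rpower (1 - x) alpha).
  { apply (eq_is_derive (fun t => PSeries c t * Rpower (1 - t) alpha) 0 x). 2: lra.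
    intros t Ht. 
    change (@zero (NormedModule.AbelianMonoid R_AbsRing R_NormedModule)) with 0.
    replace 0 with (PSeries (PS_derive c) t * Rpower (1 - t)
      alpha + PSeries c t * (- alpha * Rpower (1 - t) (alpha - 1))).
    - apply (is_derive_mult (PSeries c) (fun t => Rpower (1 - t) alpha) t).
      apply is_derive_PSeries. apply CR; lra. apply is_derive_Rpower_1m; lra.
      intros; apply Rmult_comm.
    - replace (Rpower (1 - t) alpha) with (Rpower (1 - t) (alpha - 1) * (1 - t)).
      + transitivity (Rpower (1 - t) (alpha - 1) * ((1 - t) * PSeries (PS_derive c)
          t - alpha * PSeries c t)). ring.
        rewrite ODE by lra. ring.
      + rewrite <- (Rpower_1 (1 - t)) at 2 by lra. rewrite <- Rpower_plus. f_equal. ring. }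
  rewrite PSeries_0, Rminus_0_r in H. replace (c 0%nat) with 1 in H by reflexivity.
  replace (Rpower 1 alpha) with 1 in H by (unfold Rpower; rewrite ln_1, Rmult_0_r, exp_0; auto).
  rewrite Rpower_Ropp. assert (P := Rpower_pos (1 - x) alpha).
  apply Rmult_eq_reg_r with (Rpower (1 - x) alpha); [|lra]. rewrite Rinv_l, <- H; lra.
Qed.

(* (1 - z^2)^(-alpha) *)
Definition extremal (alpha : R) (z : C) : C := PSum (fun k => RtoC (binomial_coef alpha k)) (z * z).

Lemma sq_in_disk z : in_disk z -> in_disk (z * z).
Proof. unfold in_disk. intros H. rewrite Cmod_mult. generalize (Cmod_ge_0 z). intros; nra. Qed.

Lemma extremal_analytic alpha : 0 < alpha < 1 -> analytic_on_disk (extremal alpha).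
Proof.
  intros Ha z Hz. eexists. apply Cdiff_is_derive.
  apply (Cdiff_comp _ (fun z => z * z)%C). apply PSum_Cdiff. now apply binomial_conv_disk.
  now apply sq_in_disk.
  apply Cdiff_mult; apply Cdiff_id.
Qed.

(** Nonnegative coefficients bound the modulus at z by the value at |z|, which is (1 -
    |z|^2)^(-alpha). *)
Lemma extremal_growth alpha : 0 < alpha < 1 -> growth (extremal alpha) 1 alpha.
Proof.
  intros Ha z Hz. unfold extremal. rewrite Rmult_1_l.
  assert (Pz := Cmod_ge_0 z). assert (Z1 : Cmod z ^ 2 < 1) by (unfold in_disk in Hz; nra).
  rewrite <- binomial_series by (auto; split; auto; apply pow2_ge_0).
  apply (Cseries_le _ _ _ (PSum_correct _ _ (binomial_conv_disk alpha Ha) (sq_in_disk z Hz))).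
  - intros n. rewrite Cmod_mult, Cmod_pow, Cmod_mult, Cmod_R, Rabs_pos_eq.
    simpl. rewrite Rmult_1_r. lra. generalize (binomial_coef_bounds alpha n Ha). lra.
  - apply ex_pseries_R. apply CV_radius_inside. apply Rbar_lt_le_trans with 1. simpl.
    rewrite Rabs_pos_eq. exact Z1. apply pow2_ge_0. now apply binomial_radius.
Qed.

Lemma extremal_real alpha x : 0 < alpha < 1 -> 0 <= x < 1 ->
  extremal alpha (RtoC x) = RtoC (Rpower (1 - x ^ 2) (- alpha)).
Proof.
  intros Ha Hx. unfold extremal. rewrite <- RtoC_mult, PSum_real.
  rewrite <- (binomial_series alpha (x ^ 2)) by (auto; nra).
  unfold RtoC at 3. f_equal.
  - replace (x ^ 2) with (x * x) by ring. apply PSeries_ext. intros n. reflexivity.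
  - rewrite <- (PSeries_const_0 (x * x)). apply PSeries_ext. intros n. reflexivity.
Qed.

(** Positivity of the real part lets the two ends be discarded, so a minorant on a compact
    subinterval suffices. *)
Lemma Re_CInt_lower F l (k : R -> R) u v : is_CInt F 0 1 l -> (forall x, 0 <= x <= 1 ->
  Ccont F x) ->
  0 < u -> u <= v -> v < 1 -> (forall x, 0 <= x <= 1 -> 0 <= Re (F x)) ->
  (forall x, u <= x <= v -> k x <= Re (F x)) -> (forall x, 0 < x < 1 -> continuous k x) ->
    RInt k u v <= Re l.
Proof.
  intros Hl HF H1 H2 H3 Pos Hk Ck.
  rewrite <- (is_RInt_unique _ _ _ _ (is_CInt_Re _ _ _ _ Hl)).
  assert (E : forall x y, 0 <= x -> x <= y -> y <= 1 -> ex_RInt (fun t => Re (F t)) x y).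
  { intros x y p1 p2 p3. apply ex_RInt_segment; auto.
    intros t Ht. apply (Clim_Re (locally t)). apply HF. lra. }
  rewrite <- (RInt_Chasles _ 0 v 1) by (apply E; lra).
  rewrite <- (RInt_Chasles _ 0 u v) by (apply E; lra).
  unfold plus; simpl.
  assert (L1 : 0 <= RInt (fun t => Re (F t)) 0 u). { apply RInt_ge_0. lra. apply E; lra.
  intros; apply Pos; lra. }
  assert (L2 : 0 <= RInt (fun t => Re (F t)) v 1). { apply RInt_ge_0. lra. apply E; lra.
  intros; apply Pos; lra. }
  assert (L3 : RInt k u v <= RInt (fun t => Re (F t)) u v).
  { apply RInt_le; auto. now apply ex_RInt_cont. apply E; lra. intros x Hx. apply Hk. lra. }
  lra.
Qed.

(** 1 - rho^2 x^2 exceeds 1 - x^2 by at most 1 - rho^2, which is at most (1 - x^2) (1 - rho^2) / c.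
    The loss is a factor independent of x that tends to 1, and this replaces a uniform convergence
    argument. *)
Lemma dilation_loss alpha rho x c : 0 <= alpha -> 0 < rho < 1 -> 0 < c -> c <= 1 - x ^ 2 -> 
  Rpower (1 + (1 - rho ^ 2) / c) (- alpha) * Rpower (1 - x ^ 2) (- alpha) <= Rpower (1 - (rho * x)
    ^ 2) (- alpha).
Proof.
  intros Ha Hr Hc Hx. assert (R2 : 0 < 1 - rho ^ 2) by nra.
  assert (P0 : 0 < (1 - rho ^ 2) / c) by (apply Rdiv_lt_0_compat; lra).
  rewrite Rpower_mult_distr by lra. assert (X2 := pow2_ge_0 x).
  assert (0 < 1 - (rho * x) ^ 2) by (rewrite Rpow_mult_distr; nra).
  apply Rpower_neg_le; auto.
  assert ((1 - rho ^ 2) / c * c <= (1 - rho ^ 2) / c * (1 - x ^ 2)) by (apply Rmult_le_compat_l;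
    lra).
  replace ((1 - rho ^ 2) / c * c) with (1 - rho ^ 2) in H0 by (field; lra).
  rewrite Rpow_mult_distr. nra.
Qed.

Lemma dilation_lower_limit alpha c (l : R -> C) L I : 0 < c ->
  (forall rho, 0 < rho < 1 -> Rpower (1 + (1 - rho ^ 2) / c) (- alpha) * I <= Re (l rho)) ->
  Clim (at_left 1) l L -> I <= Re L.
Proof.
  intros Hc H HL. apply (Rlim_le (at_left 1) (fun rho => Rpower (1 + (1 - rho ^ 2) / c) (- alpha)
    * I) (fun rho => Re (l rho))).
  - generalize at_left_1_unit. apply filter_imp. exact H.
  - intros P HP.
    assert (Ct : continuous (fun rho => Rpower (1 + (1 - rho ^ 2) / c) (- alpha) * I) 1).
    { apply continuous_of_ex_derive. unfold Rpower. auto_derive. 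
      replace (1 + (1 + - 1 ^ 2) * / c) with 1 by (field; lra). repeat split; lra. }
    assert (E : Rpower (1 + (1 - 1 ^ 2) / c) (- alpha) * I = I).
    { replace (1 + (1 - 1 ^ 2) / c) with 1 by (field; lra). unfold Rpower.
      rewrite ln_1, Rmult_0_r, exp_0. ring. }
    unfold continuous in Ct. rewrite E in Ct. destruct (Ct P HP) as [d Hd]. exists d.
    intros y Hy _. now apply Hd.
  - now apply (Clim_Re (at_left 1)).
Qed.

Lemma extremal_value_lower alpha a b u v : 0 < alpha < 1 -> hilbert_coefs (extremal alpha) a b ->
  0 < u -> u <= v -> v < 1 ->
  RInt (fun t => 1 / Rpower (1 - t ^ 2) alpha) u v <= Cmod (b 0%nat).
Proof.
  intros Hal [Hf [_ Hm]] H1 H2 H3. apply Rle_trans with (Re (b 0%nat)).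
  2: apply Rle_trans with (2 := re_le_Cmod _); apply Rle_abs.
  apply (dilation_lower_limit alpha (1 - v ^ 2) (fun rho => dilated_moment a rho 0)). nra.
  2: now apply moment_limit.
  intros rho Hr.
  assert (Fx : forall x, 0 <= x <= 1 -> Re (RtoC x ^ 0 * extremal alpha (RtoC rho * RtoC x))
    = Rpower (1 - (rho * x) ^ 2) (- alpha)).
  { intros x Hx. rewrite <- RtoC_mult, extremal_real by (auto; nra). simpl. ring. }
  rewrite <- (RInt_scal (V := R_CompleteNormedModule) (fun t => 1 / Rpower (1 - t ^ 2) alpha) u v).
  2: { apply ex_RInt_cont; auto. intros; now apply extremal_continuous. }
  apply (Re_CInt_lower _ _ _ u v (dilated_moment_integral a _ rho 0 Hf ltac:(lra))
    (fun x Hx => dilated_moment_Ccont a _ rho 0 x Hf ltac:(lra) Hx)); auto.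
  - intros x Hx. rewrite Fx by lra. apply Rlt_le, Rpower_pos.
  - intros x Hx. rewrite Fx by lra. scalR.
    unfold Rdiv at 2. rewrite Rmult_1_l, <- Rpower_Ropp. apply dilation_loss; try lra; nra.
  - intros x Hx. apply (continuous_scal_r (K := R_AbsRing) (V := R_NormedModule)
      _ (fun t => 1 / Rpower (1 - t ^ 2) alpha)).
    now apply extremal_continuous.
Qed.

Lemma phi_real r s : 0 < r < 1 -> 0 <= s <= 1 -> phi (RtoC r) s = RtoC (s / (1 - (1 - s) * r)).
Proof.
  intros Hr Hs. unfold phi. rewrite <- RtoC_mult, <- RtoC_minus, <- RtoC_div; auto. nra.
Qed.

Definition path_kernel (alpha r s : R) : R :=
  s / (1 - (1 - s) * r) * Rpower (1 - (s / (1 - (1 - s) * r)) ^ 2) (- alpha) / (1 - r).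

Lemma path_kernel_continuous alpha r s : 0 < r < 1 -> 0 < s < 1 ->
  continuous (path_kernel alpha r) s.
Proof.
  intros Hr Hs. apply continuous_of_ex_derive. assert (Q : 0 < 1 - (1 - s) * r) by nra.
  assert (Y : 0 < s / (1 - (1 - s) * r) < 1).
  { split. apply Rdiv_lt_0_compat; lra. apply Rmult_lt_reg_r with (1 - (1 - s) * r); auto.
    unfold Rdiv. rewrite Rmult_assoc, Rinv_l; nra. }
  assert (Z : 0 < 1 - (s / (1 - (1 - s) * r)) ^ 2) by nra.
  unfold path_kernel, Rpower. auto_derive.
  replace (1 + - ((1 + - s) * r)) with (1 - (1 - s) * r) by ring.
  replace (1 + - (s * / (1 - (1 - s) * r)) ^ 2) with (1 - (s / (1 - (1 - s) * r)) ^ 2)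
    by (unfold Rdiv; ring).
  repeat split; lra.
Qed.

Lemma extremal_deriv_lower alpha a b r u v : 0 < alpha < 1 ->
  hilbert_coefs (extremal alpha) a b -> 0 < r < 1 -> 0 < u -> u <= v -> v < 1 ->
  RInt (fun s => s / (1 - (1 - s) * r) * Rpower (1 - (s / (1 - (1 - s) * r)) ^ 2) (- alpha)
    / (1 - r)) u v
    <= Cmod (PSum (Cderiv b) (RtoC r)).
Proof.
  intros Hal Hab Hr H1 H2 H3. apply Rle_trans with (Re (PSum (Cderiv b) (RtoC r))).
  2: apply Rle_trans with (2 := re_le_Cmod _); apply Rle_abs.
  assert (Hz : in_disk (RtoC r)) by (unfold in_disk; rewrite Cmod_R, Rabs_pos_eq; lra).
  (* A lower bound on [u, v] for 1 - x^2 = (1 - s)(1 - r)(p + s) / p^2, as p <= 1 and p + s >= u. *)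
  pose (c := (1 - v) * (1 - r) * u).
  assert (Pc : 0 < c) by (unfold c; repeat apply Rmult_lt_0_compat; lra).
  apply (dilation_lower_limit alpha c (fun rho => hilbert_deriv_integral (extremal alpha)
    rho (RtoC r))); auto.
  2: now apply (hilbert_deriv_limit a b (extremal alpha) 1 alpha); auto; apply extremal_growth.
  destruct Hab as [Hf _].
  intros rho Hrho.
  assert (X : forall s, 0 <= s <= 1 -> 0 <= s / (1 - (1 - s) * r) <= 1).
  { intros s Hs. assert (0 < 1 - (1 - s) * r) by nra. split. apply Rdiv_le_0_compat; lra.
    apply Rmult_le_reg_r with (1 - (1 - s) * r); auto. unfold Rdiv.
    rewrite Rmult_assoc, Rinv_l; nra. }
  assert (Fx : forall s, 0 <= s <= 1 ->
    Re (phi (RtoC r) s * extremal alpha (RtoC rho * phi (RtoC r) s) / (1 - RtoC r)) =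
    s / (1 - (1 - s) * r) * Rpower (1 - (rho * (s / (1 - (1 - s) * r))) ^ 2) (- alpha) / (1 - r)).
  { intros s Hs. specialize (X s Hs). rewrite phi_real, <- RtoC_mult, extremal_real by (auto; nra).
    rewrite <- RtoC_mult, <- RtoC_minus, <- RtoC_div by lra. reflexivity. }
  assert (Ck := fun s Hs => path_kernel_continuous alpha r s Hr Hs). unfold path_kernel in Ck.
  rewrite <- (RInt_scal (V := R_CompleteNormedModule)) by (apply ex_RInt_cont; auto).
  apply (Re_CInt_lower _ _ _ u v (hilbert_deriv_is_CInt a _ rho _ Hf ltac:(lra) Hz)
    (fun s Hs => hilbert_deriv_Ccont a _ rho _ s Hf ltac:(lra) Hz Hs)); auto.
  - intros s Hs. rewrite Fx by lra. specialize (X s Hs). apply Rmult_le_pos. apply Rmult_le_pos.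
    lra. apply Rlt_le, Rpower_pos.
    apply Rlt_le, Rinv_0_lt_compat; lra.
  - intros s Hs. rewrite Fx by lra. specialize (X s ltac:(lra)). scalR.
    set (x := s / (1 - (1 - s) * r)) in *.
    assert (Cx : c <= 1 - x ^ 2).
    { unfold x. set (p := 1 - (1 - s) * r). assert (Hp : s < p <= 1) by (unfold p; nra).
      replace (1 - (s / p) ^ 2) with ((1 - s) * (1 - r) * (p + s) * (/ p * / p))
        by (unfold p in *; field; lra).
      assert (1 <= / p) by (rewrite <- Rinv_1; apply Rinv_le_contravar; lra).
      assert (1 <= / p * / p) by nra.
      assert (T : c <= (1 - s) * (1 - r) * (p + s)).
      { unfold c. apply Rmult_le_compat; try lra. apply Rmult_le_pos; lra.
        apply Rmult_le_compat_r; lra. }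
      assert (0 < (1 - s) * (1 - r) * (p + s)) by lra. nra. }
    assert (D := dilation_loss alpha rho x c ltac:(lra) Hrho Pc Cx).
    unfold Rdiv. apply (Rmult_le_compat_l (x * / (1 - r))) in D.
    2: { apply Rmult_le_pos. lra. apply Rlt_le, Rinv_0_lt_compat; lra. } lra.
  - intros s Hs. apply (continuous_scal_r (K := R_AbsRing) (V := R_NormedModule)). auto.
Qed.

(** At z = r the weighted kernel tends to 2 s^alpha (1 - s)^(-alpha) as r -> 1. On [u, v] it is at
    least [theta r] times the limit kernel, with [theta r] free of s, so the limit is taken in the
    scalar factor alone. *)
Lemma extremal_seminorm_lower alpha a b u v Sn : 0 < alpha < 1 ->
  hilbert_coefs (extremal alpha) a b -> 0 < u -> u <= v -> v < 1 ->
  (forall z, in_disk z -> Rpower (1 - Cmod z ^ 2) (alpha + 1) * Cmod (PSum (Cderiv b) z) <= Sn) ->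
  2 * RInt (beta_kernel alpha alpha) u v <= Sn.
Proof.
  intros Hal Hab H1 H2 H3 HS.
  (* With e = (1 - r) / u one has s <= p <= s (1 + e) for s >= u. Writing p^(2 alpha - 1) as p^(2
     alpha) / p and inserting these bounds costs (1 + e)^(alpha + 1), and [theta 1] is 2. *)
  pose (theta := fun r => exp ((alpha + 1) * (ln (1 + r) - ln (1 + (1 - r) / u)) - alpha * ln 2)).
  assert (L : forall r, 0 < r < 1 -> theta r * RInt (beta_kernel alpha alpha) u v <= Sn).
  { intros r Hr. apply Rle_trans with (2 := HS (RtoC r) ltac:(unfold in_disk;
      rewrite Cmod_R, Rabs_pos_eq; lra)).
    rewrite Cmod_RtoC_sq by lra.
    assert (Pw := Rpower_pos (1 - r ^ 2) (alpha + 1)).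
    apply Rle_trans with (2 := Rmult_le_compat_l _ _ _ (Rlt_le _ _ Pw)
      (extremal_deriv_lower alpha a b r u v Hal Hab Hr H1 H2 H3)).
    rewrite <- (RInt_scal (V := R_CompleteNormedModule) (beta_kernel alpha alpha))
      by (apply ex_RInt_cont; auto; intros; now apply beta_kernel_continuous).
    assert (Ex : ex_RInt (fun s => s / (1 - (1 - s) * r) * Rpower (1 - (s / (1 - (1 - s) * r))
      ^ 2) (- alpha) / (1 - r)) u v).
    { apply ex_RInt_cont; auto. intros s Hs. now apply path_kernel_continuous. }
    rewrite <- (RInt_scal (V := R_CompleteNormedModule)) with (1 := Ex).
    apply RInt_le; auto.
    - apply (ex_RInt_scal (V := R_NormedModule)).
      apply ex_RInt_cont; auto; intros; now apply beta_kernel_continuous.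
    - apply (ex_RInt_scal (V := R_NormedModule)). exact Ex.
    - intros s Hs. do 2 scalR.
      replace (Rpower (1 - r ^ 2) (alpha + 1) * (s / (1 - (1 - s) * r)
        * Rpower (1 - (s / (1 - (1 - s) * r)) ^ 2) (- alpha) / (1 - r)))
       with (Rpower (1 - r ^ 2) (alpha + 1) / (1 - r) * ((s / (1 - (1 - s) * r))
         * Rpower (1 - (s / (1 - (1 - s) * r)) ^ 2) (- alpha)))
       by (unfold Rdiv; ring).
      rewrite real_kernel_eq by lra. unfold theta, beta_kernel, Rpower. rewrite <- !exp_plus.
      apply exp_le_compat.
      set (p := 1 - (1 - s) * r). set (e := (1 - r) / u).
      assert (Pe : 0 < e) by (apply Rdiv_lt_0_compat; lra).
      assert (Hp : 0 < p <= s * (1 + e)).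
      { split. unfold p; nra. assert (u * e = 1 - r) by (unfold e; field; lra). unfold p. nra. }
      assert (L1 : ln p <= ln s + ln (1 + e)) by (rewrite <- ln_mult by lra; apply ln_le; lra).
      assert (L2 : ln (p + s) <= ln 2 + (ln s + ln (1 + e))).
      { rewrite <- ln_mult by lra. rewrite <- ln_mult by nra. apply ln_le; nra. }
      assert (L3 : ln s <= ln p). { apply ln_le. lra. unfold p. nra. }
      apply (Rmult_le_compat_l alpha) in L2; [|lra].
      apply (Rmult_le_compat_l (2 * alpha)) in L3; [|lra]. lra. }
  apply (Rlim_le (at_left 1) (fun r => theta r * RInt (beta_kernel alpha alpha) u v) (fun _ => Sn)).
  - generalize at_left_1_unit. apply filter_imp. exact L.
  - intros P HP.
    assert (Ct : continuous (fun r => theta r * RInt (beta_kernel alpha alpha) u v) 1).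
    { apply continuous_of_ex_derive. unfold theta. auto_derive.
      replace (1 + (1 + - (1)) * / u) with 1 by (field; lra). repeat split; lra. }
    assert (E : theta 1 = 2).
    { unfold theta. replace (1 + (1 - 1) / u) with 1 by (field; lra). rewrite ln_1.
      replace (1 + 1) with 2 by ring. replace ((alpha + 1) * (ln 2 - 0) - alpha * ln 2)
        with (ln 2) by ring. apply exp_ln; lra. }
    unfold continuous in Ct. rewrite E in Ct. destruct (Ct P HP) as [d Hd]. exists d.
    intros y Hy _. now apply Hd.
  - apply filterlim_const.
Qed.

(** * The reflection formula *)

Fixpoint dirichlet (N : nat) (x : R) : R :=
  match N with O => 1 | S n => dirichlet n x + 2 * cos (INR (S n) * x) end.

(** Symmetric partial sums of the partial fractions of pi / sin(pi alpha). *)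
Fixpoint cosec_sum (alpha : R) (N : nat) : R :=
  match N with
  | O => / alpha
  | S n => cosec_sum alpha n + (-1) ^ S n * (/ (alpha + INR (S n)) + / (alpha - INR (S n)))
  end.

Lemma dirichlet_closed N x : dirichlet N x * sin (x / 2) = sin ((INR N + / 2) * x).
Proof.
  induction N; [simpl; rewrite Rmult_1_l; f_equal; field|].
  change (dirichlet (S N) x) with (dirichlet N x + 2 * cos (INR (S N) * x)).
  rewrite Rmult_plus_distr_r, IHN, S_INR.
  replace ((INR N + / 2) * x) with ((INR N + 1) * x - x / 2) by field.
  replace ((INR N + 1 + / 2) * x) with ((INR N + 1) * x + x / 2) by field.
  rewrite sin_plus, sin_minus. ring.
Qed.

Lemma dirichlet_ex_derive N x : ex_derive (dirichlet N) x.
Proof.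
  induction N. apply (ex_derive_const (K := R_AbsRing) (V := R_NormedModule)).
  apply (ex_derive_plus (dirichlet N) (fun x => 2 * cos (INR (S N) * x)) x IHN). auto_derive. auto.
Qed.

Lemma sin_INR_PI k x : sin (x + INR k * PI) = (-1) ^ k * sin x /\ sin (x - INR k * PI) = (-1)
  ^ k * sin x.
Proof.
  induction k; [simpl; rewrite Rmult_0_l, Rplus_0_r, Rminus_0_r; lra|]. destruct IHk as [E1 E2].
  rewrite S_INR, Rmult_plus_distr_r, Rmult_1_l. split.
  - replace (x + (INR k * PI + PI)) with ((x + INR k * PI) + PI) by ring. rewrite neg_sin, E1.
    simpl; ring.
  - replace (x - (INR k * PI + PI)) with ((x - INR k * PI) - PI) by ring.
    rewrite sin_minus, cos_PI, sin_PI, E2. simpl; ring.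
Qed.

Lemma alpha_INR_nz alpha k : 0 < alpha < 1 -> alpha + INR (S k) <> 0 /\ alpha - INR (S k) <> 0.
Proof. intros Ha. rewrite S_INR. generalize (pos_INR k). lra. Qed.

Lemma dirichlet_cos_integral alpha N : 0 < alpha < 1 ->
  is_RInt (fun x => cos (alpha * x) * dirichlet N x) 0 PI (sin (alpha * PI) * cosec_sum alpha N).
Proof.
  intros Ha. assert (Ppi := PI_RGT_0). induction N.
  - replace (sin (alpha * PI) * cosec_sum alpha 0) with (minus (/ alpha * sin (alpha * PI))
      (/ alpha * sin (alpha * 0))).
    + apply (is_RInt_derive (V := R_CompleteNormedModule) (fun x => / alpha * sin (alpha * x)));
        intros x _.
      * auto_derive; auto. simpl. field. lra.
      * apply continuous_of_ex_derive. simpl. auto_derive. auto.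
    + unfold minus, plus, opp; simpl. rewrite Rmult_0_r, sin_0. ring.
  - destruct (alpha_INR_nz alpha N Ha) as [N1 N2].
    replace (sin (alpha * PI) * cosec_sum alpha (S N)) with
      (plus (sin (alpha * PI) * cosec_sum alpha N)
        (minus (/ (alpha + INR (S N)) * sin ((alpha + INR (S N)) * PI) + / (alpha - INR (S N))
          * sin ((alpha - INR (S N)) * PI))
          (/ (alpha + INR (S N)) * sin ((alpha + INR (S N)) * 0) + / (alpha - INR (S N))
            * sin ((alpha - INR (S N)) * 0)))).
    + apply (is_RInt_ext (fun x => plus (cos (alpha * x) * dirichlet N x)
        (cos ((alpha + INR (S N)) * x) + cos ((alpha - INR (S N)) * x)))).
      { intros x _. change (dirichlet (S N) x) with (dirichlet N x + 2 * cos (INR (S N) * x)).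
        unfold plus; simpl (AbelianMonoid.plus _ _ _). 
        replace ((alpha + INR (S N)) * x) with (alpha * x + INR (S N) * x) by ring.
        replace ((alpha - INR (S N)) * x) with (alpha * x - INR (S N) * x) by ring.
        rewrite cos_plus, cos_minus. eqR. unfold plus; simpl. ring. }
      apply (is_RInt_plus (V := R_NormedModule)); auto.
      apply (is_RInt_derive (V := R_CompleteNormedModule) (fun x => / (alpha + INR (S N))
        * sin ((alpha + INR (S N)) * x) + / (alpha - INR (S N)) * sin ((alpha - INR (S N)) * x)));
            intros x _.
      * set (u := alpha + INR (S N)) in *. set (v := alpha - INR (S N)) in *. auto_derive; auto.
        field. auto.
      * apply continuous_of_ex_derive. auto_derive. auto.
    + destruct (sin_INR_PI (S N) (alpha * PI)) as [E1 E2].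
      rewrite Rmult_plus_distr_r, Rmult_minus_distr_r, E1, E2, !Rmult_0_r, sin_0.
      change (cosec_sum alpha (S N)) with (cosec_sum alpha N + (-1) ^ S N * (/ (alpha + INR (S N))
        + / (alpha - INR (S N)))).
      unfold minus, plus, opp; simpl (AbelianMonoid.plus _ _ _). simpl. ring.
Qed.

Lemma dirichlet_integral N : is_RInt (dirichlet N) 0 PI PI.
Proof.
  induction N.
  - replace PI with (scal (PI - 0) 1) at 2 by (unfold scal; simpl; unfold mult; simpl; ring).
    apply (is_RInt_const (V := R_NormedModule) 0 PI 1).
  - assert (P : 0 < INR (S N)) by (apply lt_0_INR; lia).
    replace PI with (plus PI (minus (2 / INR (S N) * sin (INR (S N) * PI)) (2 / INR (S N)
      * sin (INR (S N) * 0)))) at 2.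
    + apply (is_RInt_plus (V := R_NormedModule)); auto.
      apply (is_RInt_derive (V := R_CompleteNormedModule) (fun x => 2 / INR (S N) * sin (INR (S N)
        * x))); intros x _.
      * set (u := INR (S N)) in *. auto_derive; auto. field. lra.
      * apply continuous_of_ex_derive. auto_derive. auto.
    + destruct (sin_INR_PI (S N) 0) as [E1 _]. rewrite Rplus_0_l, sin_0, Rmult_0_r in E1.
      rewrite E1, !Rmult_0_r, sin_0. unfold minus, plus, opp; simpl. ring.
Qed.

Lemma cos_minus_1_bound t : Rabs (cos t - 1) <= t ^ 2 / 2.
Proof.
  assert (E : cos t = 1 - 2 * sin (t / 2) * sin (t / 2)) by (rewrite <- cos_2a_sin; f_equal; field).
  assert (S2 : sin (t / 2) ^ 2 <= (t / 2) ^ 2).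
  { assert (K : forall u, 0 <= u -> sin u ^ 2 <= u ^ 2).
    { intros u [Hu|<-]. 2: rewrite sin_0; lra. generalize (sin_lt_x u Hu) (SIN_bound u). intros.
      destruct (Rle_dec u 1). generalize (sin_ge_0 u ltac:(lra) ltac:(generalize PI2_1; lra)).
      intros; nra. nra. }
    destruct (Rle_dec 0 (t / 2)). now apply K.
    replace (sin (t / 2)) with (- sin (- (t / 2))) by (rewrite sin_neg; ring).
    generalize (K (- (t / 2)) ltac:(lra)). nra. }
  rewrite E. replace (1 - 2 * sin (t / 2) * sin (t / 2) - 1) with (- (2 * sin (t / 2) ^ 2)) by ring.
  rewrite Rabs_Ropp, Rabs_pos_eq by (generalize (pow2_ge_0 (sin (t / 2))); lra).
  replace (t ^ 2 / 2) with (2 * (t / 2) ^ 2) by field. lra.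
Qed.

(** A quantitative Riemann-Lebesgue lemma: away from 0 the integrand is a smooth [q] times sin((N +
    1/2) x), and one integration by parts gains the factor 1 / (N + 1/2). *)
Lemma dirichlet_oscillation alpha delta : 0 < delta < PI -> exists K, forall N,
  Rabs (RInt (fun x => (cos (alpha * x) - 1) * dirichlet N x) delta PI) <= K / (INR N + / 2).
Proof.
  intros Hd. assert (Ppi := PI_RGT_0).
  pose (q := fun x => (cos (alpha * x) - 1) / sin (x / 2)).
  pose (q' := fun x => (- alpha * sin (alpha * x) * sin (x / 2) - (cos (alpha * x) - 1)
    * (cos (x / 2) / 2)) / (sin (x / 2) * sin (x / 2))).
  assert (Sp : forall x, delta <= x <= PI -> 0 < sin (x / 2)) by (intros x Hx; apply sin_gt_0; lra).
  assert (Dq : forall x, delta <= x <= PI -> is_derive q x (q' x)).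
  { intros x Hx. specialize (Sp x Hx). unfold q, q'. auto_derive. unfold Rdiv in Sp. lra.
    unfold Rdiv. field.
    unfold Rdiv in Sp. lra. }
  assert (Cq' : forall x, delta <= x <= PI -> continuous q' x).
  { intros x Hx. specialize (Sp x Hx). apply continuous_of_ex_derive. unfold q'. auto_derive.
    unfold Rdiv in Sp.
    apply Rgt_not_eq, Rmult_lt_0_compat; lra. }
  assert (EK : ex_RInt (fun x => Rabs (q' x)) delta PI).
  { apply ex_RInt_segment. lra. intros x Hx.
    apply (continuous_comp q' Rabs). now apply Cq'. apply continuous_Rabs. }
  exists (Rabs (q PI) + Rabs (q delta) + RInt (fun x => Rabs (q' x)) delta PI). intros N.
  set (m := INR N + / 2). assert (Pm : 0 < m) by (unfold m; generalize (pos_INR N); lra).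
  assert (I1 : is_RInt (fun x => q x * sin (m * x) - / m * (q' x * cos (m * x))) delta PI
     (minus (- / m * (q PI * cos (m * PI))) (- / m * (q delta * cos (m * delta))))).
  { apply (is_RInt_derive (V := R_CompleteNormedModule) (fun x => - / m * (q x * cos (m * x))));
      rewrite Rmin_left, Rmax_right by lra; intros x Hx.
    - replace (q x * sin (m * x) - / m * (q' x * cos (m * x))) with (- / m * (q' x * cos (m * x)
        + q x * (- m * sin (m * x)))) by (field; lra).
      apply (is_derive_scal (fun x => q x * cos (m * x))).
      apply (is_derive_mult q (fun x => cos (m * x))). auto. auto_derive; auto; ring.
      intros; apply Rmult_comm.
    - apply (continuous_minus (V := R_NormedModule)).
      + apply (continuous_mult (K := R_AbsRing)). apply continuous_of_ex_derive.
        eexists; apply Dq; auto.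
        apply continuous_of_ex_derive. auto_derive. auto.
      + apply (continuous_scal_r (K := R_AbsRing) (V := R_NormedModule)).
        apply (continuous_mult (K := R_AbsRing)); auto.
        apply continuous_of_ex_derive. auto_derive. auto. }
  assert (E2 : ex_RInt (fun x => q' x * cos (m * x)) delta PI).
  { apply ex_RInt_segment. lra. intros x Hx.
    apply (continuous_mult (K := R_AbsRing)); auto. apply continuous_of_ex_derive. auto_derive.
    auto. }
  destruct E2 as [J HJ].
  assert (I2 := is_RInt_plus _ _ _ _ _ _ I1 (is_RInt_scal _ _ _ (/ m) _ HJ)).
  assert (EI : RInt (fun x => (cos (alpha * x) - 1) * dirichlet N x) delta PI =
    minus (- / m * (q PI * cos (m * PI))) (- / m * (q delta * cos (m * delta))) + / m * J).
  { apply is_RInt_unique. revert I2. apply is_RInt_ext. rewrite Rmin_left, Rmax_right by lra.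
    intros x Hx.
    unfold plus, scal; simpl. unfold mult; simpl. specialize (Sp x ltac:(lra)).
    unfold q. unfold m. rewrite <- dirichlet_closed. eqR. field. generalize (pos_INR N). intros.
    repeat split; lra. }
  rewrite EI. unfold minus, plus, opp; simpl.
  assert (BJ : Rabs J <= RInt (fun x => Rabs (q' x)) delta PI).
  { apply (norm_RInt_le (V := R_NormedModule) (fun x => q' x * cos (m * x)) (fun x => Rabs (q' x))
      delta PI); auto. lra.
    - intros x Hx. unfold norm; simpl. unfold abs; simpl. rewrite Rabs_mult.
      rewrite <- (Rmult_1_r (Rabs (q' x))) at 2. apply Rmult_le_compat_l. apply Rabs_pos.
      apply Rabs_le. generalize (COS_bound (m * x)). lra.
    - now apply (RInt_correct (V := R_CompleteNormedModule)). }
  replace (- / m * (q PI * cos (m * PI)) + - (- / m * (q delta * cos (m * delta))) + / m * J)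
    with ((- (q PI * cos (m * PI)) + q delta * cos (m * delta) + J) / m) by (field; lra).
  unfold Rdiv. rewrite Rabs_mult, (Rabs_pos_eq (/ m)) by (apply Rlt_le, Rinv_0_lt_compat; auto).
  apply Rmult_le_compat_r. apply Rlt_le, Rinv_0_lt_compat; auto.
  assert (B : forall u v, Rabs (u * cos v) <= Rabs u).
  { intros u v. rewrite Rabs_mult. rewrite <- (Rmult_1_r (Rabs u)) at 2. apply Rmult_le_compat_l.
    apply Rabs_pos.
    apply Rabs_le. generalize (COS_bound v). lra. }
  apply Rle_trans with (1 := Rabs_triang _ _). apply Rplus_le_compat; auto.
  apply Rle_trans with (1 := Rabs_triang _ _). rewrite Rabs_Ropp. apply Rplus_le_compat; auto.
Qed.

(** Integrating cos(alpha x) and 1 against the Dirichlet kernel gives the partial sum and pi. The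
    difference is small near 0, where cos(alpha x) - 1 is quadratic, and oscillates elsewhere. *)
Lemma cosec_sum_limit alpha : 0 < alpha < 1 ->
  is_lim_seq (fun N => sin (alpha * PI) * cosec_sum alpha N) PI.
Proof.
  intros Ha. assert (Ppi := PI_RGT_0). apply is_lim_seq_spec. intros eps. simpl.
  assert (Pe := cond_pos eps).
  pose (delta := Rmin 1 (eps / 8)).
  assert (Hd : 0 < delta <= 1 /\ delta <= eps / 8).
  { unfold delta. repeat split. apply Rmin_pos; lra. apply Rmin_l. apply Rmin_r. }
  assert (P2 := PI2_1).
  destruct (dirichlet_oscillation alpha delta) as [K HK]. lra.
  destruct (archimed_cor1 (eps / 2 / (Rabs K + 1))) as [N0 [HN0 PN0]].
  { generalize (Rabs_pos K). intros. apply Rdiv_lt_0_compat; lra. }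
  exists N0. intros N HN.
  assert (I := is_RInt_minus _ _ _ _ _ _ (dirichlet_cos_integral alpha N Ha)
    (dirichlet_integral N)).
  assert (E : forall x, ex_derive (fun x => (cos (alpha * x) - 1) * dirichlet N x) x).
  { intros x. apply (ex_derive_mult (fun x => cos (alpha * x) - 1) (dirichlet N)).
    auto_derive; auto. apply dirichlet_ex_derive. }
  assert (Ex : forall u v, ex_RInt (fun x => (cos (alpha * x) - 1) * dirichlet N x) u v).
  { intros u v. apply (ex_RInt_continuous (V := R_CompleteNormedModule)). intros x _.
    now apply continuous_of_ex_derive. }
  assert (V : sin (alpha * PI) * cosec_sum alpha N - PI = RInt (fun x => (cos (alpha * x) - 1)
    * dirichlet N x) 0 PI).
  { symmetry. apply is_RInt_unique. revert I. apply is_RInt_ext. intros x _.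
    unfold minus, plus, opp; simpl. eqR. ring. }
  rewrite V, <- (RInt_Chasles _ 0 delta PI) by apply Ex. unfold plus; simpl.
  apply Rle_lt_trans with (1 := Rabs_triang _ _).
  (* The closed form and sin(x / 2) >= x / 6 bound the kernel by 6 / x for every N; against x^2 / 2
     this leaves 3 x. *)
  assert (B1 : Rabs (RInt (fun x => (cos (alpha * x) - 1) * dirichlet N x) 0 delta) <= (delta - 0)
    * (3 * delta)).
  { apply (norm_RInt_le_const (V := R_NormedModule) (fun x => (cos (alpha * x) - 1)
      * dirichlet N x) 0 delta). lra.
    - intros x Hx. unfold norm; simpl. unfold abs; simpl. rewrite Rabs_mult.
      destruct (Req_dec x 0) as [->|Nx].
      { rewrite Rmult_0_r, cos_0, Rminus_diag, Rabs_R0. lra. }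
      assert (Hs := sin_half_ge x ltac:(lra)).
      assert (C := cos_minus_1_bound (alpha * x)).
      assert (Dc := dirichlet_closed N x).
      assert (Db : Rabs (dirichlet N x) * (x / 6) <= 1).
      { apply Rle_trans with (Rabs (dirichlet N x) * sin (x / 2)). apply Rmult_le_compat_l; auto.
        apply Rabs_pos.
        rewrite <- (Rabs_pos_eq (sin (x / 2))) by lra. rewrite <- Rabs_mult, Dc. apply Rabs_le.
        generalize (SIN_bound ((INR N + / 2) * x)). lra. }
      apply Rle_trans with (x ^ 2 / 2 * Rabs (dirichlet N x)).
      + apply Rmult_le_compat_r. apply Rabs_pos. apply Rle_trans with (1 := C).
        rewrite Rpow_mult_distr.
        assert (alpha ^ 2 <= 1) by nra. generalize (pow2_ge_0 x). intros. nra.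
      + replace (x ^ 2 / 2 * Rabs (dirichlet N x)) with (3 * x * (Rabs (dirichlet N x) * (x / 6)))
          by field. nra.
    - apply (RInt_correct (V := R_CompleteNormedModule)). apply Ex. }
  assert (B2 : Rabs (RInt (fun x => (cos (alpha * x) - 1) * dirichlet N x) delta PI) < eps / 2).
  { apply Rle_lt_trans with (1 := HK N). assert (PK := Rabs_pos K).
    assert (P3 : 0 < INR N0) by (apply lt_0_INR; lia).
    assert (P4 : INR N0 <= INR N) by (apply le_INR; lia).
    assert (T : / (INR N + / 2) < eps / 2 / (Rabs K + 1)).
    { apply Rlt_trans with (2 := HN0). apply Rinv_lt_contravar. apply Rmult_lt_0_compat; lra. lra. }
    assert (P5 : 0 < / (INR N + / 2)) by (apply Rinv_0_lt_compat; lra).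
    apply Rle_lt_trans with (Rabs K * / (INR N + / 2)).
    - apply Rmult_le_compat_r. lra. apply Rle_abs.
    - apply Rle_lt_trans with ((Rabs K + 1) * / (INR N + / 2)). nra.
      replace (eps / 2) with ((Rabs K + 1) * (eps / 2 / (Rabs K + 1))) by (field; lra).
      apply Rmult_lt_compat_l; lra. }
  nra.
Qed.

(** * From the partial fractions to the Beta integral *)

Fixpoint alternating_sum (alpha : R) (N : nat) : R :=
  match N with
  | O => 0
  | S n => alternating_sum alpha n + (-1) ^ n * (/ (INR n + alpha) + / (INR n + 1 - alpha))
  end.

(** The same fractions grouped differently: 1 / (n + 1 - alpha) is -1 / (alpha - (n + 1)), which
    belongs to the next term of [cosec_sum], so exactly one fraction is left over. *)
Lemma alternating_sum_cosec alpha N : 0 < alpha < 1 ->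
  alternating_sum alpha (S N) = cosec_sum alpha N + (-1) ^ N * / (INR N + 1 - alpha).
Proof.
  intros Ha. induction N. simpl. rewrite Rplus_0_l. field. lra.
  change (alternating_sum alpha (S (S N))) with (alternating_sum alpha (S N) + (-1)
    ^ S N * (/ (INR (S N) + alpha) + / (INR (S N) + 1 - alpha))).
  rewrite IHN.
  change (cosec_sum alpha (S N)) with (cosec_sum alpha N + (-1) ^ S N * (/ (alpha + INR (S N))
    + / (alpha - INR (S N)))).
  rewrite !S_INR. simpl pow. generalize (pos_INR N). intros. field. repeat split; lra.
Qed.

Lemma alternating_sum_limit alpha : 0 < alpha < 1 ->
  is_lim_seq (alternating_sum alpha) (PI / sin (alpha * PI)).
Proof.
  intros Ha. assert (Ppi := PI_RGT_0). assert (Sp : 0 < sin (alpha * PI)) by (apply sin_gt_0; nra).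
  apply is_lim_seq_incr_1.
  apply (is_lim_seq_ext (fun N => / sin (alpha * PI) * (sin (alpha * PI) * cosec_sum alpha N)
    + (-1) ^ N * / (INR N + 1 - alpha))).
  { intros N. rewrite alternating_sum_cosec by auto. field. generalize (pos_INR N). lra. }
  replace (Finite (PI / sin (alpha * PI))) with (Finite (/ sin (alpha * PI) * PI + 0))
    by (f_equal; unfold Rdiv; ring).
  apply is_lim_seq_plus'.
  - apply (is_lim_seq_scal_l _ _ (Finite PI)). now apply cosec_sum_limit.
  - apply is_lim_seq_abs_0.
    apply (is_lim_seq_ext (fun N => / (INR N + 1 - alpha))).
    + intros N. rewrite Rabs_mult, <- RPow_abs, Rabs_m1, pow1, Rabs_pos_eq. ring.
      apply Rlt_le, Rinv_0_lt_compat. generalize (pos_INR N). lra.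
    + apply (is_lim_seq_inv _ p_infty); [|easy].
      apply (is_lim_seq_ext (fun N => INR N + (1 - alpha))). intros; ring.
      apply (is_lim_seq_plus _ _ p_infty (1 - alpha) p_infty). apply is_lim_seq_INR.
      apply is_lim_seq_const. easy.
Qed.

(** A primitive, vanishing as y -> 0, of (y^(alpha-1) + y^(-alpha)) / (1 + y) with 1 / (1 + y)
    replaced by N terms of its geometric series. *)
Fixpoint truncated_primitive (alpha : R) (N : nat) (y : R) : R :=
  match N with
  | O => 0
  | S n => truncated_primitive alpha n y + (-1) ^ n *
      (/ (INR n + alpha) * Rpower y (INR n + alpha) + / (INR n + 1 - alpha)
        * Rpower y (INR n + 1 - alpha))
  end.

Lemma truncated_primitive_1 alpha N : truncated_primitive alpha N 1 = alternating_sum alpha N.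
Proof.
  assert (R1 : forall q, Rpower 1 q = 1) by (intros q; unfold Rpower; rewrite ln_1, Rmult_0_r;
    apply exp_0).
  induction N; simpl; auto. rewrite IHN, !R1. ring.
Qed.

Lemma truncated_primitive_derive alpha N y : 0 < alpha < 1 -> 0 < y ->
  is_derive (truncated_primitive alpha N) y
    ((Rpower y (alpha - 1) + Rpower y (- alpha)) * (1 - (- y) ^ N) / (1 + y)).
Proof.
  intros Ha Hy. induction N.
  - replace (_ / (1 + y)) with (@zero R_AbelianMonoid).
    apply (is_derive_const (K := R_AbsRing) (V := R_NormedModule)).
    simpl. unfold zero; simpl. field. lra.
  - assert (PN := pos_INR N).
    replace ((Rpower y (alpha - 1) + Rpower y (- alpha)) * (1 - (- y) ^ S N) / (1 + y)) with
      ((Rpower y (alpha - 1) + Rpower y (- alpha)) * (1 - (- y) ^ N) / (1 + y) +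
       (-1) ^ N * (/ (INR N + alpha) * ((INR N + alpha) * Rpower y (INR N + alpha - 1)) +
         / (INR N + 1 - alpha) * ((INR N + 1 - alpha) * Rpower y (INR N + 1 - alpha - 1)))).
    + apply (is_derive_plus (truncated_primitive alpha N)). exact IHN.
      apply (is_derive_scal (fun y => / (INR N + alpha) * Rpower y (INR N + alpha)
        + / (INR N + 1 - alpha) * Rpower y (INR N + 1 - alpha))).
      apply (is_derive_plus (fun y => / (INR N + alpha) * Rpower y (INR N + alpha)));
      apply (is_derive_scal (fun y => Rpower y _)); now apply is_derive_Rpower.
    + replace (INR N + alpha - 1) with (INR N + (alpha - 1)) by ring.
      replace (INR N + 1 - alpha - 1) with (INR N + - alpha) by ring.
      rewrite !Rpower_plus, !Rpower_pow by auto.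
      replace (- y) with (-1 * y) by ring. rewrite !Rpow_mult_distr. simpl. field. lra.
Qed.

Lemma Rpower_at_0 q : 0 < q -> filterlim (fun y => Rpower y q) (at_right 0) (locally 0).
Proof.
  intros Hq. apply (Rlim0 (at_right 0)). intros eps.
  exists (mkposreal _ (Rpower_pos eps (/ q))). intros y Hy Hy0.
  apply ball_Rabs in Hy. simpl in Hy. rewrite Rminus_0_r, Rabs_pos_eq in Hy by lra.
  rewrite Rabs_pos_eq by apply Rlt_le, Rpower_pos.
  replace (pos eps) with (Rpower (Rpower eps (/ q)) q).
  - unfold Rpower at 1 2. apply exp_increasing, Rmult_lt_compat_l; auto. now apply ln_increasing.
  - rewrite Rpower_mult, Rinv_l, Rpower_1 by (try lra; apply cond_pos). reflexivity.
Qed.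

Lemma Rlim0_plus {T} (F : (T -> Prop) -> Prop) {FF : Filter F} (h k : T -> R) :
  filterlim h F (locally 0) -> filterlim k F (locally 0) ->
    filterlim (fun x => h x + k x) F (locally 0).
Proof.
  intros Hh Hk. rewrite <- (Rplus_0_r 0). apply (filterlim_comp_2 (G := locally 0)
    (H := locally 0)); auto.
  apply (filterlim_plus (K := R_AbsRing) (V := R_NormedModule) 0 0).
Qed.

Lemma truncated_primitive_at_0 alpha N : 0 < alpha < 1 ->
  filterlim (truncated_primitive alpha N) (at_right 0) (locally 0).
Proof.
  intros Ha. induction N. apply (filterlim_ext (fun _ => 0)); [reflexivity|apply filterlim_const].
  assert (PN := pos_INR N).
  apply (Rlim0_plus (at_right 0)); auto. apply (Rlim0_scal (at_right 0)).
  apply (Rlim0_plus (at_right 0)); apply (Rlim0_scal (at_right 0)), Rpower_at_0; lra.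
Qed.

Definition half_line_kernel (alpha y : R) : R := (Rpower y alpha + Rpower y (- alpha)) / ((1 + y)
  * (1 + y)).

(** The second summand comes from an integration by parts that lowers the power of 1 + y in
    [half_line_kernel] from 2 to 1, where the geometric series applies; it vanishes at y = 1 and as
    y -> 0. *)
Definition half_line_primitive (alpha : R) (N : nat) (y : R) : R :=
  alpha * truncated_primitive alpha N y + (Rpower y (1 - alpha) - Rpower y alpha) / (1 + y).

Lemma half_line_primitive_derive alpha N y : 0 < alpha < 1 -> 0 < y ->
  is_derive (half_line_primitive alpha N) y
    (half_line_kernel alpha y - alpha * ((Rpower y (alpha - 1) + Rpower y (- alpha)) * (- y)
      ^ N / (1 + y))).
Proof.
  intros Ha Hy.
  replace (half_line_kernel alpha y - alpha * ((Rpower y (alpha - 1) + Rpower y (- alpha)) * (- y)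
    ^ N / (1 + y))) with
    (alpha * ((Rpower y (alpha - 1) + Rpower y (- alpha)) * (1 - (- y) ^ N) / (1 + y)) +
     (((1 - alpha) * Rpower y (1 - alpha - 1) - alpha * Rpower y (alpha - 1)) * / (1 + y) +
      (Rpower y (1 - alpha) - Rpower y alpha) * (- / ((1 + y) * (1 + y))))).
  - apply (is_derive_plus (fun y => alpha * truncated_primitive alpha N y)).
    + apply (is_derive_scal (truncated_primitive alpha N)). now apply truncated_primitive_derive.
    + apply (is_derive_mult (fun y => Rpower y (1 - alpha) - Rpower y alpha) (fun y => / (1 + y))).
      * apply (is_derive_minus (fun y => Rpower y (1 - alpha))); now apply is_derive_Rpower.
      * auto_derive. lra. field. lra.
      * intros; apply Rmult_comm.
  - unfold half_line_kernel.
    replace (1 - alpha - 1) with (- alpha) by ring.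
    replace (Rpower y (1 - alpha)) with (y * Rpower y (- alpha)).
    2: { rewrite <- (Rpower_1 y) at 1 by auto. rewrite <- Rpower_plus. f_equal; ring. }
    replace (Rpower y alpha) with (y * Rpower y (alpha - 1)).
    2: { rewrite <- (Rpower_1 y) at 1 by auto. rewrite <- Rpower_plus. f_equal. ring. }
    field. lra.
Qed.

Lemma half_line_kernel_continuous alpha y : 0 < y -> continuous (half_line_kernel alpha) y.
Proof.
  intros Hy. apply continuous_of_ex_derive. unfold half_line_kernel, Rpower. auto_derive.
  repeat split; try lra. apply Rgt_not_eq, Rmult_lt_0_compat; lra.
Qed.

(** The geometric remainder carries y^(n+1); one factor y absorbs the singularities, as y^(alpha-1)
    and y^(-alpha) are at most 1 / y, and 2 y^n integrates to at most 2 / (n + 1), uniformly in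
    eps. *)
Lemma half_line_estimate alpha n eps : 0 < alpha < 1 -> 0 < eps <= 1 ->
  Rabs (RInt (half_line_kernel alpha) eps 1 - (half_line_primitive alpha (S n)
    1 - half_line_primitive alpha (S n) eps))
    <= 2 / (INR n + 1).
Proof.
  intros Ha He. pose (e := fun y => alpha * ((Rpower y (alpha - 1) + Rpower y (- alpha)) * (- y)
    ^ S n / (1 + y))).
  assert (Ce : forall y, 0 < y -> continuous e y).
  { intros y Hy. apply continuous_of_ex_derive. unfold e, Rpower. auto_derive. repeat split; lra. }
  assert (I1 : is_RInt (fun y => half_line_kernel alpha y - e y) eps 1
     (minus (half_line_primitive alpha (S n) 1) (half_line_primitive alpha (S n) eps))).
  { apply (is_RInt_derive (V := R_CompleteNormedModule)); rewrite Rmin_left, Rmax_right by lra;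
      intros y Hy.
    - apply half_line_primitive_derive; lra.
    - apply (continuous_minus (V := R_NormedModule)). apply half_line_kernel_continuous; lra.
      apply Ce; lra. }
  assert (I2 : ex_RInt (half_line_kernel alpha) eps 1).
  { apply ex_RInt_segment. lra. intros y Hy.
    apply half_line_kernel_continuous; lra. }
  apply (RInt_correct (V := R_CompleteNormedModule)) in I2.
  assert (I3 := is_RInt_minus _ _ _ _ _ _ I2 I1).
  assert (PN := pos_INR n).
  assert (I4 : is_RInt (fun y => 2 * y ^ n) eps 1 (minus (2 / (INR n + 1) * 1 ^ S n)
    (2 / (INR n + 1) * eps ^ S n))).
  { apply (is_RInt_derive (V := R_CompleteNormedModule) (fun y => 2 / (INR n + 1) * y ^ S n));
      intros y _.
    - replace (2 * y ^ n) with (2 / (INR n + 1) * (INR (S n) * 1 * y ^ pred (S n)))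
        by (rewrite S_INR; simpl pred; field; lra).
      apply (is_derive_scal (fun y => y ^ S n)). apply (is_derive_pow (fun y => y)).
      apply (is_derive_id (K := R_AbsRing)).
    - apply continuous_of_ex_derive. auto_derive. auto. }
  apply Rle_trans with (minus (2 / (INR n + 1) * 1 ^ S n) (2 / (INR n + 1) * eps ^ S n)).
  - refine (norm_RInt_le (V := R_NormedModule) _ (fun y => 2 * y ^ n) eps 1 _ _ (proj2 He) _ I3 I4).
    intros y Hy. unfold norm, minus, plus, opp; simpl. unfold abs; simpl.
    replace (half_line_kernel alpha y + - (half_line_kernel alpha y - e y)) with (e y) by ring.
    unfold e.
    assert (Iy : 1 <= / y) by (rewrite <- Rinv_1; apply Rinv_le_contravar; lra).
    assert (B : forall q, -1 <= q -> Rpower y q <= / y).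
    { intros q Hq. replace (/ y) with (Rpower y (- (1))) by (rewrite Rpower_Ropp, Rpower_1; lra).
      unfold Rpower. apply exp_le_compat. assert (ln y <= ln 1) by (apply ln_le; lra).
      rewrite ln_1 in H. nra. }
    assert (B1 := B (alpha - 1) ltac:(lra)). assert (B2 := B (- alpha) ltac:(lra)).
    assert (Q1 := Rpower_pos y (alpha - 1)). assert (Q2 := Rpower_pos y (- alpha)).
    assert (Yn : 0 <= y ^ n) by (apply pow_le; lra).
    unfold Rdiv. rewrite !Rabs_mult, <- RPow_abs, Rabs_Ropp, (Rabs_pos_eq y) by lra.
    rewrite (Rabs_pos_eq alpha), (Rabs_pos_eq (/ (1 + y))), Rabs_pos_eq by (try (apply Rlt_le,
      Rinv_0_lt_compat); lra).
    assert (Y1 : / (1 + y) <= 1) by (rewrite <- Rinv_1; apply Rinv_le_contravar; lra).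
    assert (Y0 : 0 < / (1 + y)) by (apply Rinv_0_lt_compat; lra).
    assert (M : (Rpower y (alpha - 1) + Rpower y (- alpha)) * (y * y ^ n) <= 2 * y ^ n).
    { replace (2 * y ^ n) with ((/ y + / y) * (y * y ^ n)) by (field; lra).
      apply Rmult_le_compat_r; [|lra]. apply Rmult_le_pos; lra. }
    assert (M0 : 0 <= (Rpower y (alpha - 1) + Rpower y (- alpha)) * (y * y ^ n)).
    { apply Rmult_le_pos. lra. apply Rmult_le_pos; lra. }
    simpl pow. set (m := (Rpower y (alpha - 1) + Rpower y (- alpha)) * (y * y ^ n)) in *.
    apply Rle_trans with (1 * (m * 1)); [|lra]. apply Rmult_le_compat; try lra.
    apply Rmult_le_pos; lra.
    apply Rmult_le_compat_l; lra.
  - unfold minus, plus, opp; simpl. rewrite pow1, !Rmult_1_r.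
    assert (0 <= 2 / (INR n + 1) * (eps * eps ^ n)); [|lra].
    apply Rmult_le_pos. apply Rdiv_le_0_compat; lra. apply Rmult_le_pos. lra. apply pow_le; lra.
Qed.

(* The substitutions s = y/(1+y) and s = 1/(1+y) on the two halves of the interval. *)
Lemma beta_half_line alpha eps : 0 < eps <= 1 ->
  RInt (beta_kernel alpha alpha) (eps / (1 + eps)) (/ (1 + eps)) = RInt (half_line_kernel alpha)
    eps 1.
Proof.
  intros He.
  assert (Dom : forall y, 0 < y -> 0 < y / (1 + y) < 1 /\ 0 < / (1 + y) < 1).
  { intros y Hy. assert (0 < / (1 + y)) by (apply Rinv_0_lt_compat; lra).
    assert ((1 + y) * / (1 + y) = 1) by (apply Rinv_r; lra). unfold Rdiv. nra. }
  assert (I1 : is_RInt (fun y => scal (/ ((1 + y) * (1 + y)))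
    (beta_kernel alpha alpha (y / (1 + y)))) eps 1
     (RInt (beta_kernel alpha alpha) (eps / (1 + eps)) (1 / (1 + 1)))).
  { apply (is_RInt_comp (V := R_CompleteNormedModule) (beta_kernel alpha alpha)
      (fun y => y / (1 + y)) (fun y => / ((1 + y) * (1 + y))));
    rewrite Rmin_left, Rmax_right by lra; intros y Hy.
    - apply beta_kernel_continuous. apply Dom. lra.
    - split. auto_derive. lra. field. lra.
      apply continuous_of_ex_derive. auto_derive. apply Rgt_not_eq, Rmult_lt_0_compat; lra. }
  assert (I2 : is_RInt (fun y => scal (- / ((1 + y) * (1 + y)))
    (beta_kernel alpha alpha (/ (1 + y)))) eps 1
     (RInt (beta_kernel alpha alpha) (/ (1 + eps)) (/ (1 + 1)))).
  { apply (is_RInt_comp (V := R_CompleteNormedModule) (beta_kernel alpha alpha)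
      (fun y => / (1 + y)) (fun y => - / ((1 + y) * (1 + y))));
    rewrite Rmin_left, Rmax_right by lra; intros y Hy.
    - apply beta_kernel_continuous. apply Dom. lra.
    - split. auto_derive. lra. field. lra.
      apply continuous_of_ex_derive. auto_derive. apply Rgt_not_eq, Rmult_lt_0_compat; lra. }
  assert (I3 := is_RInt_minus _ _ _ _ _ _ I1 I2).
  replace (1 / (1 + 1)) with (/ (1 + 1)) in I3 by field.
  destruct (Dom eps ltac:(lra)) as [D1 D2].
  assert (Ex : forall u v, 0 < u < 1 -> 0 < v < 1 -> ex_RInt (beta_kernel alpha alpha) u v).
  { intros u v Hu Hv. apply (ex_RInt_continuous (V := R_CompleteNormedModule)). intros x Hx.
    apply beta_kernel_continuous.
    generalize (Rmin_glb_lt u v 0) (Rmax_lub_lt u v 1). lra. }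
  rewrite <- (RInt_Chasles (beta_kernel alpha alpha) _ (/ (1 + 1)) _) by (apply Ex; lra).
  rewrite <- (opp_RInt_swap (beta_kernel alpha alpha) (/ (1 + eps))) by (apply Ex; lra).
  symmetry. apply is_RInt_unique. revert I3. apply is_RInt_ext.
  rewrite Rmin_left, Rmax_right by lra. intros y Hy.
  unfold beta_kernel, half_line_kernel, scal, minus, plus, opp; simpl. unfold mult; simpl.
  destruct (Dom y ltac:(lra)) as [Y1 Y2].
  assert (E1 : 1 - y / (1 + y) = / (1 + y)) by (field; lra).
  assert (E2 : 1 - / (1 + y) = y / (1 + y)) by (field; lra).
  rewrite E1, E2.
  assert (Iy : 0 < / (1 + y)) by lra.
  assert (K1 : Rpower (y / (1 + y)) alpha * Rpower (/ (1 + y)) (- alpha) = Rpower y alpha).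
  { unfold Rpower, Rdiv. rewrite <- exp_plus, ln_mult by lra. f_equal. ring. }
  assert (K2 : Rpower (/ (1 + y)) alpha * Rpower (y / (1 + y)) (- alpha) = Rpower y (- alpha)).
  { unfold Rpower, Rdiv. rewrite <- exp_plus, ln_mult by lra. f_equal. ring. }
  rewrite K1, K2. eqR. field. lra.
Qed.

(** Three errors of e / 3: the tail of the alternating sum, the geometric remainder, and the
    primitive at the lower end. The index n is fixed before eps, which the uniformity of
    [half_line_estimate] allows. *)
Lemma beta_symmetric_limit alpha e : 0 < alpha < 1 -> 0 < e ->
  exists d, 0 < d <= 1 /\ forall eps, 0 < eps < d ->
  Rabs (RInt (beta_kernel alpha alpha) (eps / (1 + eps)) (/ (1 + eps))
    - alpha * PI / sin (alpha * PI)) < e.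
Proof.
  intros Ha He.
  assert (L := is_lim_seq_scal_l _ alpha _ (alternating_sum_limit alpha Ha)).
  apply is_lim_seq_spec in L. simpl in L.
  assert (P3 : 0 < e / 3) by lra. destruct (L (mkposreal _ P3)) as [N1 HN1]. simpl in HN1.
  destruct (archimed_cor1 (e / 6)) as [N2 [HN2 PN2]]. lra.
  set (n := max N1 N2).
  specialize (HN1 (S n) ltac:(lia)).
  assert (H2 : 2 / (INR n + 1) < e / 3).
  { assert (P2 : 0 < INR N2) by (apply lt_0_INR; lia).
    assert (INR N2 <= INR n) by (apply le_INR; lia).
    assert (/ (INR n + 1) < e / 6). { apply Rlt_trans with (2 := HN2). apply Rinv_lt_contravar.
    apply Rmult_lt_0_compat; lra. lra. }
    unfold Rdiv. lra. }
  assert (Z : filterlim (half_line_primitive alpha (S n)) (at_right 0) (locally 0)).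
  { apply (Rlim0_plus (at_right 0)). apply (Rlim0_scal (at_right 0)).
    now apply truncated_primitive_at_0.
    assert (A : filterlim (fun y => Rpower y (1 - alpha) + Rpower y alpha) (at_right 0)
      (locally 0)).
    { apply (Rlim0_plus (at_right 0)); apply Rpower_at_0; lra. }
    apply (Rlim0 (at_right 0)). intros ee. generalize (proj1 (Rlim0 (at_right 0) _) A ee).
    intros [d Hd]. exists d. intros y Hy Hy0. apply Rle_lt_trans with (2 := Hd y Hy Hy0).
    assert (Q1 := Rpower_pos y (1 - alpha)). assert (Q2 := Rpower_pos y alpha).
    unfold Rdiv. rewrite Rabs_mult, (Rabs_pos_eq (/ (1 + y))) by (apply Rlt_le, Rinv_0_lt_compat;
      lra).
    rewrite <- (Rmult_1_r (Rabs (_ + _))). apply Rmult_le_compat. apply Rabs_pos.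
    apply Rlt_le, Rinv_0_lt_compat; lra.
    rewrite (Rabs_pos_eq (_ + _)) by lra. apply Rabs_le. lra.
    rewrite <- Rinv_1. apply Rinv_le_contravar; lra. }
  destruct (proj1 (Rlim0 (at_right 0) _) Z (mkposreal _ P3)) as [d Hd]. simpl in Hd.
  exists (Rmin 1 d). split. split. apply Rmin_pos. lra. apply cond_pos. apply Rmin_l.
  intros eps Heps. assert (M1 := Rmin_l 1 d). assert (M2 := Rmin_r 1 d).
  rewrite beta_half_line by lra. assert (E := half_line_estimate alpha n eps Ha ltac:(lra)).
  assert (Hd' : Rabs (half_line_primitive alpha (S n) eps) < e / 3).
  { apply Hd; [|lra]. apply Rabs_ball. rewrite Rminus_0_r, Rabs_pos_eq; lra. }
  assert (V1 : half_line_primitive alpha (S n) 1 = alpha * alternating_sum alpha (S n)).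
  { unfold half_line_primitive. rewrite truncated_primitive_1.
    replace (Rpower 1 (1 - alpha)) with 1 by (unfold Rpower; rewrite ln_1, Rmult_0_r, exp_0; auto).
    replace (Rpower 1 alpha) with 1 by (unfold Rpower; rewrite ln_1, Rmult_0_r, exp_0; auto).
    field. }
  rewrite V1 in E. replace (alpha * PI / sin (alpha * PI)) with (alpha * (PI / sin (alpha * PI)))
    by (unfold Rdiv; ring).
  apply Rabs_lt_between in HN1. apply Rabs_lt_between in Hd'. apply Rabs_le_between in E.
  apply Rabs_lt_between. lra.
Qed.

Lemma beta_kernel_nonneg alpha s : 0 <= beta_kernel alpha alpha s.
Proof. apply Rmult_le_pos; apply Rlt_le, Rpower_pos. Qed.

Lemma beta_integral_le alpha a b : 0 < alpha < 1 -> 0 < a -> a <= b -> b < 1 ->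
  RInt (beta_kernel alpha alpha) a b <= alpha * PI / sin (alpha * PI).
Proof.
  intros Ha H1 H2 H3. apply le_epsilon. intros e He.
  destruct (beta_symmetric_limit alpha e Ha He) as [d [Hd K]].
  (* t <= a and t <= 1 - b place [a, b] inside the symmetric interval from t / (1 + t) to 1 / (1 +
     t). *)
  pose (t := Rmin (d / 2) (Rmin a (1 - b))).
  assert (Ht : 0 < t < d /\ t <= a /\ t <= 1 - b).
  { unfold t. split; [split|split].
    - repeat apply Rmin_pos; lra.
    - eapply Rle_lt_trans. apply Rmin_l. lra.
    - eapply Rle_trans. apply Rmin_r. apply Rmin_l.
    - eapply Rle_trans. apply Rmin_r. apply Rmin_r. }
  clearbody t.
  specialize (K t ltac:(lra)). apply Rabs_lt_between in K.
  assert (I : (1 + t) * / (1 + t) = 1) by (apply Rinv_r; lra).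
  assert (P : 0 < / (1 + t)) by (apply Rinv_0_lt_compat; lra).
  apply Rle_trans with (RInt (beta_kernel alpha alpha) (t / (1 + t)) (/ (1 + t))); [|lra].
  apply RInt_mono_interval; auto; unfold Rdiv; try nra.
  - intros; apply beta_kernel_nonneg.
  - intros; now apply beta_kernel_continuous.
Qed.

Lemma beta_integral_approx alpha e : 0 < alpha < 1 -> 0 < e ->
  exists a b, 0 < a /\ a <= b /\ b < 1 /\
  alpha * PI / sin (alpha * PI) - e < RInt (beta_kernel alpha alpha) a b.
Proof.
  intros Ha He. destruct (beta_symmetric_limit alpha e Ha He) as [d [Hd K]].
  specialize (K (d / 2) ltac:(lra)). apply Rabs_lt_between in K.
  assert (I : (1 + d / 2) * / (1 + d / 2) = 1) by (apply Rinv_r; lra).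
  assert (P : 0 < / (1 + d / 2)) by (apply Rinv_0_lt_compat; lra).
  exists (d / 2 / (1 + d / 2)), (/ (1 + d / 2)). set (u := / (1 + d / 2)) in *.
  assert (Q : d / 2 / (1 + d / 2) = d / 2 * u) by (unfold u, Rdiv; ring).
  rewrite Q in *. repeat split; try nra.
Qed.

(** * Norms *)

Lemma sup_disk_le h (M : R) : (forall z, in_disk z -> h z <= M) -> Rbar_le (sup_disk h) M.
Proof.
  intros H. apply (proj2 (Lub_Rbar_correct _)). intros x [z [Hz ->]]. now apply H.
Qed.

Lemma sup_disk_ge (h : C -> R) z : in_disk z -> Rbar_le (h z) (sup_disk h).
Proof. intros Hz. apply (proj1 (Lub_Rbar_correct (fun x => exists z, in_disk z /\ x = h z))).
now exists z. Qed.

Lemma zero_in_disk : in_disk 0.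
Proof. unfold in_disk. rewrite Cmod_0. lra. Qed.

Lemma sup_disk_finite h : Rbar_lt (sup_disk h) p_infty -> exists s, sup_disk h = Finite s.
Proof.
  intros H. generalize (sup_disk_ge h 0 zero_in_disk).
  destruct (sup_disk h) as [s| |]; simpl in *; try easy.
  intros _. now exists s.
Qed.

Lemma one_minus_Cmod_sq z : in_disk z -> 0 < 1 - Cmod z ^ 2.
Proof. unfold in_disk. generalize (Cmod_ge_0 z). intros. nra. Qed.

Lemma korenblum_growth alpha f (M : R) : Rbar_le (korenblum_norm alpha f) M -> growth f M alpha.
Proof.
  intros H z Hz. assert (K := Rbar_le_trans _ _ _ (sup_disk_ge _ z Hz) H). simpl in K.
  rewrite Rpower_Ropp. assert (P := Rpower_pos (1 - Cmod z ^ 2) alpha). simpl in P.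
  apply Rmult_le_reg_l with (1 := P). apply Rle_trans with (1 := K). apply Req_le. simpl. field.
  lra.
Qed.

Lemma growth_korenblum alpha f M : growth f M alpha -> Rbar_le (korenblum_norm alpha f) M.
Proof.
  intros H. apply sup_disk_le. intros z Hz. assert (P := Rpower_pos (1 - Cmod z ^ 2) alpha).
  apply Rle_trans with (Rpower (1 - Cmod z ^ 2) alpha * (M * Rpower (1 - Cmod z ^ 2) (- alpha))).
  apply Rmult_le_compat_l. lra. now apply H. rewrite Rpower_Ropp. apply Req_le. field. lra.
Qed.

Lemma in_space_korenblum alpha f : in_space (korenblum_norm alpha) f -> exists M, growth f M alpha.
Proof.
  intros [_ H]. destruct (sup_disk_finite _ H) as [M HM]. exists M. apply korenblum_growth.
  unfold korenblum_norm. rewrite HM. apply Rbar_le_refl.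
Qed.

Lemma is_hilbert_coefs f g : is_hilbert f g -> exists a b, hilbert_coefs f a b /\ g 0 = b 0%nat /\
  forall z, in_disk z -> C_derive g z = PSum (Cderiv b) z.
Proof.
  intros [a [b [H1 [H2 [H3 _]]]]].
  assert (Fa : expansion a f).
  { intros z Hz. apply is_pseries_Cseries. now apply H1. }
  assert (Gb : expansion b g).
  { intros z Hz. apply is_pseries_Cseries. now apply H3. }
  exists a, b. repeat split; auto.
  - now apply (expansion_conv_disk b g).
  - intros n. apply is_series_Cseries. apply H2.
  - rewrite <- (PSum_0 b). symmetry. apply CSer_unique. apply Gb. apply zero_in_disk.
  - intros z Hz. apply is_C_derive_unique. apply Cdiff_is_derive. now apply pseries_Cdiff.
Qed.

Lemma is_hilbert_exists f M alpha : analytic_on_disk f -> 0 < alpha < 1 -> growth f M alpha ->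
  exists g, is_hilbert f g /\ analytic_on_disk g.
Proof.
  intros Hf Ha HM. set (a := tcoef f (1 / 2)).
  destruct (partial_sum_bound f M alpha Hf Ha HM) as [K HK].
  destruct (moment_series a K ((1 + alpha) / 2) ltac:(lra) HK) as [B HB].
  pose (b := fun n => CSer (fun k => Cdiv (a k) (RtoC (INR (n + k + 1))))).
  assert (Hb : forall n, Cseries (fun k => Cdiv (a k) (RtoC (INR (n + k + 1)))) (b n)
    /\ Cmod (b n) <= B).
  { intros n. destruct (HB n) as [s [H1 H2]]. unfold b. now rewrite (CSer_unique _ _ H1). }
  assert (Db : conv_disk b) by (apply (conv_disk_bounded _ B); intros n; apply Hb).
  assert (An : analytic_on_disk (PSum b)).
  { intros z Hz. exists (PSum (Cderiv b) z). apply Cdiff_is_derive. now apply PSum_Cdiff. }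
  exists (PSum b). split; auto. exists a, b. repeat split; auto.
  - intros z Hz. apply is_pseries_Cseries.
    assert (Pz := Cmod_ge_0 z). unfold in_disk in Hz.
    (* The expansion at z needs a circle enclosing z; by [tcoef_indep] its coefficients are those of
       radius 1/2. *)
    apply (Cseries_ext (fun n => tcoef f ((Cmod z + 1) / 2) n * z ^ n)%C).
    + intros n. unfold a. rewrite (tcoef_indep f (1 / 2) ((Cmod z + 1) / 2)) by (auto; lra).
      reflexivity.
    + apply taylor; auto; lra.
  - intros n. apply is_series_Cseries. apply Hb.
  - intros z Hz. apply is_pseries_Cseries. now apply PSum_correct.
Qed.

Lemma bloch_norm_upper f g M alpha k C0 : 0 < alpha < 1 -> growth f M alpha -> is_hilbert f g ->
  (alpha <= 2 / 3 /\ k = beta_kernel alpha alpha \/ 1 / 2 <= alpha /\ k = beta_kernel (1 - alpha)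
    alpha) ->
  (forall u v, 0 < u -> u <= v -> v < 1 -> RInt k u v <= C0) ->
  Rbar_le (bloch_norm (alpha + 1) g)
    (Finite (M * integral01 (fun t => 1 / Rpower (1 - t ^ 2) alpha) + M * (2 * C0))).
Proof.
  intros Ha HM Hg Hk HC. destruct (is_hilbert_coefs f g Hg) as [a [b [Hab [G0 Gd]]]].
  apply (Rbar_plus_le_compat _ (Finite _) _ (Finite _)).
  - simpl. rewrite G0. now apply (hilbert_value_bound a b f).
  - apply sup_disk_le. intros z Hz. rewrite Gd by auto.
    apply (hilbert_deriv_bound a b f M alpha z k C0); auto.
    + intros s Hs. apply kernel_bound; auto; try lra.
      destruct Hk as [[H ->]|[H ->]]; [left|right]; auto.
    + intros s Hs. destruct Hk as [[H ->]|[H ->]]. now apply beta_kernel_continuous.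
      now apply beta_kernel_continuous.
Qed.

Lemma Rbar_lub_is_lub E : Rbar_is_lub E (Rbar_lub E).
Proof. unfold Rbar_lub. now destruct (Rbar_ex_lub E). Qed.

Lemma hilbert_bounded_upper alpha k C0 : 0 < alpha < 1 ->
  (alpha <= 2 / 3 /\ k = beta_kernel alpha alpha \/ 1 / 2 <= alpha /\ k = beta_kernel (1 - alpha)
    alpha) ->
  (forall u v, 0 < u -> u <= v -> v < 1 -> RInt k u v <= C0) ->
  hilbert_bounded (korenblum_norm alpha) (bloch_norm (alpha + 1)) /\
  Rbar_le (hilbert_norm (korenblum_norm alpha) (bloch_norm (alpha + 1)))
    (Finite (integral01 (fun t => 1 / Rpower (1 - t ^ 2) alpha) + 2 * C0)).
Proof.
  intros Ha Hk HC.
  assert (U : Rbar_le (hilbert_norm (korenblum_norm alpha) (bloch_norm (alpha + 1)))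
    (Finite (integral01 (fun t => 1 / Rpower (1 - t ^ 2) alpha) + 2 * C0))).
  { apply (proj2 (Rbar_lub_is_lub _)). intros y [f [g [_ [H1 [H2 ->]]]]].
    apply korenblum_growth in H1. generalize (bloch_norm_upper f g 1 alpha k C0 Ha H1 H2 Hk HC).
    now rewrite !Rmult_1_l. }
  split; auto. split.
  - intros f Hf. destruct (in_space_korenblum alpha f Hf) as [M HM].
    destruct (is_hilbert_exists f M alpha (proj1 Hf) Ha HM) as [g [G1 G2]].
    exists g. repeat split; auto.
    apply Rbar_le_lt_trans with (1 := bloch_norm_upper f g M alpha k C0 Ha HM G1 Hk HC). easy.
  - apply Rbar_le_lt_trans with (1 := U). easy.
Qed.

(** Boundedness supplies an image of the extremal function and makes its seminorm finite, so the
    comparison becomes one between real numbers. Value at 0 and seminorm are bounded below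
    separately, by the same function. *)
Lemma hilbert_norm_lower alpha : 0 < alpha < 1 ->
  hilbert_bounded (korenblum_norm alpha) (bloch_norm (alpha + 1)) ->
  Rbar_le (Finite (integral01 (fun t => 1 / Rpower (1 - t ^ 2) alpha)
    + 2 * (alpha * PI / sin (alpha * PI))))
    (hilbert_norm (korenblum_norm alpha) (bloch_norm (alpha + 1))).
Proof.
  intros Ha [HB _]. assert (N1 := growth_korenblum _ _ _ (extremal_growth alpha Ha)).
  assert (Sp : in_space (korenblum_norm alpha) (extremal alpha)).
  { split. now apply extremal_analytic. apply Rbar_le_lt_trans with (1 := N1). easy. }
  destruct (HB _ Sp) as [g [Hg [_ Fg]]].
  apply Rbar_le_trans with (bloch_norm (alpha + 1) g).
  2: { apply (proj1 (Rbar_lub_is_lub _)). exists (extremal alpha), g.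
  repeat split; auto; apply Sp. }
  destruct (is_hilbert_coefs _ g Hg) as [a [b [Hab [G0 Gd]]]].
  unfold bloch_norm in *.
  set (h := fun z => Rpower (1 - Cmod z ^ 2) (alpha + 1) * Cmod (C_derive g z)) in *.
  assert (E : exists s, sup_disk h = Finite s).
  { apply sup_disk_finite. destruct (sup_disk h); simpl in *; auto. }
  destruct E as [s Es]. rewrite Es.
  change (integral01 (fun t => 1 / Rpower (1 - t ^ 2) alpha) + 2 * (alpha * PI / sin (alpha * PI))
    <= Cmod (g 0) + s).
  apply Rplus_le_compat.
  - rewrite G0. apply le_epsilon. intros e He.
    destruct (integral01_spec (fun t => 1 / Rpower (1 - t ^ 2) alpha) (/ (1 - alpha))) as [_ I].
    + intros x _. unfold Rdiv. rewrite Rmult_1_l, <- Rpower_Ropp. apply Rlt_le, Rpower_pos.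
    + intros x Hx. now apply extremal_continuous.
    + intros u v H1 H2 H3. now apply extremal_integral_le.
    + destruct (I e He) as [u [v [H1 [H2 [H3 H4]]]]].
      generalize (extremal_value_lower alpha a b u v Ha Hab H1 H2 H3). lra.
  - apply le_epsilon. intros e He.
    destruct (beta_integral_approx alpha (e / 2) Ha ltac:(lra)) as [u [v [H1 [H2 [H3 H4]]]]].
    assert (L : 2 * RInt (beta_kernel alpha alpha) u v <= s); [|lra].
    apply (extremal_seminorm_lower alpha a b u v s Ha Hab H1 H2 H3).
    intros z Hz. rewrite <- Gd by auto. generalize (sup_disk_ge h z Hz). rewrite Es. auto.
Qed.

Lemma beta_kernel_reflect alpha u v : 0 < alpha < 1 -> 0 < u -> u <= v -> v < 1 ->
  RInt (beta_kernel (1 - alpha) alpha) u v = RInt (fun t => Rpower (1 - t) (1 - alpha)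
    / Rpower t alpha) (1 - v) (1 - u).
Proof.
  intros Ha H1 H2 H3.
  assert (E : forall x y, 0 < x < 1 -> 0 < y < 1 -> ex_RInt (beta_kernel (1 - alpha) alpha) x y).
  { intros x y Hx Hy. apply (ex_RInt_continuous (V := R_CompleteNormedModule)). intros t Ht.
    apply beta_kernel_continuous.
    assert (0 < Rmin x y) by (apply Rmin_glb_lt; lra).
    assert (Rmax x y < 1) by (apply Rmax_lub_lt; lra). lra. }
  assert (C := RInt_comp_lin (V := R_CompleteNormedModule) (beta_kernel (1 - alpha) alpha) (-1)
    1 (1 - v) (1 - u)).
  replace (-1 * (1 - v) + 1) with v in C by ring. replace (-1 * (1 - u) + 1) with u in C by ring.
  specialize (C (E v u ltac:(lra) ltac:(lra))).
  rewrite <- (opp_RInt_swap (beta_kernel (1 - alpha) alpha)) by (apply E; lra). rewrite <- C.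
  rewrite <- (RInt_opp (V := R_CompleteNormedModule)).
  - apply RInt_ext. rewrite Rmin_left, Rmax_right by lra. intros t Ht. unfold opp, scal; simpl.
    unfold mult; simpl.
    unfold beta_kernel, Rdiv. rewrite <- Rpower_Ropp.
    replace (-1 * t + 1) with (1 - t) by ring. replace (1 - (1 - t)) with t by ring. ring.
  - apply (ex_RInt_comp_lin (V := R_NormedModule) (beta_kernel (1 - alpha) alpha) (-1) 1).
    replace (-1 * (1 - v) + 1) with v by ring. replace (-1 * (1 - u) + 1) with u by ring.
    apply E; lra.
Qed.

Lemma beta_kernel_integral01 alpha u v : 0 < alpha < 1 -> 0 < u -> u <= v -> v < 1 ->
  RInt (beta_kernel (1 - alpha) alpha) u v <= integral01 (fun t => Rpower (1 - t) (1 - alpha)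
    / Rpower t alpha).
Proof.
  intros Ha H1 H2 H3. rewrite beta_kernel_reflect by auto.
  destruct (integral01_spec (fun t => Rpower (1 - t) (1 - alpha) / Rpower t alpha)
    (/ (1 - alpha))) as [I _].
  - intros x _. apply Rlt_le, Rdiv_lt_0_compat; apply Rpower_pos.
  - intros x Hx. apply continuous_of_ex_derive. unfold Rpower. auto_derive. repeat split; try lra.
    apply Rgt_not_eq, exp_pos.
  - intros x y Hx Hxy Hy. generalize (beta_kernel_reflect alpha (1 - y) (1 - x) Ha ltac:(lra)
      ltac:(lra) ltac:(lra)).
    replace (1 - (1 - x)) with x by ring. replace (1 - (1 - y)) with y by ring. intros <-.
    apply beta_kernel_integral_le; lra.
  - apply I; lra.
Qed.

(** * The unbounded range *)

Lemma geom_analytic : analytic_on_disk (fun z => / (1 - z))%C.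
Proof.
  intros z Hz. eexists. apply Cdiff_is_derive. apply (Cdiff_inv (fun z => 1 - z)%C).
  now apply one_minus_nz. apply (Cdiff_ext_loc (fun z => RtoC 1 + (- (1)) * z)%C).
  apply filter_forall. intros w. ring.
  apply Cdiff_plus. apply Cdiff_const. apply (Cdiff_mult (fun _ => (- (1))%C) (fun z => z)).
  apply Cdiff_const. apply Cdiff_id.
Qed.

Lemma geom_growth alpha z : 1 <= alpha -> in_disk z ->
  Rpower (1 - Cmod z ^ 2) alpha * Cmod (/ (1 - z)) <= 2.
Proof.
  intros Ha Hz. assert (N := one_minus_nz z Hz). assert (P := one_minus_Cmod_sq z Hz).
  assert (Pz := Cmod_ge_0 z).
  unfold in_disk in Hz. rewrite Cmod_inv by auto. set (r := Cmod z) in *.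
  assert (D1 : 1 - r <= Cmod (1 - z)).
  { generalize (Cmod_triangle_inv 1 z). rewrite Cmod_1. fold r. generalize (Rle_abs (1 - r)). lra. }
  assert (L : Rpower (1 - r ^ 2) alpha <= 1 - r ^ 2).
  { replace alpha with (1 + (alpha - 1)) by ring. rewrite Rpower_plus, Rpower_1 by auto.
    assert (Q := Rpower_le_1 (1 - r ^ 2) (alpha - 1) ltac:(split; [auto|generalize (pow2_ge_0 r);
      lra]) ltac:(lra)).
    assert (Q' := Rpower_pos (1 - r ^ 2) (alpha - 1)). nra. }
  apply Rle_trans with ((1 - r ^ 2) * / (1 - r)).
  - apply Rmult_le_compat; auto. apply Rlt_le, Rpower_pos. apply Rlt_le, Rinv_0_lt_compat; lra.
    apply Rinv_le_contravar; lra.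
  - replace ((1 - r ^ 2) * / (1 - r)) with (1 + r) by (field; lra). lra.
Qed.

Lemma harmonic_diverges : ~ ex_series (fun k => / INR (k + 1)).
Proof.
  intros E. assert (Pos : forall k, 0 < INR (k + 1)) by (intros k; apply lt_0_INR; lia).
  assert (L : forall n, ln (INR (n + 2)) <= @sum_n R_AbelianMonoid (fun k => / INR (k + 1)) n).
  { induction n.
    - rewrite sum_O. simpl. rewrite Rinv_1. generalize (ln_ge_1_inv (/ (1 + 1)) ltac:(lra)).
      rewrite ln_Rinv, Rinv_inv by lra. lra.
    - rewrite sum_Sn. unfold plus; simpl (AbelianMonoid.plus _ _ _).
      replace (S n + 2)%nat with (S (n + 2)) by lia. replace (S n + 1)%nat with (n + 2)%nat by lia.
      assert (P : 0 < INR (n + 2)) by (apply lt_0_INR; lia).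
      assert (G := ln_ge_1_inv (INR (n + 2) / INR (S (n + 2))) ltac:(rewrite S_INR;
        apply Rdiv_lt_0_compat; lra)).
      rewrite ln_div in G by (rewrite ?S_INR; lra). rewrite S_INR in *.
      replace (1 - / (INR (n + 2) / (INR (n + 2) + 1))) with (- / INR (n + 2)) in G by (field;
        lra). unfold plus; simpl (_ + _). lra. }
  set (S0 := Series (fun k => / INR (k + 1))).
  assert (B : forall n, ln (INR (n + 2)) <= S0).
  { intros n. apply Rle_trans with (1 := L n). apply sum_n_le_Series; auto. intros k.
    apply Rlt_le, Rinv_0_lt_compat, Pos. }
  destruct (INR_unbounded (exp S0)) as [n Hn].
  assert (exp (ln (INR (n + 2))) <= exp S0) by (apply exp_le_compat, B).
  rewrite exp_ln in H by (apply lt_0_INR; lia). rewrite plus_INR in H. simpl in H. lra.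
Qed.

(** The failure lies in the definition of the image: its constant coefficient would be the sum of
    the harmonic series. Hence the target exponent [beta] is arbitrary. Uniqueness of expansions
    excludes any other choice of coefficients for 1 / (1 - z). *)
Lemma hilbert_unbounded alpha beta : 1 <= alpha ->
  ~ hilbert_bounded (korenblum_norm alpha) (bloch_norm beta).
Proof.
  intros Ha [HB _]. destruct (HB (fun z => / (1 - z))%C) as [g [Hg _]].
  { split. apply geom_analytic. apply Rbar_le_lt_trans with (Finite 2). 2: easy.
    apply sup_disk_le. intros z Hz. now apply geom_growth. }
  destruct (is_hilbert_coefs _ g Hg) as [a [b [[Fa [_ Mb]] _]]].
  assert (D1 : conv_disk (fun _ => RtoC 1)) by (apply (conv_disk_bounded _ 1); intros;
    rewrite Cmod_1; lra).
  assert (E : forall n, a n = RtoC 1).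
  { apply (pseries_coef_unique a (fun _ => RtoC 1)); auto. now apply (expansion_conv_disk a _ Fa).
    intros z Hz.
    unfold PSum. rewrite (CSer_unique _ _ (Fa z Hz)). symmetry. apply CSer_unique.
    apply (Cseries_ext (fun n => z ^ n)%C). intros; ring. now apply geom_Cseries. }
  apply harmonic_diverges. exists (Re (b 0%nat)).
  apply (filterlim_ext (fun n => Re (Csum (fun k => Cdiv (a k) (RtoC (INR (0 + k + 1)))) n))).
  2: apply (Clim_Re eventually _ _ (Mb 0%nat)).
  intros n. rewrite Csum_Re. apply sum_n_ext. intros k.
  rewrite E, <- RtoC_div by (apply not_0_INR; lia).
  simpl (0 + k + 1)%nat. rewrite re_RtoC. unfold Rdiv. apply Rmult_1_l.
Qed.

Theorem theorem7p1 (alpha : R) (halpha : 0 < alpha) :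
  (alpha <= 2 / 3 ->
     hilbert_bounded (korenblum_norm alpha) (bloch_norm (alpha + 1)) /\
     hilbert_norm (korenblum_norm alpha) (bloch_norm (alpha + 1)) =
       Finite (integral01 (fun t => 1 / Rpower (1 - t ^ 2) alpha)
               + 2 * alpha * PI / sin (alpha * PI))) /\
  (2 / 3 < alpha < 1 ->
     hilbert_bounded (korenblum_norm alpha) (bloch_norm (alpha + 1)) /\
     Rbar_le
       (Finite (integral01 (fun t => 1 / Rpower (1 - t ^ 2) alpha)
                + 2 * alpha * PI / sin (alpha * PI)))
       (hilbert_norm (korenblum_norm alpha) (bloch_norm (alpha + 1))) /\
     Rbar_le
       (hilbert_norm (korenblum_norm alpha) (bloch_norm (alpha + 1)))
       (Finite (integral01 (fun t => 1 / Rpower (1 - t ^ 2) alpha)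
                + 2 * integral01 (fun t => Rpower (1 - t) (1 - alpha)
                                           / Rpower t alpha)))) /\
  (1 <= alpha ->
     ~ hilbert_bounded (korenblum_norm alpha) (bloch_norm (alpha + 1))).
Proof.
  replace (2 * alpha * PI / sin (alpha * PI)) with (2 * (alpha * PI / sin (alpha * PI)))
    by (unfold Rdiv; ring).
  split; [|split].
  - intros H. assert (Ha : 0 < alpha < 1) by lra.
    destruct (hilbert_bounded_upper alpha (beta_kernel alpha alpha)
      (alpha * PI / sin (alpha * PI)) Ha) as [B U]; auto.
    { intros u v. now apply beta_integral_le. }
    split; auto. apply Rbar_le_antisym; auto. now apply hilbert_norm_lower.
  - intros H. assert (Ha : 0 < alpha < 1) by lra.
    destruct (hilbert_bounded_upper alpha (beta_kernel (1 - alpha) alpha)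
      (integral01 (fun t => Rpower (1 - t) (1 - alpha) / Rpower t alpha)) Ha) as [B U].
    { right. split; auto; lra. }
    { intros u v. now apply beta_kernel_integral01. }
    repeat split; auto; try apply B. now apply hilbert_norm_lower.
  - intros H. now apply hilbert_unbounded.
Qed.
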